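(* Let $f\in C^\infty(\mathbb{R}^d)$ be a tempered distribution such that $\operatorname{supp}\mathcal{F}f$ is compact. Let $P$ be a polynomial. Then $\widetilde R(P,f)=R(P,\mathcal{F}f)$.
   Context: $\mathbb{N}=\{1,2,3,\ldots\}$, $\mathbb{N}_0=\{0,1,2,\ldots\}$. Polynomials are on $\mathbb{R}^d$ with complex coefficients. For a polynomial $P$, $P(\partial)$ is the corresponding constant coefficient differential operator, so that $P(\partial)e^{i\lambda\cdot x}=P(i\lambda)e^{i\lambda\cdot x}$. The Fourier transform is $\mathcal{F}f(\lambda)=(2\pi)^{-d/2}\int_{\mathbb{R}^d}f(x)e^{-i\lambda\cdot x}\,dx$ on $L^1(\mathbb{R}^d)$, extended to tempered distributions by $\langle\mathcal{F}T,\phi\rangle=\langle T,\mathcal{F}\phi\rangle$ for Schwartz functions $\phi$. For a distribution $T$ on $\mathbb{R}^d$, $R(P,T)=\sup\{|P(i\lambda)|:\lambda\in\operatorname{supp}T\}\in[0,\infty]$, with $R(P,T)=0$ if $T=0$. For $f\in C^\infty(\mathbb{R}^d)$ a tempered distribution with $\operatorname{supp}\mathcal{F}f$ compact, $\widetilde R(P,f)$ is the infimum of all $R\ge 0$ for which there exist constants $N\in\mathbb{N}_0$ and $C_{N,R}\ge 0$ such that, for all $n\in\mathbb{N}$ and $x\in\mathbb{R}^d$, $|P(\partial)^n f(x)|\le C_{N,R}\,n^N R^n(1+|x|)^N$. *)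

(* Defs.v *)
From HB Require Import structures.
From mathcomp Require Import all_boot all_order all_algebra.
From mathcomp Require Import complex.
(* The notations of mpoly cannot be parsed together with those of
   mathcomp-analysis, hence the selective import. *)
From mathcomp Require Import -(notations) mpoly.
From mathcomp Require Import all_classical all_reals all_analysis.

Set Implicit Arguments.
Unset Strict Implicit.
Unset Printing Implicit Defensive.

Import Order.TTheory GRing.Theory Num.Theory.
Import numFieldNormedType.Exports.

Local Open Scope classical_set_scope.
Local Open Scope ring_scope.
Local Open Scope complex_scope.

Notation normc := ComplexField.Normc.normc.

Section LebesgueMeasureRn.
Context (R : realType).
Local Notation B := (measurableTypeR R).

Definition tuple_cons n (p : B * n.-tuple B) : n.+1.-tuple B :=
  [tuple of p.1 :: p.2].

Definition tuple_uncons n (t : n.+1.-tuple B) : B * n.-tuple B :=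
  (thead t, [tuple of behead t]).

Lemma tuple_consK n : cancel (@tuple_cons n) (@tuple_uncons n).
Proof.
by move=> [x t]; rewrite /tuple_uncons /tuple_cons theadE; congr pair; exact: val_inj.
Qed.

Lemma measurable_tuple_cons n : measurable_fun [set: _] (@tuple_cons n).
Proof. by apply: measurable_cons. Qed.

Lemma measurable_tuple_uncons n : measurable_fun [set: _] (@tuple_uncons n).
Proof.
by apply: measurable_fun_pair; [exact: measurable_tnth | exact: measurable_behead].
Qed.

Section step.
Context n (m : {sigma_finite_measure set (n.-tuple B) -> \bar R}).

Definition lebesgue_cons : set (n.+1.-tuple B) -> \bar R :=
  pushforward (lebesgue_measure \x m)%E (@tuple_cons n).

Let lebesgue_cons0 : lebesgue_cons set0 = 0%E.
Proof. by rewrite /lebesgue_cons /pushforward preimage_set0 measure0. Qed.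

Let lebesgue_cons_ge0 A : (0 <= lebesgue_cons A)%E.
Proof. exact: (measure_ge0 (lebesgue_measure \x m)%E). Qed.

Let lebesgue_cons_sigma_additive : semi_sigma_additive lebesgue_cons.
Proof.
exact: (@measure_semi_sigma_additive _ _ _
  (@measure_function_pushforward__canonical__measure_function_Measure _ _ _ _ _
     (lebesgue_measure \x m)%E _ (@measurable_tuple_cons n))).
Qed.

HB.instance Definition _ := isMeasure.Build _ _ _ lebesgue_cons
  lebesgue_cons0 lebesgue_cons_ge0 lebesgue_cons_sigma_additive.

Let lebesgue_cons_sigma_finite : sigma_finite setT lebesgue_cons.
Proof.
have /sigma_finiteP[F [TF ndF Foo]] := sigma_finiteT (@lebesgue_measure R).
have /sigma_finiteP[G [TG ndG Goo]] := sigma_finiteT m.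
exists (fun k => @tuple_uncons n @^-1` (F k `*` G k)).
  rewrite -preimage_bigcup (_ : \bigcup_k _ = setT) ?preimage_setT//.
  rewrite -setXTT TF TG predeqE => -[x y]; split => [[k _ []/= ? ?]|].
    by split; exists k.
  move=> [/= [k _ Fkx] [l _ Gly]]; exists (maxn k l) => //; split.
    by move: x Fkx; exact/subsetPset/ndF/leq_maxl.
  by move: y Gly; exact/subsetPset/ndG/leq_maxr.
move=> k; have [mF Fk] := Foo k; have [mG Gk] := Goo k; split.
  rewrite -[X in measurable X]setTI; apply: measurable_tuple_uncons => //.
  exact: measurableX.
rewrite /lebesgue_cons /pushforward -comp_preimage.
rewrite (_ : _ \o _ = id) ?preimage_id; last first.
  by apply/funext => p; exact: tuple_consK.
by rewrite product_measure1E// lte_mul_pinfty// ge0_fin_numE.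
Qed.

HB.instance Definition _ := Measure_isSigmaFinite.Build _ _ _ lebesgue_cons
  lebesgue_cons_sigma_finite.

End step.

Fixpoint lebesgue_tuple n : {sigma_finite_measure set (n.-tuple B) -> \bar R} :=
  match n with
  | 0 => \d_([tuple] : 0.-tuple B)
  | n'.+1 => lebesgue_cons (lebesgue_tuple n')
  end.

End LebesgueMeasureRn.

Section PaleyWiener.
Context (R : realType) (n : nat).
Local Notation C := R[i].
Local Notation V := 'rV[R]_n.
Implicit Types (f g phi : V -> C) (x y l : V).

Definition dotp x y : R := \sum_(j < n) x 0 j * y 0 j.

(* The library norm on row vectors is the sup norm. *)
Definition enorm x : R := Num.sqrt (dotp x x).

Definition expi (t : R) : C := cos t +i* sin t.

Definition cintegral f : C :=
  let F (t : n.-tuple (measurableTypeR R)) := f (\row_j (tnth t j : R)) in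
  (\int[lebesgue_tuple R n]_t complex.Re (F t))
  +i* (\int[lebesgue_tuple R n]_t complex.Im (F t)).

Definition partial (j : 'I_n) f : V -> C := fun x =>
  'D_(delta_mx 0 j) (fun y => complex.Re (f y)) x
  +i* 'D_(delta_mx 0 j) (fun y => complex.Im (f y)) x.

Definition smooth f : Prop := forall s : seq 'I_n,
  let g := foldr partial f s in
  [/\ continuous (fun x => complex.Re (g x)),
      continuous (fun x => complex.Im (g x)) &
      forall (j : 'I_n) x,
        derivable (fun y => complex.Re (g y)) x (delta_mx 0 j) /\
        derivable (fun y => complex.Im (g y)) x (delta_mx 0 j)].

Definition mpartial (a : multinom n) f : V -> C :=
  foldr (fun j g => iter (a j) (partial j) g) f (enum 'I_n).

Definition monomial (a : multinom n) x : R := \prod_(j < n) x 0 j ^+ a j.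

Definition diffop (P : mpoly n C) f : V -> C := fun x =>
  \sum_(a <- msupp P) mcoeff a P * mpartial a f x.

(* The symbol P(i l). *)
Definition symbol (P : mpoly n C) l : C := meval (fun j => 0 +i* l 0 j) P.

Definition fsupp phi : set V := closure [set x | phi x != 0].

Definition test_function phi : Prop := smooth phi /\ compact (fsupp phi).

Definition schwartz_seminorm (a b : multinom n) phi : \bar R :=
  ereal_sup (range (fun x => (normc ((monomial a x)%:C * mpartial b phi x))%:E)).

Definition schwartz phi : Prop :=
  smooth phi /\ forall a b, (schwartz_seminorm a b phi < +oo)%E.

(* Functionals are total on V -> C; only their values on Schwartz functions
   (resp. test functions) are ever constrained or used. *)
Implicit Types T : (V -> C) -> C.

Definition tempered_distribution T : Prop :=
  (forall (c : C) phi psi, schwartz phi -> schwartz psi ->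
     T (fun x => c * phi x + psi x) = c * T phi + T psi) /\
  (exists (k : nat) (c : R), forall phi, schwartz phi ->
     ((normc (T phi))%:E <= c%:E *
        \sum_(a : bmultinom n k) \sum_(b : bmultinom n k)
          schwartz_seminorm a b phi)%E).

(* The distribution given by the smooth function f is defined on test functions
   by integration; f is tempered when it extends to a tempered distribution T,
   which is then unique by density.  The integral of f * phi need not converge
   absolutely for phi merely Schwartz. *)
Definition extends_function f T : Prop :=
  forall phi, test_function phi -> T phi = cintegral (fun x => f x * phi x).

Definition fourier phi : V -> C := fun l =>
  ((2 * pi) `^ (- (n%:R / 2)))%:C
    * cintegral (fun x => phi x * expi (- dotp l x)).

Definition dist_fourier T : (V -> C) -> C := fun phi => T (fourier phi).

Definition vanishes_on T (U : set V) : Prop :=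
  forall phi, test_function phi -> fsupp phi `<=` U -> T phi = 0.

Definition dist_supp T : set V :=
  ~` \bigcup_(U in [set U : set V | open U /\ vanishes_on T U]) U.

Definition Rsupp (P : mpoly n C) T : \bar R :=
  if `[< vanishes_on T setT >] then 0%E
  else ereal_sup [set (normc (symbol P l))%:E | l in dist_supp T].

Definition Rtilde (P : mpoly n C) f : \bar R :=
  ereal_inf [set r%:E | r in [set r : R | 0 <= r /\
    exists (N : nat) (c : R), 0 <= c /\
      forall (k : nat) x, (0 < k)%N ->
        normc (iter k (diffop P) f x)
          <= c * k%:R ^+ N * r ^+ k * (1 + enorm x) ^+ N]].

End PaleyWiener.

(* Main.v *)
(* Idea.  Put S := F T and p := symbol P.  On Fourier transforms the transpose of
   P(d)^k is multiplication by p^k:  <P(d)^k f, F u> = T(F(p^k u)) = S(p^k u).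

   Upper bound.  If |p| < r on the compact supp S, a cutoff psi equal to 1 near
   supp S and supported in {|p| < r} gives S(p^k u) = S(p^k (psi u)), and the
   seminorms of p^k (psi u) grow like (k+1)^m r^k.  Taking F u = g to be a bump
   concentrated at x bounds P(d)^k f(x).  This needs Fourier inversion only for
   products of one-variable bumps, where it follows from Poisson kernels.

   Lower bound.  If P(d)^k f grows like k^N r^k and phi is supported in
   {|p| > r'} with r' > r, let a be smooth with a p = 1 there; then
   S(phi) = T(P(d)^k-transpose of F(a^k phi)) is bounded by a polynomial in k times
   (r/r')^k, so S(phi) = 0, and supp S is contained in {|p| <= r}. *)
Require Import Defs.
From HB Require Import structures.
From mathcomp Require Import all_boot all_order all_algebra.
From mathcomp Require Import complex ring lra.
From mathcomp Require Import all_classical all_reals all_analysis.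
From mathcomp Require Import measurable_realfun.
From mathcomp Require Import -(notations) mpoly.

Set Implicit Arguments.
Unset Strict Implicit.
Unset Printing Implicit Defensive.

Import Order.TTheory GRing.Theory Num.Theory.
Import numFieldNormedType.Exports.

Local Open Scope classical_set_scope.
Local Open Scope ring_scope.

(** * Iterated directional derivatives *)

(** [T] is tied to [f] on test functions only, and [f] carries no a priori growth bound. For a
    merely Schwartz [h], such as a Fourier transform, [T (iter k (adjop P) h)] is therefore not
    known to be an integral. The lower bound replaces [h] by [cutoff a 0] times [h]: there the
    integral is estimated uniformly in [a], and the error is at most a constant times [a]. That
    constant may depend on [k] and [h], because [a] tends to 0 before anything else happens.

    In the upper bound the obstacle is uniformity in the width of the bump: weighted seminorms of
    [u] blow up as the bump narrows. What survives are the derivatives of [u] without weight. They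
    are Fourier transforms of monomials times the bump, hence bounded by a constant times (1 +
    |x|)^m times the mass of the bump. The compact support of [psi] makes up for the missing weight,
    division by the mass gives the pointwise bound, and the exponent [N] comes out as the order [m]
    of the functional S. *)

HB.lock Definition pd {R : realType} {V : normedModType R} {J : Type}
  (e : J -> V) (j : J) (f : V -> R) : V -> R := fun x => 'D_(e j) f x.

Section Calculus.
Context {R : realType} {V : normedModType R} {J : Type} (e : J -> V).
Implicit Types f g : V -> R.
Local Notation pd := (@pd R V J e).

Lemma pdE j f x : pd j f x = 'D_(e j) f x. Proof. by rewrite pd.unlock. Qed.

Lemma is_derive_pdE j f x df : is_derive x (e j) f df -> pd j f x = df.
Proof. by move=> [_ <-]; exact: pdE. Qed.

Lemma pdD j f g x : derivable f x (e j) -> derivable g x (e j) ->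
  pd j (fun x => f x + g x) x = pd j f x + pd j g x.
Proof. by move=> df dg; rewrite !pdE; exact (deriveD df dg). Qed.

Lemma pdB j f g x : derivable f x (e j) -> derivable g x (e j) ->
  pd j (fun x => f x - g x) x = pd j f x - pd j g x.
Proof. by move=> df dg; rewrite !pdE; exact (deriveB df dg). Qed.

Lemma pdM j f g x : derivable f x (e j) -> derivable g x (e j) ->
  pd j (fun x => f x * g x) x = f x * pd j g x + g x * pd j f x.
Proof. by move=> df dg; rewrite !pdE; exact (deriveM df dg). Qed.

Lemma pd_cst j (c : R) x : pd j (fun=> c) x = 0.
Proof. by rewrite pdE; exact: derive_cst. Qed.

(** The family of directions [e] is arbitrary, so that the same closure lemmas serve row vectors
    (through [dir]) and the real line (through [unitdir]). *)
Fixpoint Cn (m : nat) f : Prop :=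
  match m with
  | 0 => continuous f
  | m'.+1 => [/\ continuous f, forall j x, derivable f x (e j) &
                 forall j, Cn m' (pd j f)]
  end.

Lemma CnW m f : Cn m.+1 f -> Cn m f.
Proof.
elim: m f => [|m IH] f /= [cf df Cf] //; split => // j; exact: IH (Cf j).
Qed.

Lemma Cn_cst m (c : R) : Cn m (fun=> c).
Proof.
elim: m c => [|m IH] c /=; first by move=> x; exact: cvg_cst.
split; [by move=> x; exact: cvg_cst|by move=> j x; exact: derivable_cst|].
by move=> j; rewrite (_ : pd j _ = fun=> 0)//; apply/funext => x; exact: pd_cst.
Qed.

Lemma CnD m f g : Cn m f -> Cn m g -> Cn m (fun x => f x + g x).
Proof.
elim: m f g => [|m IH] f g /=.
  by move=> cf cg x; apply: cvgD; [exact: cf|exact: cg].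
move=> [cf df Cf] [cg dg Cg]; split.
- by move=> x; apply: cvgD; [exact: cf|exact: cg].
- by move=> j x; apply: derivableD.
- move=> j; rewrite (_ : pd j _ = fun x => pd j f x + pd j g x); first exact: IH.
  by apply/funext => x; exact: pdD.
Qed.

Lemma CnM m f g : Cn m f -> Cn m g -> Cn m (fun x => f x * g x).
Proof.
elim: m f g => [|m IH] f g.
  by move=> /= cf cg x; apply: cvgM; [exact: cf|exact: cg].
move=> Cf' Cg'; have [/= [cf df Cf] [cg dg Cg]] := (Cf', Cg'); split.
- by move=> x; apply: cvgM; [exact: cf|exact: cg].
- by move=> j x; apply: derivableM.
- move=> j; rewrite (_ : pd j _ = fun x => f x * pd j g x + g x * pd j f x).
    by apply: CnD; apply: IH => //; exact: CnW.
  by apply/funext => x; exact: pdM.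
Qed.

Lemma CnN m f : Cn m f -> Cn m (fun x => - f x).
Proof.
move=> Cf; rewrite (_ : (fun _ => _) = fun x => -1 * f x).
  by apply: CnM => //; exact: Cn_cst.
by apply/funext => x; rewrite mulN1r.
Qed.

Lemma CnB m f g : Cn m f -> Cn m g -> Cn m (fun x => f x - g x).
Proof. by move=> Cf Cg; apply: CnD => //; exact: CnN. Qed.

Lemma Cn_sum m (I : Type) (r : seq I) (F : I -> V -> R) :
  (forall i, Cn m (F i)) -> Cn m (fun x => \sum_(i <- r) F i x).
Proof.
move=> CF; elim: r => [|i r IH].
  under eq_fun do rewrite big_nil; exact: Cn_cst.
by under eq_fun do rewrite big_cons; exact: CnD.
Qed.

Lemma Cn_prod m (I : Type) (r : seq I) (F : I -> V -> R) :
  (forall i, Cn m (F i)) -> Cn m (fun x => \prod_(i <- r) F i x).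
Proof.
move=> CF; elim: r => [|i r IH].
  under eq_fun do rewrite big_nil; exact: Cn_cst.
by under eq_fun do rewrite big_cons; exact: CnM.
Qed.

(* The derivative along [v] is an ordinary derivative in one variable, which
   gives access to the one-dimensional chain rule. *)
Lemma is_derive_line f x v df :
  is_derive x v f df <-> is_derive (0 : R) (1 : R) (fun h : R => f (h *: v + x)) df.
Proof.
have E : (fun h : R => h^-1 *: ((f \o shift x) (h *: v) - f x)) =
   (fun h : R => h^-1 *: (((fun h : R => f (h *: v + x)) \o shift 0) (h *: 1)
                - (fun h : R => f (h *: v + x)) 0)).
  by apply/funext => h /=; rewrite addr0 scale0r add0r /GRing.scale /= mulr1.
by split => -[H1 H2]; split; move: H1 H2; rewrite /derivable /derive E.
Qed.

Lemma is_derive_comp1 (h : R -> R) f x v (dh df : R) :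
  is_derive (f x) 1 h dh -> is_derive x v f df ->
  is_derive x v (fun y => h (f y)) (dh * df).
Proof.
move=> Hh /is_derive_line Hf; apply/is_derive_line.
rewrite mulrC.
have := @is_derive1_comp R h (fun k : R => f (k *: v + x)) 0 dh df.
by rewrite /= scale0r add0r mulrC; apply.
Qed.

Lemma is_derive_pd f x j : derivable f x (e j) -> is_derive x (e j) f (pd j f x).
Proof. by move=> df; split => //; rewrite pdE. Qed.

(* A family of functions of one variable stable under differentiation composes
   with functions of several variables. *)
Lemma Cn_comp (I : Type) (h : I -> R -> R) (D : I -> seq (R * I)) m i f :
  (forall i t, is_derive t (1 : R) (h i) (\sum_(c <- D i) c.1 * h c.2 t)) ->
  Cn m f -> Cn m (fun x => h i (f x)).
Proof.
move=> hD; have ch k : continuous (h k).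
  move=> t; apply: differentiable_continuous; apply/derivable1_diffP.
  by case: (hD k t).
elim: m i f => [|m IH] i f.
  by move=> /= cf x; apply: continuous_comp; [exact: cf|exact: ch].
move=> Cf'; have /= [cf df Cf] := Cf'.
have dhf j x : is_derive x (e j) (fun y => h i (f y))
    ((\sum_(c <- D i) c.1 * h c.2 (f x)) * pd j f x).
  exact: (is_derive_comp1 (hD i (f x)) (is_derive_pd (df j x))).
split.
- by move=> x; apply: continuous_comp; [exact: cf|exact: ch].
- by move=> j x; case: (dhf j x).
- move=> j; rewrite (_ : pd j _ =
     fun x => (\sum_(c <- D i) c.1 * h c.2 (f x)) * pd j f x).
    apply: CnM => //; apply: Cn_sum => c; apply: CnM; first exact: Cn_cst.
    by apply: IH; exact: CnW.
  by apply/funext => x; exact: is_derive_pdE.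
Qed.

Lemma CnV m f : (forall x, f x != 0) -> Cn m f -> Cn m (fun x => (f x)^-1).
Proof.
move=> f0; elim: m => [|m IH].
  by move=> /= cf x; apply: cvgV => //; exact: cf.
move=> Cf'; have /= [cf df Cf] := Cf'.
have Cg := IH (CnW Cf'); split.
- by move=> x; apply: cvgV => //; exact: cf.
- by move=> j x; apply: derivableV.
- move=> j; rewrite (_ : pd j _ = fun x => - ((f x)^-1 * (f x)^-1) * pd j f x).
    by apply: CnM => //; apply: CnN; exact: CnM.
  by apply/funext => x; rewrite !pdE deriveV// /GRing.scale/= -exprVn expr2.
Qed.

End Calculus.

(** * Complex-valued smooth functions *)

Section ComplexModulus.
Context {R : realType}.
Local Notation C := R[i].
Implicit Types x y : C.
Local Notation Re := complex.Re.
Local Notation Im := complex.Im.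

Lemma complexP x y : Re x = Re y -> Im x = Im y -> x = y.
Proof. by case: x y => [a b] [c d] /= -> ->. Qed.

Lemma cReD x y : Re (x + y) = Re x + Re y. Proof. by case: x y => [a b] [c d]. Qed.
Lemma cImD x y : Im (x + y) = Im x + Im y. Proof. by case: x y => [a b] [c d]. Qed.
Lemma cReM x y : Re (x * y) = Re x * Re y - Im x * Im y.
Proof. by case: x y => [a b] [c d]. Qed.
Lemma cImM x y : Im (x * y) = Re x * Im y + Im x * Re y.
Proof. by case: x y => [a b] [c d]. Qed.

Lemma normcN x : normc (- x) = normc x. Proof. exact: complex.normcN. Qed.
Lemma normcD x y : normc (x + y) <= normc x + normc y.
Proof. exact: complex.le_normcD. Qed.
Lemma normcM x y : normc (x * y) = normc x * normc y.
Proof. exact: ComplexField.Normc.normcM. Qed.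
Lemma normc_ge0 x : 0 <= normc x.
Proof. by case: x => a b /=; exact: sqrtr_ge0. Qed.
Lemma normc0 : normc (0 : C) = 0. Proof. exact: ComplexField.Normc.normc0. Qed.
Lemma normc_eq0 x : (normc x == 0) = (x == 0).
Proof.
apply/eqP/eqP => [/ComplexField.Normc.eq0_normc//|->]; exact: normc0.
Qed.
Lemma normcB x y : normc (x - y) <= normc x + normc y.
Proof. by rewrite -(normcN y); exact: normcD. Qed.
Lemma normcX x k : normc (x ^+ k) = normc x ^+ k.
Proof.
by elim: k => [|k IH]; rewrite ?expr0 ?exprS ?normcM ?IH//; exact: ComplexField.Normc.normc1.
Qed.
Lemma normc_real (a : R) : normc (a%:C)%C = `|a|.
Proof. by rewrite /= expr0n /= addr0 sqrtr_sqr. Qed.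
Lemma normc_Re x : `|Re x| <= normc x.
Proof.
case: x => a b /=; rewrite -sqrtr_sqr ler_wsqrtr// lerDl; exact: sqr_ge0.
Qed.
Lemma normc_Im x : `|Im x| <= normc x.
Proof.
case: x => a b /=; rewrite -sqrtr_sqr ler_wsqrtr// lerDr; exact: sqr_ge0.
Qed.
Lemma normc_le x : normc x <= `|Re x| + `|Im x|.
Proof.
case: x => a b /=; rewrite -[leRHS]ger0_norm ?addr_ge0// -[leRHS]sqrtr_sqr.
rewrite ler_wsqrtr// sqrrD !real_normK ?num_real// -addrA lerD2l lerDr.
by rewrite mulrn_wge0// mulr_ge0.
Qed.
End ComplexModulus.

Definition dir {R : realType} {n : nat} (j : 'I_n) : 'rV[R]_n := delta_mx 0 j.

HB.lock Definition cpd {R : realType} {n : nat} (j : 'I_n) (f : 'rV[R]_n -> R[i]) :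
  'rV[R]_n -> R[i] := fun x =>
  (pd dir j (fun y => complex.Re (f y)) x +i* pd dir j (fun y => complex.Im (f y)) x)%C.

(* [smooth] is a conjunction over all words of partial derivatives; the wrapper
   keeps the unifier from unfolding it. *)
Variant csmooth {R : realType} {n : nat} (f : 'rV[R]_n -> R[i]) : Prop :=
  CSmooth of smooth f.

Section SmoothComplex.
Context {R : realType} {n : nat}.
Local Notation C := R[i].
Local Notation V := 'rV[R]_n.
Local Notation Re := complex.Re.
Local Notation Im := complex.Im.
Local Notation Cn := (@Cn R V 'I_n (@dir R n)).
Implicit Types f g : V -> C.

Lemma partialE : @partial R n = cpd.
Proof.
apply/funext => j; apply/funext => f; apply/funext => x.
by rewrite cpd.unlock /partial !pdE.
Qed.

Lemma csmoothP f : smooth f <-> csmooth f.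
Proof. by split=> [|[]]. Qed.

(** Words are peeled at their last letter, which is the innermost derivative: the induction then
    changes the function and leaves the outer word alone. This turns the conjunction over words into
    the nested classes [Cn], whose closure properties are known. *)
Lemma csmoothE f : csmooth f <->
  forall m, Cn m (fun x => Re (f x)) /\ Cn m (fun x => Im (f x)).
Proof.
have sp g j : smooth g -> smooth (cpd j g).
  by move=> sg s; have := sg (rcons s j); rewrite foldr_rcons partialE.
split=> [[sf] m|Cf].
  elim: m f sf => [|m IH] f sf; first by have [] := sf [::].
  have [/= cr ci df] := sf [::].
  split; (split=> //; first by move=> j x; case: (df j x)).
    by move=> j; case: (IH _ (sp f j sf)); rewrite cpd.unlock.
  by move=> j; case: (IH _ (sp f j sf)); rewrite cpd.unlock.
split=> s; elim/last_ind: s f Cf => [|s j IH] f Cf.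
  have [[? dr _] [? di _]] := Cf 1%N.
  by split => // j x; split; [exact: (dr j x)|exact: (di j x)].
rewrite foldr_rcons; apply: IH => m; rewrite partialE cpd.unlock.
by have [[_ _ Cr] [_ _ Ci]] := Cf m.+1; split; [exact: Cr|exact: Ci].
Qed.

Lemma smooth_cpd f j : csmooth f -> csmooth (cpd j f).
Proof.
move=> /csmoothE Cf; apply/csmoothE => m; rewrite cpd.unlock.
by have [[_ _ Cr] [_ _ Ci]] := Cf m.+1; split; [exact: Cr|exact: Ci].
Qed.

Lemma smooth_foldr f s : csmooth f -> csmooth (foldr cpd f s).
Proof. by move=> sf; elim: s => [|j s IH] //=; exact: smooth_cpd. Qed.

Lemma smooth_cont f : csmooth f ->
  continuous (fun x => Re (f x)) /\ continuous (fun x => Im (f x)).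
Proof. by move=> /csmoothE/(_ 0%N). Qed.

Lemma smooth_derivable f j x : csmooth f ->
  derivable (fun y => Re (f y)) x (dir j) /\
  derivable (fun y => Im (f y)) x (dir j).
Proof. by move=> /csmoothE/(_ 1%N)[[_ dr _] [_ di _]]. Qed.

Lemma eq_smooth f g : (forall x, g x = f x) -> csmooth f -> csmooth g.
Proof. by move=> /funext ->. Qed.

Lemma smooth_cst (c : C) : csmooth (fun _ : V => c).
Proof. by apply/csmoothE => m; split; exact: Cn_cst. Qed.

Lemma smoothD f g : csmooth f -> csmooth g -> csmooth (fun x => f x + g x).
Proof.
move=> /csmoothE sf /csmoothE sg; apply/csmoothE => m.
have [? ?] := sf m; have [? ?] := sg m; split.
  by under [X in Cn _ X]eq_fun do rewrite cReD; exact: CnD.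
by under [X in Cn _ X]eq_fun do rewrite cImD; exact: CnD.
Qed.

Lemma smoothM f g : csmooth f -> csmooth g -> csmooth (fun x => f x * g x).
Proof.
move=> /csmoothE sf /csmoothE sg; apply/csmoothE => m.
have [? ?] := sf m; have [? ?] := sg m; split.
  by under [X in Cn _ X]eq_fun do rewrite cReM; apply: CnB; exact: CnM.
by under [X in Cn _ X]eq_fun do rewrite cImM; apply: CnD; exact: CnM.
Qed.

Lemma smoothZ (c : C) f : csmooth f -> csmooth (fun x => c * f x).
Proof. exact: smoothM (smooth_cst c). Qed.

Lemma smoothN f : csmooth f -> csmooth (fun x => - f x).
Proof. by move=> sf; apply: (eq_smooth _ (smoothZ (-1) sf)) => x; rewrite [RHS]mulN1r. Qed.

Lemma smoothB f g : csmooth f -> csmooth g -> csmooth (fun x => f x - g x).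
Proof. by move=> sf sg; exact: (smoothD sf (smoothN sg)). Qed.

Lemma smooth_sum (I : Type) (r : seq I) (F : I -> V -> C) :
  (forall i, csmooth (F i)) -> csmooth (fun x => \sum_(i <- r) F i x).
Proof.
move=> sF; elim: r => [|i r IH].
  by apply: (eq_smooth _ (smooth_cst 0)) => x; rewrite big_nil.
by apply: (eq_smooth _ (smoothD (sF i) IH)) => x; rewrite big_cons.
Qed.

Lemma smooth_prod (I : Type) (r : seq I) (F : I -> V -> C) :
  (forall i, csmooth (F i)) -> csmooth (fun x => \prod_(i <- r) F i x).
Proof.
move=> sF; elim: r => [|i r IH].
  by apply: (eq_smooth _ (smooth_cst 1)) => x; rewrite big_nil.
by apply: (eq_smooth _ (smoothM (sF i) IH)) => x; rewrite big_cons.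
Qed.

Lemma smoothX f k : csmooth f -> csmooth (fun x => f x ^+ k).
Proof.
move=> sf; elim: k => [|k IH]; first exact: smooth_cst.
by apply: (eq_smooth _ (smoothM sf IH)) => x; rewrite exprS.
Qed.

Lemma smooth_real (f : V -> R) :
  (forall m, Cn m f) -> csmooth (fun x => (f x)%:C%C).
Proof. by move=> Cf; apply/csmoothE => m; split => //=; exact: Cn_cst. Qed.

Lemma smooth_conj f : csmooth f -> csmooth (fun x => ((f x)^*)%C).
Proof.
move=> /csmoothE sf; apply/csmoothE => m; have [? ?] := sf m.
split.
  by rewrite (_ : (fun x => _) = fun x => Re (f x))//; apply/funext => x; case: (f x).
rewrite (_ : (fun x => _) = fun x => - Im (f x)); first exact: CnN.
by apply/funext => x; case: (f x).
Qed.

Lemma cpd_cst (c : C) j : cpd j (fun _ : V => c) = fun=> 0.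
Proof. by apply/funext => x; rewrite cpd.unlock !pd_cst. Qed.

Lemma cpdD f g j : csmooth f -> csmooth g ->
  cpd j (fun x => f x + g x) = fun x => cpd j f x + cpd j g x.
Proof.
move=> sf sg; apply/funext => x.
have [a b] := smooth_derivable j x sf; have [c d] := smooth_derivable j x sg.
rewrite cpd.unlock; apply: complexP; rewrite ?cReD ?cImD.
  rewrite [LHS](_ : _ = pd dir j (fun y => Re (f y) + Re (g y)) x); first exact (pdD a c).
  by congr (pd _ _ _ _); apply/funext => y; rewrite cReD.
rewrite [LHS](_ : _ = pd dir j (fun y => Im (f y) + Im (g y)) x); first exact (pdD b d).
by congr (pd _ _ _ _); apply/funext => y; rewrite cImD.
Qed.

Lemma cpdM f g j : csmooth f -> csmooth g ->
  cpd j (fun x => f x * g x) =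
  fun x => cpd j f x * g x + f x * cpd j g x.
Proof.
move=> sf sg; apply/funext => x.
have [a b] := smooth_derivable j x sf; have [c d] := smooth_derivable j x sg.
rewrite cpd.unlock; apply: complexP; rewrite ?cReD ?cImD ?cReM ?cImM.
  rewrite [LHS](_ : _ =
    pd dir j (fun y => Re (f y) * Re (g y) - Im (f y) * Im (g y)) x); last first.
    by congr (pd _ _ _ _); apply/funext => y; rewrite cReM.
  rewrite (pdB (derivableM a c) (derivableM b d)) (pdM a c) (pdM b d) /=.
  move: (pd _ _ _ _) (pd _ _ _ _) (pd _ _ _ _) (pd _ _ _ _) => p1 p2 p3 p4.
  by move: (Re _) (Im _) (Re _) (Im _) => r1 r2 r3 r4; ring.
rewrite [LHS](_ : _ =
  pd dir j (fun y => Re (f y) * Im (g y) + Im (f y) * Re (g y)) x); last first.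
  by congr (pd _ _ _ _); apply/funext => y; rewrite cImM.
rewrite (pdD (derivableM a d) (derivableM b c)) (pdM a d) (pdM b c) /=.
move: (pd _ _ _ _) (pd _ _ _ _) (pd _ _ _ _) (pd _ _ _ _) => p1 p2 p3 p4.
by move: (Re _) (Im _) (Re _) (Im _) => r1 r2 r3 r4; ring.
Qed.

Lemma cpdZ (c : C) f j : csmooth f ->
  cpd j (fun x => c * f x) = fun x => c * cpd j f x.
Proof.
move=> sf; rewrite cpdM//; last exact: smooth_cst.
by rewrite cpd_cst; apply/funext => x; rewrite mul0r add0r.
Qed.

Lemma foldrD f g s : csmooth f -> csmooth g ->
  foldr cpd (fun x => f x + g x) s =
  fun x => foldr cpd f s x + foldr cpd g s x.
Proof.
elim/last_ind: s f g => [|s j IH] f g sf sg //.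
by rewrite !foldr_rcons cpdD// IH//; exact: smooth_cpd.
Qed.

Lemma foldrZ (c : C) f s : csmooth f ->
  foldr cpd (fun x => c * f x) s =
  fun x => c * foldr cpd f s x.
Proof.
elim/last_ind: s f => [|s j IH] f sf //.
by rewrite !foldr_rcons cpdZ// IH//; exact: smooth_cpd.
Qed.

(** Each letter splits a product into two products, whence [2 ^+ m]. The bounds are taken at a
    single point [x], so that [A] and [B] may contain weights depending on [x]. *)
Lemma leibniz_bound m f g x (A B : R) : csmooth f -> csmooth g ->
  (forall s, (size s <= m)%N -> normc (foldr cpd f s x) <= A) ->
  (forall s, (size s <= m)%N -> normc (foldr cpd g s x) <= B) ->
  forall s, (size s <= m)%N ->
    normc (foldr cpd (fun y => f y * g y) s x) <= 2 ^+ m * A * B.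
Proof.
elim: m f g => [|m IH] f g sf sg fA gB s.
  rewrite leqn0 => /nilP -> /=.
  rewrite normcM expr0 mul1r ler_pM ?normc_ge0//; [exact: (fA [::])|exact: (gB [::])].
have A0 : 0 <= A by rewrite (le_trans (normc_ge0 _) (fA [::] isT)).
have B0 : 0 <= B by rewrite (le_trans (normc_ge0 _) (gB [::] isT)).
case/lastP: s => [_ /=|s j].
  rewrite normcM; apply: le_trans (_ : A * B <= _).
    by rewrite ler_pM ?normc_ge0//; [exact: (fA [::])|exact: (gB [::])].
  by rewrite -mulrA ler_peMl ?mulr_ge0// exprn_ege1// ler1n.
rewrite size_rcons ltnS => sm; rewrite foldr_rcons cpdM//.
have ? := smooth_cpd j sf; have ? := @smooth_cpd g j sg.
rewrite foldrD; try exact: smoothM.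
apply: le_trans (normcD _ _) _.
have -> : 2 ^+ m.+1 * A * B = 2 ^+ m * A * B + 2 ^+ m * A * B.
  by rewrite exprS; ring.
apply: lerD; apply: IH => // t tm; rewrite -?foldr_rcons.
- by apply: fA; rewrite size_rcons.
- by apply: gB; rewrite leqW.
- by apply: fA; rewrite leqW.
- by apply: gB; rewrite size_rcons.
Qed.

(* Differentiating [p ^ k * w] lowers the exponent at most [m] times and each
   time produces a factor at most [k]. *)
Lemma power_bound m (A rho : R) : 0 < rho -> exists2 c : R, 0 <= c &
  forall (p w : V -> C) x (B : R) k, csmooth p -> csmooth w ->
  normc (p x) <= rho ->
  (forall s, (size s <= m)%N -> normc (foldr cpd p s x) <= A) ->
  (forall s, (size s <= m)%N -> normc (foldr cpd w s x) <= B) ->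
  forall s, (size s <= m)%N ->
    normc (foldr cpd (fun y => p y ^+ k * w y) s x)
      <= c * (k.+1)%:R ^+ m * rho ^+ k * B.
Proof.
move=> rho0; elim: m => [|m [c c0 IH]].
  exists 1 => // p w x B k sp sw prho pA wB s; rewrite leqn0 => /nilP -> /=.
  rewrite normcM normcX mul1r expr0 mul1r ler_pM ?exprn_ge0 ?normc_ge0//.
    by rewrite lerXn2r ?nnegrE ?normc_ge0// ltW.
  exact: (wB [::]).
(* The summand [c] pays for the term that differentiates [w]. In the other term the quotient by
   [rho] restores the power lost in p^(k-1), and 2^m |A| is the Leibniz factor of the remaining
   product. The 1 covers the empty word. *)
exists (Num.max 1 (c * (2 ^+ m * `|A|) / rho + c)).
  by rewrite le_max ler01.
set c' := Num.max _ _.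
have c'1 : 1 <= c' by rewrite le_max lexx.
have c'2 : c * (2 ^+ m * `|A|) / rho + c <= c' by rewrite le_max lexx orbT.
move=> p w x B k sp sw prho pA wB s.
have A0 : 0 <= A by rewrite (le_trans (normc_ge0 _) (pA [::] isT)).
have B0 : 0 <= B by rewrite (le_trans (normc_ge0 _) (wB [::] isT)).
case/lastP: s => [_ /=|s j].
  rewrite normcM normcX; apply: ler_pM; rewrite ?exprn_ge0 ?normc_ge0//; last exact: (wB [::]).
  apply: (@le_trans _ _ (rho ^+ k)).
    by rewrite lerXn2r ?nnegrE ?normc_ge0// ltW.
  rewrite ler_peMl ?exprn_ge0 ?(ltW rho0)//.
  by rewrite mulr_ege1// exprn_ege1// ler1n.
rewrite size_rcons ltnS => sm; rewrite foldr_rcons.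
have spj := @smooth_cpd p j sp; have swj := @smooth_cpd w j sw.
(* At [k = 0] the truncated predecessor is harmless, since the factor [k%:R] vanishes. *)
have pk : cpd j (fun y => p y ^+ k * w y) =
   fun y => p y ^+ k.-1 * (k%:R * (cpd j p y * w y)) + p y ^+ k * cpd j w y.
  rewrite cpdM//; last exact: smoothX.
  apply/funext => y; congr (_ + _).
  elim: k {pA wB} y => [|k IHk] y; first by rewrite cpd_cst !mul0r mulr0.
  rewrite (_ : (fun x => p x ^+ k.+1) = fun x => p x * p x ^+ k); last first.
    by apply/funext => z; rewrite exprS.
  rewrite cpdM//; last exact: smoothX.
  rewrite mulrDl -[p y * _ * _]mulrA IHk succnK.
  case: k {IHk} => [|k]; first by rewrite !expr0; ring.
  by rewrite succnK -[k.+2%:R]natr1 exprS; ring.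
rewrite pk foldrD; last 2 first.
- by apply: smoothM; [exact: smoothX|apply: smoothZ; exact: smoothM].
- by apply: smoothM => //; exact: smoothX.
apply: le_trans (normcD _ _) _.
have pA' t : (size t <= m)%N -> normc (foldr cpd p t x) <= A.
  by move=> tm; apply: pA; rewrite leqW.
have wB' t : (size t <= m)%N -> normc (foldr cpd w t x) <= B.
  by move=> tm; apply: wB; rewrite leqW.
have pjA t : (size t <= m)%N -> normc (foldr cpd (cpd j p) t x) <= A.
  by move=> tm; rewrite -foldr_rcons; apply: pA; rewrite size_rcons.
have wjB t : (size t <= m)%N -> normc (foldr cpd (cpd j w) t x) <= B.
  by move=> tm; rewrite -foldr_rcons; apply: wB; rewrite size_rcons.
have H2 := IH p _ x B k sp swj prho pA' wjB s sm.
have H1 : normc (foldr cpd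
    (fun y => p y ^+ k.-1 * (k%:R * (cpd j p y * w y))) s x) <=
    c * (2 ^+ m * `|A|) / rho * k.+1%:R ^+ m.+1 * rho ^+ k * B.
  case: k {pk H2} => [|k].
    rewrite (_ : (fun _ => _) = fun y => 0 * w y); last first.
      by apply/funext => y; rewrite !mul0r mulr0.
    rewrite foldrZ// mul0r normc0 ?mulr_ge0 ?invr_ge0 ?exprn_ge0// ltW//.
  rewrite succnK.
  have Hb t : (size t <= m)%N -> normc (foldr cpd
      (fun y => k.+1%:R * (cpd j p y * w y)) t x) <= k.+1%:R * (2 ^+ m * A * B).
    move=> tm; rewrite foldrZ; last exact: smoothM.
    rewrite normcM; apply: ler_pM; rewrite ?normc_ge0//; last exact: leibniz_bound.
    by rewrite (_ : k.+1%:R = (k.+1%:R)%:C%C) ?normc_real ?ger0_norm// rmorph_nat.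
  have := IH p _ x _ k sp _ prho pA' Hb s sm.
  move=> /(_ (smoothZ _ (smoothM spj sw)))/le_trans; apply.
  rewrite (ger0_norm A0) -subr_ge0.
  have -> : c * (2 ^+ m * A) / rho * k.+2%:R ^+ m.+1 * rho ^+ k.+1 * B -
     c * k.+1%:R ^+ m * rho ^+ k * (k.+1%:R * (2 ^+ m * A * B)) =
     c * 2 ^+ m * A * B * rho ^+ k * (k.+2%:R ^+ m.+1 - k.+1%:R ^+ m.+1).
    rewrite !exprS; field; exact: lt0r_neq0.
  rewrite !mulr_ge0 ?exprn_ge0 ?(ltW rho0)// subr_ge0 lerXn2r ?nnegrE// ler_nat//.
apply: le_trans (lerD H1 H2) _.
apply: (@le_trans _ _ ((c * (2 ^+ m * `|A|) / rho + c) * k.+1%:R ^+ m.+1 * rho ^+ k * B)).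
  rewrite !mulrDl lerD2l -!mulrA ler_wpM2l// ler_wpM2r ?mulr_ge0 ?exprn_ge0 ?(ltW rho0)//.
  by rewrite exprS ler_peMl ?exprn_ge0// ler1n.
apply: ler_wpM2r => //; apply: ler_wpM2r; first by rewrite exprn_ge0// ltW.
by apply: ler_wpM2r => //; rewrite exprn_ge0.
Qed.

End SmoothComplex.

(** * Bump functions *)

Section FlatFunction.
Context {R : realType}.
Implicit Types (m : nat) (t : R).

(** The function exp(-1/t) extended by 0, times t^(-m). The index [m] is there because the family,
    and not exp(-1/t) alone, is stable under differentiation, which is what [Cn_comp] asks for. *)
Definition flat m t : R := if 0 < t then t^-1 ^+ m * expR (- t^-1) else 0.

Lemma flat_ge0 m t : 0 <= flat m t.
Proof.
rewrite /flat; case: ifPn => // t0.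
by rewrite mulr_ge0 ?expR_ge0// exprn_ge0// invr_ge0 ltW.
Qed.

Lemma flat0_gt0 t : 0 < t -> 0 < flat 0 t.
Proof. by move=> t0; rewrite /flat t0 expr0 mul1r expR_gt0. Qed.

Lemma flat_npos m t : t <= 0 -> flat m t = 0.
Proof. by move=> t0; rewrite /flat ltNge t0. Qed.

(* [y ^ k <= k ^ k * exp y] follows from [1 + y / k <= exp (y / k)]. *)
Lemma flat_le m t : flat m t <= m.+2%:R ^+ m.+2 * t ^+ 2.
Proof.
rewrite /flat; case: ifPn => [t0|_]; last first.
  by apply: mulr_ge0; [exact: exprn_ge0|exact: sqr_ge0].
set y := t^-1; have y0 : 0 < y by rewrite invr_gt0.
have k0 : (0 : R) < m.+2%:R by rewrite ltr0n.
have H : (y / m.+2%:R) ^+ m.+2 <= expR y.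
  rewrite (_ : expR y = expR (y / m.+2%:R) ^+ m.+2); last first.
    by rewrite -expRM_natr divfK// lt0r_neq0.
  rewrite lerXn2r ?nnegrE ?expR_ge0 ?divr_ge0 ?(ltW y0)//.
  by apply: le_trans (expR_ge1Dx _); rewrite lerDr.
move: H; rewrite expr_div_n ler_pdivrMr ?exprn_gt0// => H.
rewrite expRN ler_pdivrMr ?expR_gt0//.
have -> : y ^+ m = y ^+ m.+2 * t ^+ 2.
  by rewrite /y -[m.+2]addn2 exprD -mulrA -exprMn mulVf ?lt0r_neq0// expr1n mulr1.
by rewrite [leRHS]mulrAC ler_wpM2r ?sqr_ge0// mulrC.
Qed.


(** Away from 0 this is the product rule. At 0 the bound [flat_le], quadratic in t, forces the
    difference quotient to 0. *)
Lemma is_derive_flat m t :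
  is_derive t (1 : R) (flat m) (flat m.+2 t - m%:R * flat m.+1 t).
Proof.
have [t0|t0|->] := ltgtP t 0.
- rewrite !flat_npos ?ltW// mulr0 subr0.
  apply: (@near_eq_is_derive _ _ _ (fun=> 0)).
    near=> x; rewrite flat_npos// ltW//; near: x; exact: lt_nbhsl.
- pose g (x : R) := x^-1 ^+ m * expR (- x^-1).
  apply: (@near_eq_is_derive _ _ _ g).
    by near=> x; rewrite /flat ifT//; near: x; exact: lt_nbhsr.
  have tn0 : t != 0 by rewrite lt0r_neq0.
  have dV : is_derive t (1 : R) (fun x : R => x^-1) (- t^-1 ^+ 2).
    have := is_deriveV tn0 (is_derive_id t (1 : R)).
    by rewrite /GRing.scale/= mulr1 exprVn.
  have dE : is_derive t (1 : R) (fun x : R => expR (- x^-1))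
      (expR (- t^-1) * t^-1 ^+ 2).
    have dN := is_deriveN dV; rewrite opprK in dN.
    exact: (@is_derive1_comp _ expR (- (fun x : R => x^-1)) t _ _
      (is_derive_expR _) dN).
  have := is_deriveM (is_deriveX m dV) dE.
  rewrite /flat t0 /GRing.scale /=.
  have E1 : ((fun x : R => x^-1) ^+ m) t = t^-1 ^+ m by rewrite fctE.
  rewrite (_ : (fun x : R => x^-1) ^+ m * _ = g); last first.
    by apply/funext => x; rewrite /g !fctE.
  rewrite E1 => /is_derive_eq; apply.
  case: m {g E1} => [|m]; first by rewrite !mul0r !mulr0 !expr0; ring.
  rewrite succnK !exprS; ring.
- rewrite !flat_npos// mulr0 subr0.
  pose K : R := m.+2%:R ^+ m.+2.
  have K0 : 0 < K by rewrite exprn_gt0// ltr0n.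
  have H : h^-1 *: ((flat m \o shift 0) (h *: 1) - flat m 0) @[h --> 0^'] --> (0 : R).
    apply/cvgr0Pnorm_le => eps eps0; near=> h.
    rewrite /= addr0 (flat_npos m (lexx 0)) subr0 /GRing.scale/= mulr1.
    rewrite normrM normfV ler_pdivrMl ?normr_gt0//; last by near: h; exact: nbhs_dnbhs_neq.
    rewrite ger0_norm ?flat_ge0//; apply: le_trans (flat_le _ _) _.
    rewrite -[h ^+ 2]real_normK ?num_real// expr2 mulrCA ler_wpM2l// -ler_pdivlMl//.
    by near: h; apply: dnbhs0_le; rewrite mulr_gt0// invr_gt0.
  by apply: DeriveDef; [apply/cvg_ex; exists 0; exact: H|apply/cvg_lim => //; exact: H].
Unshelve. all: by end_near.
Qed.
End FlatFunction.

Section Bump1.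
Context {R : realType}.
Implicit Types t : R.

Lemma bump1_den_gt0 (a : R) : 0 < flat 0 (4 - a) + flat 0 (a - 1).
Proof.
have [a4|a4] := ltP a 4.
  by apply: ltr_wpDr; [exact: flat_ge0|apply: flat0_gt0; rewrite subr_gt0].
apply: ltr_wpDl; [exact: flat_ge0|apply: flat0_gt0; rewrite subr_gt0].
by apply: lt_le_trans a4; rewrite ltr1n.
Qed.

(** The classical quotient of flat functions, equal to 1 on [-1, 1] and to 0 outside (-2, 2). It is
    written in terms of t^2 because |t| is not smooth; 4 and 1 are the squares of the two radii. *)
Definition bump1 t : R := flat 0 (4 - t ^+ 2) / (flat 0 (4 - t ^+ 2) + flat 0 (t ^+ 2 - 1)).

Lemma bump1_ge0 t : 0 <= bump1 t.
Proof. by rewrite divr_ge0 ?flat_ge0// ltW// bump1_den_gt0. Qed.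

Lemma bump1_le1 t : bump1 t <= 1.
Proof. by rewrite ler_pdivrMr ?bump1_den_gt0// mul1r lerDl flat_ge0. Qed.

Lemma bump1_eq1 t : `|t| <= 1 -> bump1 t = 1.
Proof.
move=> t1; have t2 : t ^+ 2 <= 1 by rewrite -real_normK ?num_real// expr_le1.
rewrite /bump1 [flat 0 (t ^+ 2 - 1)]flat_npos ?subr_le0// addr0 divff//.
by rewrite lt0r_neq0// flat0_gt0// subr_gt0 (le_lt_trans t2)// ltr1n.
Qed.

Lemma bump1_eq0 t : 2 <= `|t| -> bump1 t = 0.
Proof.
move=> t2; rewrite /bump1 flat_npos ?mul0r// subr_le0 -real_normK ?num_real//.
by rewrite (_ : 4 = 2 ^+ 2 :> R) ?lerXn2r ?nnegrE// -natrX.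
Qed.

Lemma Cn_flat {V : normedModType R} {J : Type} (e : J -> V) m k (f : V -> R) :
  Cn e m f -> Cn e m (fun x => flat k (f x)).
Proof.
apply: (@Cn_comp _ _ _ e nat flat (fun i => [:: (1, i.+2); (- i%:R, i.+1)])).
move=> i t; rewrite !big_cons big_nil /= addr0 mul1r mulNr.
exact: is_derive_flat.
Qed.

Lemma Cn_bump1 {V : normedModType R} {J : Type} (e : J -> V) m (f : V -> R) :
  Cn e m f -> Cn e m (fun x => bump1 (f x)).
Proof.
move=> Cf; have C2 : Cn e m (fun x => f x ^+ 2).
  by rewrite (_ : (fun x => _) = fun x => f x * f x)//; exact: CnM.
have C4 : Cn e m (fun x => flat 0 (4 - f x ^+ 2)).
  by apply: Cn_flat; apply: CnB => //; exact: Cn_cst.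
have C1 : Cn e m (fun x => flat 0 (f x ^+ 2 - 1)).
  by apply: Cn_flat; apply: CnB => //; exact: Cn_cst.
apply: CnM => //; apply: CnV => [x|]; last exact: CnD.
by rewrite lt0r_neq0// bump1_den_gt0.
Qed.

End Bump1.

(** * Row vectors: the sup norm, affine substitutions and box-shaped bumps *)

Lemma affine_continuous {R : realType} {V : normedModType R} (a : R) (p : V) :
  continuous (fun x : V => a *: x + p).
Proof.
move=> x; apply: (@cvgD R V V (nbhs x) _ (fun x => a *: x) (fun _ => p));
  last exact: cvg_cst.
exact: (@scaler_continuous R V a x).
Qed.

Lemma dist_continuous {R : realType} {V : normedModType R} (p : V) :
  continuous (fun x : V => `|x - p|).
Proof.
move=> x; apply: (@cvg_norm R V V (nbhs x) _ (fun x => x - p)).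
by apply: cvgB; [exact: cvg_id|exact: cvg_cst].
Qed.

Section RowVectors.
Context {R : realType} {n : nat}.
Local Notation V := 'rV[R]_n.
Implicit Types x y p : V.

Lemma coord_le_norm x j : `|x 0 j| <= `|x|.
Proof.
rewrite [leRHS]mx_normrE.
by apply/bigmax_geP; right; exists (0, j).
Qed.

Lemma norm_le_coord x (c : R) : 0 <= c -> (forall j, `|x 0 j| <= c) -> `|x| <= c.
Proof.
move=> c0 xc; rewrite [leLHS]mx_normrE; apply/bigmax_leP; split => // -[i j] _ /=.
by rewrite (ord1 i).
Qed.

Lemma norm_attained x : `|x| = 0 \/ exists j, `|x| = `|x 0 j|.
Proof.
have [x0|/mx_norm_neq0[[i j] /= xj]] := eqVneq `|x| 0; first by left.
by right; exists j; rewrite {1}/Num.norm/= xj (ord1 i).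
Qed.

Lemma compact_box p (r : R) : compact [set x : V | `|x - p| <= r].
Proof.
apply: bounded_closed_compact.
  exists (`|p| + `|r|); split; first by rewrite num_real.
  move=> M Mp x /= xp; rewrite -[x](subrK p); apply: (le_trans (ler_normD _ _)).
  rewrite addrC; apply: le_trans (ltW Mp); rewrite lerD2l (le_trans xp)// ler_norm//.
apply: (@preimage_closed _ _ (fun x : V => `|x - p|) [set t | t <= r]);
  last exact: closed_le.
by move=> x _; exact: (@dist_continuous R V p x).
Qed.

Lemma is_derive_coord j x v : is_derive x v (fun y : V => y 0 j) (v 0 j).
Proof.
apply/is_derive_line.
rewrite (_ : (fun h : R => _) = (fun h : R => h * v 0 j + x 0 j)); last first.
  by apply/funext => h; rewrite !mxE.
by apply: is_derive_eq; rewrite addr0 /GRing.scale/= mulr0 mulr1 add0r.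
Qed.

Lemma pd_coord i j : pd dir i (fun y : V => y 0 j) = fun=> (i == j)%:R.
Proof.
apply/funext => x; rewrite (is_derive_pdE (is_derive_coord j x (dir i))).
by rewrite /dir mxE eqxx/= eq_sym.
Qed.

Lemma Cn_coord m j : Cn dir m (fun y : V => y 0 j).
Proof.
case: m => [|m] /=; first exact: coord_continuous.
split; first exact: coord_continuous.
  by move=> i x; case: (is_derive_coord j x (dir i)).
by move=> i; rewrite pd_coord; exact: Cn_cst.
Qed.

Lemma smooth_coord j : csmooth (fun y : V => (y 0 j)%:C%C).
Proof. by apply: smooth_real => m; exact: Cn_coord. Qed.

Lemma cpd_coord i j : cpd i (fun y : V => (y 0 j)%:C%C) = fun=> (i == j)%:R.
Proof.
apply/funext => x; rewrite cpd.unlock /= pd_coord pd_cst.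
by case: (i == j).
Qed.

Lemma is_derive_affine (f : V -> R) (a : R) p x v df :
  is_derive (a *: x + p) v f df ->
  is_derive x v (fun y => f (a *: y + p)) (a * df).
Proof.
move=> /is_derive_line Hf; apply/is_derive_line.
rewrite (_ : (fun h : R => _) =
   (fun h => f (h *: v + (a *: x + p))) \o (fun h => a * h)); last first.
  by apply/funext => h /=; rewrite scalerDr scalerA addrA.
rewrite mulrC; apply: is_derive1_comp; first by rewrite mulr0.
have := is_deriveZ a (is_derive_id (0 : R) (1 : R)).
by rewrite /GRing.scale/= mulr1.
Qed.

Lemma Cn_affine m (f : V -> R) (a : R) p : Cn dir m f ->
  Cn dir m (fun x => f (a *: x + p)).
Proof.
elim: m f => [|m IH] f.
  move=> /= cf x; apply: (@continuous_comp _ _ _ (fun x => a *: x + p) f); last exact: cf.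
  exact: (@affine_continuous R V a p x).
move=> Cf'; have /= [cf df Cf] := Cf'.
have dfa j x : is_derive x (dir j) (fun y => f (a *: y + p)) (a * pd dir j f (a *: x + p)).
  by apply: is_derive_affine; exact: is_derive_pd.
split.
- move=> x; apply: (@continuous_comp _ _ _ (fun x => a *: x + p) f); last exact: cf.
  exact: (@affine_continuous R V a p x).
- by move=> j x; case: (dfa j x).
- move=> j; rewrite (_ : pd _ _ _ = fun x => a * pd dir j f (a *: x + p)).
    by apply: CnM; [exact: Cn_cst|exact: IH].
  by apply/funext => x; exact: is_derive_pdE.
Qed.

Lemma smooth_affine (f : V -> R[i]) (a : R) p : csmooth f ->
  csmooth (fun x => f (a *: x + p)).
Proof.
move=> /csmoothE Cf; apply/csmoothE => m; have [? ?] := Cf m.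
by split; [exact: (@Cn_affine m (fun x => complex.Re (f x)))|
           exact: (@Cn_affine m (fun x => complex.Im (f x)))].
Qed.

Lemma cpd_affine (f : V -> R[i]) (a : R) p j : csmooth f ->
  cpd j (fun x => f (a *: x + p)) = fun x => a%:C%C * cpd j f (a *: x + p).
Proof.
move=> sf; apply/funext => x; rewrite cpd.unlock.
have [dr di] := smooth_derivable j (a *: x + p) sf.
rewrite (is_derive_pdE (is_derive_affine (is_derive_pd dr))).
rewrite (is_derive_pdE (is_derive_affine (is_derive_pd di))).
by apply: complexP; rewrite ?cReM ?cImM /= mul0r ?subr0 ?addr0.
Qed.

Lemma foldr_affine (f : V -> R[i]) (a : R) p s : csmooth f ->
  foldr cpd (fun x => f (a *: x + p)) s =
  fun x => (a%:C%C) ^+ size s * foldr cpd f s (a *: x + p).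
Proof.
elim/last_ind: s f => [|s j IH] f sf.
  by apply/funext => x; rewrite expr0 mul1r.
rewrite !foldr_rcons cpd_affine// foldrZ; last exact/smooth_affine/smooth_cpd.
rewrite IH; last exact: smooth_cpd.
by apply/funext => x; rewrite size_rcons exprS mulrA.
Qed.

Definition boxbump (x : V) : R := \prod_(j < n) bump1 (x 0 j).

Lemma boxbump_le1 x : boxbump x <= 1.
Proof. by apply: prodr_ile1 => j _; rewrite bump1_ge0 bump1_le1. Qed.

Lemma boxbump_eq1 x : `|x| <= 1 -> boxbump x = 1.
Proof.
move=> x1; rewrite /boxbump big1// => j _; apply: bump1_eq1.
exact: le_trans (coord_le_norm _ _) x1.
Qed.

Lemma boxbump_eq0 x : 2 <= `|x| -> boxbump x = 0.
Proof.
move=> x2; have [x0|[j xj]] := norm_attained x.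
  by move: x2; rewrite x0 lern0.
by rewrite /boxbump (bigD1 j)//= bump1_eq0 ?mul0r// -xj.
Qed.

Lemma Cn_boxbump m : Cn dir m boxbump.
Proof. by apply: Cn_prod => j; apply: Cn_bump1; exact: Cn_coord. Qed.

Lemma smooth_boxbump : csmooth (fun x => (boxbump x)%:C%C).
Proof. by apply: smooth_real => m; exact: Cn_boxbump. Qed.

End RowVectors.

(** * One-dimensional integrals *)

Lemma dominated_integrable d (T : measurableType d) (R : realType)
    (m : {measure set T -> \bar R}) (D : set T) (F W : T -> R) (K : R) :
  measurable D -> m.-integrable D (EFin \o W) -> measurable_fun D F ->
  (forall t, D t -> `|F t| <= K * W t) -> m.-integrable D (EFin \o F).
Proof.
move=> mD iW mF FW.
apply: (@le_integrable _ _ _ m D mD (EFin \o F) (fun t => K%:E * (EFin \o W) t)%E).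
- exact/measurable_EFinP.
- move=> t Dt; rewrite /= lee_fin; apply: le_trans (FW t Dt) _; exact: ler_norm.
- exact: integrableZl.
Qed.

Section OneDim.
Context {R : realType}.
Local Notation mu := (@lebesgue_measure R).
Implicit Types (h H : R -> R).

(** The common dominating function of the whole development: it is integrable, has the
    antiderivative [atan], and is dominated by every weight of Schwartz type. *)
Definition cauchyw (x : R) : R := (1 + x ^+ 2)^-1.

Lemma cauchyw_gt0 x : 0 < cauchyw x.
Proof. by rewrite invr_gt0 ltr_pwDl// sqr_ge0. Qed.

Lemma cauchyw_ge0 x : 0 <= cauchyw x. Proof. exact/ltW/cauchyw_gt0. Qed.

Lemma cauchyw_le1 x : cauchyw x <= 1.
Proof. by rewrite invf_le1 ?ltr_pwDl ?sqr_ge0// lerDl sqr_ge0. Qed.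

Lemma continuous_cauchyw : continuous cauchyw.
Proof. exact: continuous_oneDsqrV. Qed.

Lemma cauchywN x : cauchyw (- x) = cauchyw x.
Proof. by rewrite /cauchyw sqrrN. Qed.

Lemma integrable_cauchyw : mu.-integrable setT (EFin \o cauchyw).
Proof.
apply/integrableP; split.
  by apply/measurable_EFinP; apply: continuous_measurable_fun; exact: continuous_cauchyw.
under eq_integral do rewrite /= ger0_norm ?cauchyw_ge0//.
rewrite ge0_symfun_integralT; last 3 first.
- exact: cauchyw_ge0.
- exact: continuous_cauchyw.
- by move=> x /=; rewrite cauchywN.
rewrite -set_itvcy integral0y_oneDsqr -EFinM ltry//.
Qed.

Lemma integrable_cauchyw_dom (D : set R) h K : measurable D -> continuous h ->
  (forall x, D x -> `|h x| <= K * cauchyw x) -> mu.-integrable D (EFin \o h).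
Proof.
move=> mD ch hK; apply: (@dominated_integrable _ _ R mu D h cauchyw K) => //.
  exact: integrableS integrable_cauchyw.
by apply: measurable_funTS; exact: continuous_measurable_fun.
Qed.

Lemma Rintegral0y_cauchyw : \int[mu]_(x in `[0, +oo[) cauchyw x = pi / 2.
Proof. by rewrite /Rintegral integral0y_oneDsqr. Qed.

Lemma continuous_withinE (D : set R) h : continuous h -> {within D, continuous h}.
Proof. exact: continuous_subspaceT. Qed.

Lemma derive_continuous h H : (forall x, is_derive x (1 : R) H (h x)) -> continuous H.
Proof.
by move=> dH x; apply: differentiable_continuous; apply/derivable1_diffP; case: (dH x).
Qed.

(* Adding a multiple of the density [cauchyw] and of its antiderivative [atan]
   reduces to nonnegative integrands. *)
Lemma halfline_FTC h H K l : continuous h ->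
  (forall x, is_derive x (1 : R) H (h x)) ->
  (forall x, 0 <= x -> `|h x| <= K * cauchyw x) ->
  H x @[x --> +oo] --> l ->
  \int[mu]_(x in `[0, +oo[) h x = l - H 0.
Proof.
move=> ch dH hK Hl.
pose g x := h x + K * cauchyw x; pose G x := H x + K * atan x.
have cg : continuous g.
  move=> x; apply: cvgD; first exact: ch.
  by apply: cvgM; [exact: cvg_cst|exact: continuous_cauchyw].
have dG x : is_derive x (1 : R) G (g x).
  have dK : is_derive x (1 : R) (fun x => K * atan x) (K * cauchyw x).
    have := is_deriveZ K (is_derive1_atan x).
    by rewrite /GRing.scale/= => D; apply: is_derive_eq D _.
  exact: (is_deriveD (dH x) dK).
have : \int[mu]_(x in `[0, +oo[) g x = (l + K * (pi / 2)) - G 0.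
  apply: Rintegral_ge0_continuous_FTC2y.
  - move=> x x0; rewrite /g -lerBlDr sub0r.
    by have := hK x x0; rewrite ler_norml => /andP[].
  - exact: continuous_withinE.
  - by apply: cvgD => //; apply: cvgM; [exact: cvg_cst|exact: cvgy_atan].
  - by move=> x _; case: (dG x).
  - by apply: cvg_at_right_filter; exact: (derive_continuous dG).
  - by move=> x _; rewrite derive1E; case: (dG x).
rewrite /g RintegralD//; last 2 first.
- by apply: (integrable_cauchyw_dom (K := K)) => // x /=; rewrite in_itv/= andbT; exact: hK.
- apply: (integrable_cauchyw_dom (K := `|K|)) => //.
    by move=> x; apply: cvgM; [exact: cvg_cst|exact: continuous_cauchyw].
  by move=> x _; rewrite normrM (ger0_norm (cauchyw_ge0 x)).
rewrite RintegralZl//; last first.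
  exact: integrableS integrable_cauchyw.
rewrite Rintegral0y_cauchyw /G atan0 mulr0 addr0 => E.
apply: (addIr (K * (pi / 2))); rewrite E; ring.
Qed.

(** The substitution rule behind [refl] is for nonnegative integrands. A signed [h] is reached by
    adding [K * cauchyw], which is even and has integral [K * (pi / 2)] on either half-line. *)
Lemma Rintegral_fold h K : continuous h -> (forall x, `|h x| <= K * cauchyw x) ->
  \int[mu]_x h x = \int[mu]_(x in `[0, +oo[) (h x + h (- x)).
Proof.
move=> ch hK.
have chN : continuous (fun x => h (- x)).
  by move=> x; apply: continuous_comp; [exact: opp_continuous|exact: ch].
have hNK x : `|h (- x)| <= K * cauchyw x by rewrite -cauchywN; exact: hK.
have cKw : continuous (fun x => K * cauchyw x).
  by move=> x; apply: cvgM; [exact: cvg_cst|exact: continuous_cauchyw].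
have iw (D : set R) : measurable D -> mu.-integrable D (EFin \o (fun x => K * cauchyw x)).
  move=> mD; apply: (integrable_cauchyw_dom (K := `|K|)) => // x _.
  by rewrite normrM (ger0_norm (cauchyw_ge0 x)).
have ih (D : set R) : measurable D -> mu.-integrable D (EFin \o h).
  by move=> mD; apply: (integrable_cauchyw_dom (K := K)).
have ihN (D : set R) : measurable D -> mu.-integrable D (EFin \o (fun x => h (- x))).
  by move=> mD; apply: (integrable_cauchyw_dom (K := K)).
have mN : measurable [set` `]-oo, (0 : R)]] by [].
have mP : measurable [set` `[(0 : R), +oo[] by [].
have refl (f : R -> R) : continuous f -> (forall x, 0 <= f x) ->
    \int[mu]_(x in `]-oo, 0]) f x = \int[mu]_(x in `[0, +oo[) f (- x).
  move=> cf f0; rewrite /Rintegral; congr fine.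
  rewrite -[X in `]-oo, X]]oppr0 ge0_integration_by_substitutionNy//.
  exact: continuous_withinE.
have E : \int[mu]_(x in `]-oo, 0]) h x = \int[mu]_(x in `[0, +oo[) h (- x).
  have := refl (fun x => h x + K * cauchyw x).
  rewrite !RintegralD//; try exact: iw; try exact: ih; try exact: ihN; last first.
    rewrite (_ : (EFin \o _) = EFin \o (fun x => K * cauchyw x)); first exact: iw.
    by apply/funext => x /=; rewrite cauchywN.
  have Kw (f : R -> R) : (forall x, f x = K * cauchyw x) ->
      \int[mu]_(x in `[0, +oo[) f x = K * (pi / 2).
    move=> /funext ->; rewrite RintegralZl ?Rintegral0y_cauchyw//.
    exact: integrableS integrable_cauchyw.
  have -> : \int[mu]_(x in `]-oo, 0]) (K * cauchyw x) = K * (pi / 2).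
    rewrite refl//; first by apply: Kw => x; rewrite cauchywN.
    by move=> x; apply: le_trans (hK x).
  rewrite (Kw (fun x => K * cauchyw (- x))); last by move=> x; rewrite cauchywN.
  move=> H; apply: (addIr (K * (pi / 2))); apply: H.
    by move=> x; apply: cvgD; [exact: ch|exact: cKw].
  move=> x; rewrite -lerBlDr sub0r; have := hK x; rewrite ler_norml => /andP[]//.
rewrite RintegralD//; try exact: ih; try exact: ihN.
have U : [set: R] = [set` `[(0 : R), +oo[] `|` [set` `]-oo, (0 : R)[].
  by rewrite -setCitvr setUv.
have D : [disjoint [set` `[(0 : R), +oo[] & [set` `]-oo, (0 : R)[]].
  by rewrite -setCitvr; exact/disj_setPCl.
rewrite -E -(@Rintegral_itv_bndo_bndc R -oo%O 0); last exact: ih.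
by rewrite U Rintegral_setU// -U; exact: ih.
Qed.

(** Folding leaves two half-lines. An antiderivative of h(-x) is -H(-x), and the two values at 0
    cancel. *)
Lemma line_FTC h H K l l' : continuous h ->
  (forall x, is_derive x (1 : R) H (h x)) ->
  (forall x, `|h x| <= K * cauchyw x) ->
  H x @[x --> +oo] --> l -> H x @[x --> -oo] --> l' ->
  \int[mu]_x h x = l - l'.
Proof.
move=> ch dH hK Hl Hl'.
have chN : continuous (fun x => h (- x)).
  by move=> x; apply: continuous_comp; [exact: opp_continuous|exact: ch].
have hNK x : `|h (- x)| <= K * cauchyw x by rewrite -cauchywN; exact: hK.
rewrite (Rintegral_fold ch hK) RintegralD//; last 2 first.
- exact: (integrable_cauchyw_dom (K := K)).
- exact: (integrable_cauchyw_dom (K := K)).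
rewrite (halfline_FTC ch dH (fun x _ => hK x) Hl).
have dHN x : is_derive x (1 : R) (fun x => - H (- x)) (h (- x)).
  have := @is_derive1_comp _ H (fun x => - x) x _ _ (dH (- x)) (is_deriveNid x 1).
  by move=> /is_deriveN; rewrite mulrN1 opprK.
rewrite (@halfline_FTC (fun x => h (- x)) (fun x => - H (- x)) K (- l')) ?oppr0 //; first by ring.
by apply: cvgN; apply/cvgNy_compNP; exact: Hl'.
Qed.

End OneDim.

(** * Integration over tuples *)

Section TupleIntegral.
Context {R : realType}.
Local Notation B := (measurableTypeR R).
Local Notation mu := (@lebesgue_measure R).
Local Notation leb := (@lebesgue_tuple R).

(** [cintegral] integrates over tuples, whereas continuity and derivatives live on row vectors;
    [trow] passes from the former to the latter. *)
Definition trow n (t : n.-tuple B) : 'rV[R]_n := \row_j (tnth t j : R).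

Lemma trowE n (t : n.-tuple B) j : trow t 0 j = tnth t j.
Proof. by rewrite mxE. Qed.

(** An open set is the union of the boxes with rational centre and radius 1/(k+1) that it contains.
    There are countably many of them, and the preimage of each is a finite intersection of
    conditions on single coordinates. *)
Lemma measurable_trow_open n (O : set 'rV[R]_n) : open O ->
  measurable (@trow n @^-1` O).
Proof.
move=> oO.
pose box (q : 'rV[rat]_n * nat) : set 'rV[R]_n :=
  [set x | forall j, `|ratr (q.1 0 j) - x 0 j| < (q.2.+1%:R)^-1].
pose bx q := if `[< box q `<=` O >] then box q else set0.
have -> : O = \bigcup_q (bx q).
  apply/seteqP; split=> [x Ox|x [q _]]; last first.
    by rewrite /bx; case: ifPn => // /asboolP; apply.
  have /nbhs_ballP[e /= e0 xeO] : nbhs x O by exact: open_nbhs_nbhs.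
  have [k ke] : exists k : nat, k.+1%:R^-1 < e / 2.
    have e2 : 0 < e / 2 by rewrite divr_gt0.
    by have [k] := ltr_add_invr e2; rewrite add0r; exists k.
  have Q j : exists q : rat, `|ratr q - x 0 j| < k.+1%:R^-1.
    have /rat_in_itvoo[q] : x 0 j < x 0 j + k.+1%:R^-1 :> R by rewrite ltrDl.
    rewrite in_itv/= => /andP[q1 q2]; exists q.
    by rewrite gtr0_norm ?subr_gt0// ltrBlDl.
  have [q qx] := choice Q.
  exists (\row_j q j, k) => //; rewrite /bx.
  have bxx : box (\row_j q j, k) x by move=> j /=; rewrite mxE; exact: qx.
  rewrite ifT//; apply/asboolP => y by_; apply: xeO.
  rewrite -ball_normE /=; apply: le_lt_trans (_ : k.+1%:R^-1 + k.+1%:R^-1 < e); last first.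
    by rewrite [ltRHS](splitr e) ltrD.
  apply: norm_le_coord; first by rewrite addr_ge0.
  move=> j; rewrite !mxE -[x 0 j](subrK (ratr (q j))) -addrA.
  apply: le_trans (ler_normD _ _) _; rewrite lerD//; last first.
    by have := by_ j; rewrite /= mxE => /ltW.
  by rewrite distrC ltW.
rewrite preimage_bigcup; apply: countable_bigcupT_measurable; first exact: countableP.
move=> q; rewrite /bx; case: ifPn => _; last by rewrite preimage_set0.
rewrite (_ : _ @^-1` _ = \big[setI/setT]_(j < n)
    (setT `&` (fun t : n.-tuple B => tnth t j) @^-1` (ball (ratr (q.1 0 j) : R) (q.2.+1%:R^-1)))).
  apply: bigsetI_measurable => j _; apply: measurable_tnth => //.
  by apply: open_measurable; exact: ball_open.
apply/seteqP; split=> [t /= bt|t].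
  rewrite -bigcap_seq => j _; split => //=.
  by have := bt j; rewrite trowE -ball_normE.
rewrite -bigcap_seq => bt j; have [_ /=] := bt j (mem_index_enum _).
by rewrite trowE -ball_normE.
Qed.

Lemma measurable_trow n (f : 'rV[R]_n -> R) : continuous f ->
  measurable_fun setT (fun t => f (trow t)).
Proof.
move=> /continuousP cf; apply: (measurability _ (RGenOpens.measurableE R)).
move=> _ [_ [a [b ->] <-]]; rewrite setTI.
rewrite -[X in measurable X]/(@trow n @^-1` (f @^-1` _)).
by apply: measurable_trow_open; apply: cf; exact: interval_open.
Qed.

Lemma measurable_slicer n (F : n.+1.-tuple B -> R) (x : B) :
  measurable_fun setT F -> measurable_fun setT (fun t => F (tuple_cons (x, t))).
Proof.
move=> mF; apply: measurableT_comp => //.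
apply: (@measurableT_comp _ _ _ _ _ _ (@tuple_cons R n)).
  exact: measurable_tuple_cons.
exact: pair1_measurable.
Qed.

Lemma measurable_slicel n (F : n.+1.-tuple B -> R) (t : n.-tuple B) :
  measurable_fun setT F -> measurable_fun setT (fun x => F (tuple_cons (x, t))).
Proof.
move=> mF; apply: measurableT_comp => //.
apply: (@measurableT_comp _ _ _ _ _ _ (@tuple_cons R n)).
  exact: measurable_tuple_cons.
exact: pair2_measurable.
Qed.

Lemma measurable_tcons n (F : n.+1.-tuple B -> R) :
  measurable_fun setT F -> measurable_fun setT (fun p => F (@tuple_cons R n p)).
Proof. by move=> mF; apply: measurableT_comp => //; exact: measurable_tuple_cons. Qed.

(** A product over the coordinates, so that domination by a multiple of it passes to every slice
    ([dom_slicer], [dom_slicel]) and justifies Fubini in either order. *)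
Definition weight n (t : n.-tuple B) : R := \prod_(j < n) cauchyw (tnth t j).

Lemma weight_cons n x (t : n.-tuple B) :
  weight (tuple_cons (x, t)) = cauchyw x * weight t.
Proof.
rewrite /weight big_ord_recl; congr (_ * _); apply: eq_bigr => j _.
by rewrite tnthS; congr (cauchyw (tnth _ _)); exact: val_inj.
Qed.

Lemma weight_gt0 n (t : n.-tuple B) : 0 < weight t.
Proof. by apply: prodr_gt0 => j _; exact: cauchyw_gt0. Qed.

Lemma weight_ge0 n (t : n.-tuple B) : 0 <= weight t.
Proof. exact/ltW/weight_gt0. Qed.

Lemma measurable_weight n : measurable_fun setT (@weight n).
Proof.
apply: measurable_prod => j _.
apply: (@measurableT_comp _ _ _ _ _ _ cauchyw); last exact: measurable_tnth.
by apply: continuous_measurable_fun; exact: continuous_cauchyw.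
Qed.

Lemma integrable_prod_cons n (F : n.+1.-tuple B -> R) : measurable_fun setT F ->
  (mu \x leb n)%E.-integrable setT (fun p => (F (tuple_cons p))%:E) <->
  (leb n.+1).-integrable setT (EFin \o F).
Proof.
move=> mF; split=> iF.
  have := @integrable_pushforward _ _ _ _ R _ (@measurable_tuple_cons R n)
    (mu \x leb n)%E setT (EFin \o F) _ _ measurableT.
  rewrite preimage_setT; apply => //; exact/measurable_EFinP.
apply/integrableP; split; first by apply/measurable_EFinP; exact: measurable_tcons.
move/integrableP : iF => [_].
rewrite (ge0_integral_pushforward (@measurable_tuple_cons R n) (mu \x leb n)%E)//.
by apply: measurableT_comp => //; exact/measurable_EFinP.
Qed.

Lemma Rintegral_cons n (F : n.+1.-tuple B -> R) : measurable_fun setT F ->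
  (leb n.+1).-integrable setT (EFin \o F) ->
  \int[leb n.+1]_t F t = fine (\int[mu \x leb n]_p (F (tuple_cons p))%:E)%E.
Proof.
move=> mF iF; congr fine.
have := @integral_pushforward _ _ _ _ R _ (@measurable_tuple_cons R n)
  (mu \x leb n)%E setT (EFin \o F) _ _ measurableT.
rewrite preimage_setT; apply; first exact/measurable_EFinP.
by move/(integrable_prod_cons mF): iF.
Qed.

Lemma integrable_weight n : (leb n).-integrable setT (EFin \o @weight n).
Proof.
elim: n => [|n IH].
  apply/integrableP; split; first by apply/measurable_EFinP; exact: measurable_weight.
  rewrite (_ : (fun x => _) = cst 1%E); last first.
    by apply/funext => t; rewrite /= /weight big_ord0 normr1.
  by rewrite integral_cst// /lebesgue_tuple /= diracT mul1e ltry.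
apply/(integrable_prod_cons (@measurable_weight n.+1)).
have mw : measurable_fun setT (fun p => weight (@tuple_cons R n p)).
  exact: measurable_tcons (@measurable_weight n.+1).
apply/integrable12ltyP; first exact/measurable_EFinP.
have fin : (\int[leb n]_t (weight t)%:E)%E \is a fin_num.
  exact: (integrable_fin_num measurableT IH).
under eq_integral => x _.
  under eq_integral => t _.
    rewrite weight_cons /= ger0_norm ?mulr_ge0 ?cauchyw_ge0 ?weight_ge0// EFinM.
    over.
  rewrite integralZl// -[X in (_ * X)%E](fineK fin).
  over.
rewrite integralZr//; last exact: integrable_cauchyw.
have fin2 : (\int[mu]_x (cauchyw x)%:E)%E \is a fin_num.
  exact: (integrable_fin_num measurableT integrable_cauchyw).
by rewrite -[X in (X * _)%E](fineK fin2) -EFinM ltry.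
Qed.

Lemma integrable_dom n (F : n.-tuple B -> R) K : measurable_fun setT F ->
  (forall t, `|F t| <= K * weight t) -> (leb n).-integrable setT (EFin \o F).
Proof.
move=> mF FK; apply: (@dominated_integrable _ _ R (leb n) setT F (@weight n) K) => //.
exact: integrable_weight.
Qed.

Lemma dom_slicer n (F : n.+1.-tuple B -> R) K x : (forall t, `|F t| <= K * weight t) ->
  forall t, `|F (tuple_cons (x, t))| <= K * cauchyw x * weight t.
Proof. by move=> FK t; rewrite -mulrA -weight_cons. Qed.

Lemma dom_slicel n (F : n.+1.-tuple B -> R) K t : (forall t, `|F t| <= K * weight t) ->
  forall x, `|F (tuple_cons (x, t))| <= K * weight t * cauchyw x.
Proof. by move=> FK x; rewrite mulrAC -mulrA -weight_cons. Qed.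

Lemma Rintegral_cons1 n (F : n.+1.-tuple B -> R) K : measurable_fun setT F ->
  (forall t, `|F t| <= K * weight t) ->
  \int[leb n.+1]_t F t = \int[mu]_x \int[leb n]_t F (tuple_cons (x, t)).
Proof.
move=> mF FK; have iF := integrable_dom mF FK.
rewrite Rintegral_cons// -integral12_prod_meas1; last exact/integrable_prod_cons.
congr fine; apply: eq_integral => x _; rewrite /fubini_F /= fineK//.
apply: (integrable_fin_num measurableT).
exact: integrable_dom (measurable_slicer x mF) (dom_slicer x FK).
Qed.

Lemma Rintegral_cons2 n (F : n.+1.-tuple B -> R) K : measurable_fun setT F ->
  (forall t, `|F t| <= K * weight t) ->
  \int[leb n.+1]_t F t = \int[leb n]_t \int[mu]_x F (tuple_cons (x, t)).
Proof.
move=> mF FK; have iF := integrable_dom mF FK.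
rewrite Rintegral_cons// -integral21_prod_meas1; last exact/integrable_prod_cons.
congr fine; apply: eq_integral => t _; rewrite /fubini_G /= fineK//.
apply: (integrable_fin_num measurableT).
apply: (@dominated_integrable _ _ R mu setT _ cauchyw (K * weight t)) => //.
- exact: integrable_cauchyw.
- exact: measurable_slicel.
- by move=> x _; exact: dom_slicel.
Qed.

Lemma Rintegral_tensor n (F : n.+1.-tuple B -> R) (a : R -> R) (b : n.-tuple B -> R) K :
  measurable_fun setT F -> (forall t, `|F t| <= K * weight t) ->
  measurable_fun setT b -> (exists K', forall t, `|b t| <= K' * weight t) ->
  continuous a -> (exists K', forall x, `|a x| <= K' * cauchyw x) ->
  (forall x t, F (tuple_cons (x, t)) = a x * b t) ->
  \int[leb n.+1]_t F t = \int[mu]_x a x * \int[leb n]_t b t.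
Proof.
move=> mF FK mb [K1 bK] ca [K2 aK] Fab; rewrite (Rintegral_cons1 mF FK).
rewrite -RintegralZr//; last first.
  by apply: (integrable_cauchyw_dom (K := K2)).
congr fine; apply: eq_integral => x _; congr EFin.
rewrite -RintegralZl//; last exact: integrable_dom bK.
by congr fine; apply: eq_integral => t _; rewrite Fab.
Qed.

Definition upd n (t : n.-tuple B) (j : 'I_n) (s : B) : n.-tuple B :=
  [tuple (if i == j then s else tnth t i) | i < n].

Lemma upd_cons0 n x s (t : n.-tuple B) :
  upd (tuple_cons (x, t)) ord0 s = tuple_cons (s, t).
Proof.
apply: eq_from_tnth => i; rewrite tnth_mktuple.
case: (unliftP ord0 i) => [i'|] ->; last by rewrite eqxx.
rewrite eq_sym (negbTE (neq_lift _ _)) !tnthS.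
by congr (tnth _ _); exact: val_inj.
Qed.

Lemma tnth_cons_lift n x (t : n.-tuple B) i : tnth (tuple_cons (x, t)) (lift ord0 i) = tnth t i.
Proof. by rewrite tnthS; congr (tnth _ _); exact: val_inj. Qed.

Lemma upd_consS n x s (t : n.-tuple B) j :
  upd (tuple_cons (x, t)) (lift ord0 j) s = tuple_cons (x, upd t j s).
Proof.
apply: eq_from_tnth => i; rewrite tnth_mktuple.
case: (unliftP ord0 i) => [i'|] ->.
  by rewrite !tnth_cons_lift tnth_mktuple (inj_eq lift_inj).
by rewrite (negbTE (neq_lift _ _)).
Qed.

Lemma cauchyw_cvg0 (H : R -> R) K : (forall x, `|H x| <= K * cauchyw x) ->
  H x @[x --> +oo] --> (0 : R).
Proof.
move=> HK; apply/cvgr0Pnorm_le => e e0; near=> x.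
have x1 : 1 <= x by near: x; exact: nbhs_pinfty_ge.
have x0 : 0 < x by apply: lt_le_trans x1.
have K0 : 0 <= K.
  by have := le_trans (normr_ge0 _) (HK 0); rewrite pmulr_lge0// cauchyw_gt0.
apply: le_trans (HK x) _; rewrite /cauchyw ler_pdivrMr ?ltr_pwDl ?sqr_ge0//.
apply: (@le_trans _ _ (e * x)).
  rewrite -ler_pdivrMl// mulrC; near: x; exact: nbhs_pinfty_ge.
rewrite ler_wpM2l ?(ltW e0)// (le_trans (_ : x <= x ^+ 2))//.
  by rewrite expr2 ler_peMl// ltW.
by rewrite lerDr.
Unshelve. all: by end_near. Qed.

Lemma Rintegral_derive1D (H h : R -> R) K : continuous h ->
  (forall x, is_derive x (1 : R) H (h x)) ->
  (forall x, `|h x| <= K * cauchyw x) -> (forall x, `|H x| <= K * cauchyw x) ->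
  \int[mu]_x h x = 0.
Proof.
move=> ch dH hK HK; rewrite (line_FTC ch dH hK (l := 0) (l' := 0)) ?subr0//.
  exact: cauchyw_cvg0 HK.
apply/cvgNy_compNP; apply: (@cauchyw_cvg0 _ K) => x.
by rewrite /= -cauchywN; exact: HK.
Qed.

(** Fubini is applied in the order that keeps the [j]-th variable inside: the first variable goes
    outside if [j] is another one, and induction treats the tail; the tail goes outside if [j] is
    the first. The inner integral then vanishes by the one-variable case. *)
Lemma Rintegral_derive n (j : 'I_n) (U dU : n.-tuple B -> R) K :
  measurable_fun setT dU ->
  (forall t, `|U t| <= K * weight t) -> (forall t, `|dU t| <= K * weight t) ->
  (forall t, continuous (fun s : R => dU (upd t j s))) ->
  (forall t (s : R), is_derive s (1 : R) (fun s : R => U (upd t j s)) (dU (upd t j s))) ->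
  \int[leb n]_t dU t = 0.
Proof.
elim: n j U dU K => [|n IH] j U dU K mdU UK dUK cdU dUU; first by case: (j).
case: (unliftP ord0 j) => [j'|] jE.
  rewrite (Rintegral_cons1 mdU dUK).
  rewrite (_ : (fun x => _) = fun=> 0); first by rewrite Rintegral_cst// mul0r.
  apply/funext => x; apply: (IH j' (fun t => U (tuple_cons (x, t))) _ (K * cauchyw x)).
  - exact: measurable_slicer.
  - exact: dom_slicer.
  - exact: dom_slicer.
  - move=> t; have := cdU (tuple_cons (x, t)); rewrite jE.
    by under eq_fun do rewrite upd_consS.
  - move=> t s; have := dUU (tuple_cons (x, t)) s; rewrite jE upd_consS.
    by under [fun s => _]eq_fun do rewrite upd_consS.
rewrite (Rintegral_cons2 mdU dUK).
rewrite (_ : (fun x => _) = fun=> 0); first by rewrite Rintegral_cst// mul0r.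
apply/funext => t.
apply: (@Rintegral_derive1D (fun x => U (tuple_cons (x, t))) _ (K * weight t)).
- have := cdU (tuple_cons (0, t)); rewrite jE.
  by under eq_fun do rewrite upd_cons0.
- move=> s; have := dUU (tuple_cons (0, t)) s; rewrite jE upd_cons0.
  by under [fun s => _]eq_fun do rewrite upd_cons0.
- exact: dom_slicel.
- exact: dom_slicel.
Qed.

End TupleIntegral.

(** * Derivability and continuity from explicit remainder bounds *)

Section Remainders.
Context {R : realType}.

(** This is how differentiation under the integral sign is carried out: a remainder of order h^2 is
    an inequality, and an inequality can be integrated. *)
Lemma is_derive_quadratic {V : normedModType R} (g : V -> R) x v (dg K : R) :
  (forall h : R, `|g (h *: v + x) - g x - h * dg| <= K * h ^+ 2) ->
  is_derive x v g dg.
Proof.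
move=> gK; have H : h^-1 *: ((g \o shift x) (h *: v) - g x) @[h --> 0^'] --> dg.
  apply/cvgrPdist_le => e e0; near=> h.
  have h0 : h != 0 by near: h; exact: nbhs_dnbhs_neq.
  have -> : dg - h^-1 *: ((g \o shift x) (h *: v) - g x) =
      - (h^-1 * (g (h *: v + x) - g x - h * dg)).
    by rewrite /GRing.scale/= [in RHS]mulrBr mulKf// opprB.
  rewrite normrN normrM normfV ler_pdivrMl ?normr_gt0//.
  apply: le_trans (gK h) _.
  apply: (@le_trans _ _ ((`|K| + 1) * h ^+ 2)).
    by rewrite ler_wpM2r ?sqr_ge0// (le_trans (ler_norm _))// lerDl.
  rewrite -[h ^+ 2]real_normK ?num_real// expr2 mulrCA ler_wpM2l//.
  rewrite -ler_pdivlMl ?ltr_wpDl//.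
  by near: h; apply: dnbhs0_le; rewrite mulr_gt0// invr_gt0 ltr_wpDl.
by apply: DeriveDef; [apply/cvg_ex; exists dg; exact: H|apply/cvg_lim => //; exact: H].
Unshelve. all: by end_near. Qed.

Lemma lipschitz_cont {V : normedModType R} (g : V -> R) (K : R) :
  (forall x y, `|g x - g y| <= K * `|x - y|) -> continuous g.
Proof.
move=> gK x; apply/cvgrPdist_le => e e0; near=> y.
apply: le_trans (gK x y) _.
apply: (@le_trans _ _ ((`|K| + 1) * `|x - y|)).
  by rewrite ler_wpM2r// (le_trans (ler_norm _))// lerDl.
rewrite -ler_pdivlMl ?ltr_wpDl//.
by near: y; apply: cvgr_dist_le => //; rewrite mulr_gt0// invr_gt0 ltr_wpDl.
Unshelve. all: by end_near. Qed.

End Remainders.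

(** * Complex integrals of dominated continuous functions *)

Section ComplexIntegral.
Context {R : realType} {n : nat}.
Local Notation C := R[i].
Local Notation V := 'rV[R]_n.
Local Notation Re := complex.Re.
Local Notation Im := complex.Im.
Local Notation leb := (lebesgue_tuple R n).
Implicit Types (f g : V -> C) (x : V).

Definition ccontinuous f :=
  continuous (fun x => Re (f x)) /\ continuous (fun x => Im (f x)).

Definition rweight x : R := \prod_(j < n) cauchyw (x 0 j).

Definition cdom f := ccontinuous f /\ exists K, forall x, normc (f x) <= K * rweight x.

Lemma rweight_trow (t : n.-tuple (measurableTypeR R)) : rweight (trow t) = weight t.
Proof. by apply: eq_bigr => j _; rewrite trowE. Qed.

Lemma rweight_gt0 x : 0 < rweight x.
Proof. by apply: prodr_gt0 => j _; exact: cauchyw_gt0. Qed.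

Lemma cdom_integrable f : cdom f ->
  leb.-integrable setT (EFin \o (fun t => Re (f (trow t)))) /\
  leb.-integrable setT (EFin \o (fun t => Im (f (trow t)))).
Proof.
move=> [[cr ci] [K fK]]; split; apply: (@integrable_dom _ _ _ K).
- exact: (@measurable_trow R n (fun x => Re (f x))).
- by move=> t; rewrite -rweight_trow; exact: le_trans (normc_Re _) (fK _).
- exact: (@measurable_trow R n (fun x => Im (f x))).
- by move=> t; rewrite -rweight_trow; exact: le_trans (normc_Im _) (fK _).
Qed.

Lemma continuousRD (f g : V -> R) : continuous f -> continuous g ->
  continuous (fun x => f x + g x).
Proof. exact: (@CnD R V _ dir 0). Qed.

Lemma continuousRB (f g : V -> R) : continuous f -> continuous g ->
  continuous (fun x => f x - g x).
Proof. exact: (@CnB R V _ dir 0). Qed.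

Lemma continuousRM (f g : V -> R) : continuous f -> continuous g ->
  continuous (fun x => f x * g x).
Proof. exact: (@CnM R V _ dir 0). Qed.

Lemma continuousR_cst (c : R) : continuous (fun _ : V => c).
Proof. exact: (@Cn_cst R V _ dir 0). Qed.

Lemma ccontinuousD f g : ccontinuous f -> ccontinuous g ->
  ccontinuous (fun x => f x + g x).
Proof.
move=> [fr fi] [gr gi]; split.
  by rewrite (_ : (fun x => _) = fun x => Re (f x) + Re (g x));
    [exact: continuousRD|apply/funext => x; exact: cReD].
by rewrite (_ : (fun x => _) = fun x => Im (f x) + Im (g x));
  [exact: continuousRD|apply/funext => x; exact: cImD].
Qed.

Lemma ccontinuousM f g : ccontinuous f -> ccontinuous g ->
  ccontinuous (fun x => f x * g x).
Proof.
move=> [fr fi] [gr gi]; split.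
  rewrite (_ : (fun x => _) = fun x => Re (f x) * Re (g x) - Im (f x) * Im (g x)).
    by apply: continuousRB; exact: continuousRM.
  by apply/funext => x; exact: cReM.
rewrite (_ : (fun x => _) = fun x => Re (f x) * Im (g x) + Im (f x) * Re (g x)).
  by apply: continuousRD; exact: continuousRM.
by apply/funext => x; exact: cImM.
Qed.

Lemma ccontinuous_cst (c : C) : ccontinuous (fun=> c).
Proof. by split; exact: continuousR_cst. Qed.

Lemma cdomD f g : cdom f -> cdom g -> cdom (fun x => f x + g x).
Proof.
move=> [cf [K fK]] [cg [L gL]]; split; first exact: ccontinuousD.
exists (K + L) => x; rewrite mulrDl; apply: le_trans (normcD _ _) _.
exact: lerD.
Qed.

Lemma cdomZ (c : C) f : cdom f -> cdom (fun x => c * f x).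
Proof.
move=> [cf [K fK]]; split; first exact: ccontinuousM (ccontinuous_cst c) cf.
by exists (normc c * K) => x; rewrite normcM -mulrA ler_wpM2l// normc_ge0.
Qed.

Lemma cintegralE f : cintegral f =
  (\int[leb]_t Re (f (trow t)) +i* \int[leb]_t Im (f (trow t)))%C.
Proof. by []. Qed.

Lemma cintegralD f g : cdom f -> cdom g ->
  cintegral (fun x => f x + g x) = cintegral f + cintegral g.
Proof.
move=> /cdom_integrable[fr fi] /cdom_integrable[gr gi].
apply: complexP; rewrite ?cReD ?cImD !cintegralE /=.
  rewrite -(RintegralD measurableT fr gr); congr fine.
  by apply: eq_integral => t _; rewrite cReD.
rewrite -(RintegralD measurableT fi gi); congr fine.
by apply: eq_integral => t _; rewrite cImD.
Qed.

Lemma cintegralZ (c : C) f : cdom f ->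
  cintegral (fun x => c * f x) = c * cintegral f.
Proof.
move=> /cdom_integrable[fr fi].
have Z (a : R) (F : n.-tuple (measurableTypeR R) -> R) : leb.-integrable setT (EFin \o F) ->
    leb.-integrable setT (EFin \o (fun t => a * F t)).
  by move=> iF; exact: (integrableZl measurableT a iF).
apply: complexP; rewrite ?cReM ?cImM !cintegralE /=.
  rewrite -(RintegralZl (Re c) measurableT fr) -(RintegralZl (Im c) measurableT fi).
  rewrite -(RintegralB measurableT (Z _ _ fr) (Z _ _ fi)); congr fine.
  by apply: eq_integral => t _; rewrite cReM.
rewrite -(RintegralZl (Im c) measurableT fr) -(RintegralZl (Re c) measurableT fi).
rewrite -(RintegralD measurableT (Z _ _ fi) (Z _ _ fr)); congr fine.
by apply: eq_integral => t _; rewrite cImM.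
Qed.

(** The factor 2 comes from estimating the real and imaginary parts separately. *)
Lemma cintegral_le f (b : V -> R) : cdom f -> (forall x, normc (f x) <= b x) ->
  leb.-integrable setT (EFin \o (fun t => b (trow t))) ->
  normc (cintegral f) <= 2 * \int[leb]_t b (trow t).
Proof.
move=> /cdom_integrable[fr fi] fb ib; rewrite cintegralE.
apply: le_trans (normc_le _) _; rewrite /= mulr_natl mulr2n.
apply: lerD; (apply: le_trans (le_normr_Rintegral measurableT _) _ => //;
  apply: le_Rintegral => //; first exact: integrable_norm).
  by move=> t _; exact: le_trans (normc_Re _) (fb _).
by move=> t _; exact: le_trans (normc_Im _) (fb _).
Qed.

Lemma cintegral_le_weight f (K : R) : ccontinuous f ->
  (forall x, normc (f x) <= K * rweight x) ->
  normc (cintegral f) <= 2 * K * \int[leb]_t weight t.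
Proof.
move=> cf fK; apply: le_trans (cintegral_le (b := fun x => K * rweight x) _ fK _) _.
- by split => //; exists K.
- rewrite (_ : _ \o _ = EFin \o (fun t => K * weight t)); last first.
    by apply/funext => t /=; rewrite rweight_trow.
  exact: (integrableZl measurableT K (integrable_weight _)).
- rewrite -mulrA -(RintegralZl K measurableT (integrable_weight _)).
  rewrite ler_wpM2l// le_eqVlt; apply/orP; left; apply/eqP; congr fine; apply: eq_integral => t _.
  by rewrite rweight_trow.
Qed.

Lemma trow_upd (t : n.-tuple (measurableTypeR R)) j (s : R) :
  trow (upd t j s) = s *: dir j + (trow t - tnth t j *: dir j).
Proof.
apply/rowP => i; rewrite !mxE tnth_mktuple eqxx /=.
by case: eqP => [->|_]; rewrite ?mulr1 ?mulr0 /=; ring.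
Qed.

Lemma is_derive_shift_line (g : V -> R) (v b : V) (s : R) dg :
  is_derive (s *: v + b) v g dg ->
  is_derive s (1 : R) (fun u : R => g (u *: v + b)) dg.
Proof.
move=> /is_derive_line H.
have E : (fun u : R => g (u *: v + b)) =
    (fun h : R => g (h *: v + (s *: v + b))) \o (fun u => u - s).
  by apply/funext => u /=; rewrite addrA -scalerDl subrK.
rewrite E -[dg]mulr1; apply: is_derive1_comp; first by rewrite subrr.
have := is_deriveB (is_derive_id s (1 : R)) (is_derive_cst s s (1 : R)).
by rewrite subr0.
Qed.

Lemma Rintegral_pd (g : V -> R) j (K : R) : continuous g -> continuous (pd dir j g) ->
  (forall x, derivable g x (dir j)) ->
  (forall x, `|g x| <= K * rweight x) -> (forall x, `|pd dir j g x| <= K * rweight x) ->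
  \int[leb]_t pd dir j g (trow t) = 0.
Proof.
move=> cg cpg dg gK pgK.
apply: (@Rintegral_derive _ _ j (fun t => g (trow t)) _ K).
- exact: measurable_trow.
- by move=> t; rewrite -rweight_trow.
- by move=> t; rewrite -rweight_trow.
- move=> t; rewrite (_ : (fun s => _) =
    (fun s => pd dir j g (s *: dir j + (trow t - tnth t j *: dir j)))); last first.
    by apply/funext => s; rewrite trow_upd.
  move=> s; apply: (@continuous_comp _ _ _
    (fun s : R => s *: dir j + (trow t - tnth t j *: dir j))); last exact: cpg.
  apply: (@cvgD R V _ (nbhs s) _ (fun s => s *: dir j) (fun=> _)); last exact: cvg_cst.
  exact: (@scalel_continuous R V (dir j) s).
- move=> t s; rewrite (_ : (fun s => _) =
    (fun s => g (s *: dir j + (trow t - tnth t j *: dir j)))); last first.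
    by apply/funext => u; rewrite trow_upd.
  by rewrite trow_upd; apply: is_derive_shift_line; exact: is_derive_pd.
Qed.

Lemma cintegral_cpd f j (K : R) : csmooth f ->
  (forall x, normc (f x) <= K * rweight x) ->
  (forall x, normc (cpd j f x) <= K * rweight x) ->
  cintegral (cpd j f) = 0.
Proof.
move=> sf fK pfK; have [cr ci] := smooth_cont sf.
have [cpr cpi] := smooth_cont (smooth_cpd j sf).
have sd x := smooth_derivable j x sf.
have EQr x : Re (cpd j f x) = pd dir j (fun y => Re (f y)) x by rewrite cpd.unlock.
have EQi x : Im (cpd j f x) = pd dir j (fun y => Im (f y)) x by rewrite cpd.unlock.
rewrite cintegralE; apply: complexP => /=.
  under eq_Rintegral do rewrite EQr.
  apply: (@Rintegral_pd _ j K) => //.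
  - by move: cpr; under [fun x => _]eq_fun do rewrite EQr.
  - by move=> x; case: (sd x).
  - by move=> x; exact: le_trans (normc_Re _) (fK _).
  - by move=> x; rewrite -EQr; exact: le_trans (normc_Re _) (pfK _).
under eq_Rintegral do rewrite EQi.
apply: (@Rintegral_pd _ j K) => //.
- by move: cpi; under [fun x => _]eq_fun do rewrite EQi.
- by move=> x; case: (sd x).
- by move=> x; exact: le_trans (normc_Im _) (fK _).
- by move=> x; rewrite -EQi; exact: le_trans (normc_Im _) (pfK _).
Qed.

End ComplexIntegral.

(** * Schwartz seminorms *)

Section Seminorms.
Context {R : realType} {n : nat}.
Local Notation C := R[i].
Local Notation V := 'rV[R]_n.
Implicit Types (f g u v : V -> C) (x l : V).

(** One index [m] measures both the weight and the number of derivatives, so every operation is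
    described by how far it shifts this index. [K] is any bound and not the least one, which keeps
    suprema out of the estimates. *)
Definition sbound m f (K : R) := forall s, (size s <= m)%N ->
  forall x, (1 + `|x|) ^+ m * normc (foldr cpd f s x) <= K.

Definition cschwartz f := csmooth f /\ forall m, exists K, sbound m f K.

Lemma norm1_ge1 x : 1 <= 1 + `|x|. Proof. by rewrite lerDl. Qed.

Lemma norm1_gt0 x : 0 < 1 + `|x|. Proof. exact: lt_le_trans ltr01 (norm1_ge1 x). Qed.

Lemma norm1X_ge1 x m : 1 <= (1 + `|x|) ^+ m. Proof. exact/exprn_ege1/norm1_ge1. Qed.

Lemma norm1X_ge0 x m : 0 <= (1 + `|x|) ^+ m. Proof. exact/exprn_ge0/ltW/norm1_gt0. Qed.

Lemma sbound_ge0 m f K : sbound m f K -> 0 <= K.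
Proof.
move=> /(_ [::] isT 0); apply: le_trans.
by rewrite mulr_ge0 ?norm1X_ge0 ?normc_ge0.
Qed.

Lemma sbound_le m f K K' : K <= K' -> sbound m f K -> sbound m f K'.
Proof. by move=> KK' fK s sm x; exact: le_trans (fK s sm x) KK'. Qed.

Lemma sboundW m m' f K : (m <= m')%N -> sbound m' f K -> sbound m f K.
Proof.
move=> mm' fK s sm x; apply: le_trans (fK s (leq_trans sm mm') x).
by apply: ler_wpM2r; [exact: normc_ge0|apply: ler_weXn2l => //; exact: norm1_ge1].
Qed.

Lemma sboundD m f g K L : csmooth f -> csmooth g -> sbound m f K -> sbound m g L ->
  sbound m (fun x => f x + g x) (K + L).
Proof.
move=> sf sg fK gL s sm x; rewrite foldrD//.
apply: le_trans (lerD (fK s sm x) (gL s sm x)).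
by rewrite -mulrDr ler_wpM2l ?norm1X_ge0// normcD.
Qed.

Lemma sboundZ m (c : C) f K : csmooth f -> sbound m f K ->
  sbound m (fun x => c * f x) (normc c * K).
Proof.
move=> sf fK s sm x; rewrite foldrZ// normcM mulrCA.
by apply: ler_wpM2l; [exact: normc_ge0|exact: fK].
Qed.

Lemma sbound_cpd m j f K : sbound m.+1 f K -> sbound m (cpd j f) K.
Proof.
move=> fK s sm x; rewrite -foldr_rcons.
apply: le_trans (fK (rcons s j) _ x); last by rewrite size_rcons.
by apply: ler_wpM2r; [exact: normc_ge0|apply: ler_weXn2l => //; exact: norm1_ge1].
Qed.

(** At each fixed point the Leibniz bound is applied with G (1 + |x|)^q for [g] and K / (1 + |x|)^(m
    + q) for [f]. A multiplier of growth [q] thus costs [q] in the index. *)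
Lemma sboundM m q g f (G K : R) : csmooth g -> csmooth f ->
  (forall s, (size s <= m)%N -> forall x, normc (foldr cpd g s x) <= G * (1 + `|x|) ^+ q) ->
  sbound (m + q) f K -> sbound m (fun x => g x * f x) (2 ^+ m * G * K).
Proof.
move=> sg sf gG fK s sm x.
have G0 : 0 <= G.
  have := le_trans (normc_ge0 _) (gG [::] isT 0).
  by rewrite pmulr_lge0// exprn_gt0// norm1_gt0.
have fB t : (size t <= m)%N -> normc (foldr cpd f t x) <= K / (1 + `|x|) ^+ (m + q).
  move=> tm; rewrite ler_pdivlMr ?exprn_gt0 ?norm1_gt0// mulrC.
  exact: fK (leq_trans tm (leq_addr _ _)) x.
have := leibniz_bound sg sf (fun t tm => gG t tm x) fB sm.
have p0 : 0 < 1 + `|x| by exact: norm1_gt0.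
move=> /(ler_wpM2l (norm1X_ge0 x m))/le_trans; apply.
rewrite le_eqVlt; apply/orP; left; apply/eqP.
rewrite exprD; field.
by rewrite !expf_neq0 ?lt0r_neq0.
Qed.

Lemma foldr_cst (c : C) s : foldr cpd (fun _ : V => c) s =
  fun=> if s is [::] then c else 0.
Proof.
elim: s => [|j s IH] //=; rewrite IH cpd_cst; by case: s {IH}.
Qed.

Lemma foldr_coord j s x : normc (foldr cpd (fun y : V => (y 0 j)%:C%C) s x) <= 1 + `|x|.
Proof.
case/lastP: s => [|s i]; rewrite ?foldr_rcons ?cpd_coord /=.
  by rewrite expr0n /= addr0 sqrtr_sqr (le_trans (coord_le_norm x j))// lerDr.
rewrite foldr_cst; case: s => [|a s]; last by rewrite normc0 ltW ?norm1_gt0.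
case: (i == j); rewrite ?mulr1n ?mulr0n; first by rewrite ComplexField.Normc.normc1 norm1_ge1.
by rewrite normc0 ltW ?norm1_gt0.
Qed.

Lemma sbound_coord m j f K : csmooth f -> sbound m.+1 f K ->
  sbound m (fun x => (x 0 j)%:C%C * f x) (2 ^+ m * K).
Proof.
move=> sf fK; rewrite -[2 ^+ m]mulr1.
apply: (@sboundM m 1) => //; first exact: smooth_coord.
  by move=> s _ x; rewrite mul1r expr1; exact: foldr_coord.
by rewrite addn1.
Qed.

(** Every coordinate contributes 1 + x_j^2 <= (1 + |x|)^2, whence the exponent [n.*2]: this is the
    decay that guarantees integrability. *)
Lemma rweight_norm1 x : 1 <= rweight x * (1 + `|x|) ^+ n.*2.
Proof.
rewrite -muln2 mulnC exprM -[X in _ ^+ X]card_ord -prodr_const -big_split /=.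
elim/big_ind: _ => // [a b|j _]; first exact: mulr_ege1.
 rewrite /cauchyw mulrC ler_pdivlMr ?ltr_pwDl ?sqr_ge0// mul1r.
rewrite sqrrD expr1n mul1r -[x 0 j ^+ 2]real_normK ?num_real//.
apply: lerD; first by rewrite lerDl mulrn_wge0.
by rewrite lerXn2r ?nnegrE// coord_le_norm.
Qed.

Lemma norm1_le_rweight f K : (forall x, (1 + `|x|) ^+ n.*2 * normc (f x) <= K) ->
  forall x, normc (f x) <= K * rweight x.
Proof.
move=> fK x; have := fK x.
rewrite -(ler_pM2r (rweight_gt0 x)) => /(le_trans _); apply.
rewrite mulrAC [_ * rweight x]mulrC ler_peMl ?normc_ge0//; exact: rweight_norm1.
Qed.

Lemma sbound_rweight f K : sbound n.*2 f K -> forall x, normc (f x) <= K * rweight x.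
Proof. by move=> fK; apply: norm1_le_rweight => x; exact: (fK [::]). Qed.

Lemma cschwartz_cdom f : cschwartz f -> cdom f.
Proof.
move=> [sf /(_ n.*2)[K fK]]; split; first exact: smooth_cont.
by exists K; exact: sbound_rweight.
Qed.

Lemma cschwartzD f g : cschwartz f -> cschwartz g -> cschwartz (fun x => f x + g x).
Proof.
move=> [sf bf] [sg bg]; split; first exact: smoothD.
by move=> m; have [K fK] := bf m; have [L gL] := bg m; exists (K + L); exact: sboundD.
Qed.

Lemma cschwartzZ (c : C) f : cschwartz f -> cschwartz (fun x => c * f x).
Proof.
move=> [sf bf]; split; first exact: smoothZ.
by move=> m; have [K fK] := bf m; exists (normc c * K); exact: sboundZ.
Qed.

Lemma cschwartz_cpd j f : cschwartz f -> cschwartz (cpd j f).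
Proof.
move=> [sf bf]; split; first exact: smooth_cpd.
by move=> m; have [K fK] := bf m.+1; exists K; exact: sbound_cpd.
Qed.

Lemma cschwartz_coord j f : cschwartz f -> cschwartz (fun x => (x 0 j)%:C%C * f x).
Proof.
move=> [sf bf]; split; first exact/smoothM/sf/smooth_coord.
by move=> m; have [K fK] := bf m.+1; exists (2 ^+ m * K); exact: sbound_coord.
Qed.

End Seminorms.

(** * The exponential on the imaginary axis and its Taylor remainders *)

Section Expi.
Context {R : realType}.
Implicit Types t a b : R.
Local Notation C := R[i].

Lemma mean_value_le (f df : R -> R) M x :
  (forall t, is_derive t (1 : R) f (df t)) ->
  (forall t, `|t| <= `|x| -> `|df t| <= M) -> `|f x - f 0| <= M * `|x|.
Proof.
move=> dF dM; have cf : continuous f := derive_continuous dF.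
have [x0|x0|->] := ltgtP x 0; last by rewrite subrr !normr0 mulr0.
- have [c /itvP cx E] := @MVT R f df x 0 x0 (fun t _ => dF t) (@continuous_withinE R _ f cf).
  rewrite distrC E sub0r normrM normrN ler_wpM2r// dM//.
  by rewrite !ler0_norm ?lerN2 ?cx// ltW.
- have [c /itvP cx E] := @MVT R f df 0 x x0 (fun t _ => dF t) (@continuous_withinE R _ f cf).
  rewrite E subr0 normrM ler_wpM2r// dM//.
  by rewrite !ger0_norm ?cx// ltW.
Qed.

Lemma sin_le t : `|sin t| <= `|t|.
Proof.
have := @mean_value_le sin cos 1 t (fun u => is_derive_sin u).
rewrite sin0 subr0 mul1r; apply => u _; exact: cos_max.
Qed.

Lemma cosB1_le t : `|cos t - 1| <= `|t|.
Proof.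
have := @mean_value_le cos (fun u => - sin u) 1 t (fun u => is_derive_cos u).
rewrite cos0 mul1r; apply => u _; rewrite normrN; exact: sin_max.
Qed.

Lemma cosB1_le2 t : `|cos t - 1| <= t ^+ 2.
Proof.
have := @mean_value_le cos (fun u => - sin u) `|t| t (fun u => is_derive_cos u).
rewrite cos0 -real_normK ?num_real// expr2; apply => u ut.
by rewrite normrN; exact: le_trans (sin_le u) ut.
Qed.

Lemma sinB_le2 t : `|sin t - t| <= t ^+ 2.
Proof.
have dd (u : R) : is_derive u (1 : R) (fun u => sin u - u) (cos u - 1).
  exact: is_deriveB (is_derive_sin u) (is_derive_id u 1).
have := @mean_value_le _ _ `|t| t dd.
rewrite sin0 !subr0 -real_normK ?num_real// expr2; apply => u ut.
exact: le_trans (cosB1_le u) ut.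
Qed.

Lemma normc_expi t : normc (expi t) = 1.
Proof. by rewrite /= cos2Dsin2 sqrtr1. Qed.

Lemma expiD a b : expi (a + b) = expi a * expi b.
Proof.
apply: complexP; rewrite ?cReM ?cImM /=; first by rewrite cosD.
by rewrite sinD addrC.
Qed.

Lemma expi_remainder1 t : normc (expi t - 1) <= 2 * `|t|.
Proof.
apply: le_trans (normc_le _) _; rewrite mulr_natl mulr2n.
apply: lerD => /=; first exact: cosB1_le.
by rewrite subr0 sin_le.
Qed.

Lemma expi_remainder2 t : normc (expi t - 1 - (0 +i* t)%C) <= 2 * t ^+ 2.
Proof.
apply: le_trans (normc_le _) _; rewrite mulr_natl mulr2n.
apply: lerD => /=; first by rewrite subr0; exact: cosB1_le2.
by rewrite subr0; exact: sinB_le2.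
Qed.

Lemma Cn_expi {V : normedModType R} {J : Type} (e : J -> V) m (q : V -> R) :
  Cn e m q -> Cn e m (fun x => cos (q x)) /\ Cn e m (fun x => sin (q x)).
Proof.
pose h (b : bool) : R -> R := if b then cos else sin.
pose D (b : bool) : seq (R * bool) := if b then [:: (-1, false)] else [:: (1, true)].
have hD (b : bool) t : is_derive t (1 : R) (h b) (\sum_(c <- D b) c.1 * h c.2 t).
  by case: b; rewrite big_cons big_nil /= addr0 ?mulN1r ?mul1r;
    [exact: is_derive_cos|exact: is_derive_sin].
by move=> Cq; split; [exact: (Cn_comp true hD Cq)|exact: (Cn_comp false hD Cq)].
Qed.

End Expi.

(** * Fourier transform of Schwartz functions *)

Section Fourier.
Context {R : realType} {n : nat}.
Local Notation C := R[i].
Local Notation V := 'rV[R]_n.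
Local Notation Re := complex.Re.
Local Notation Im := complex.Im.
Local Notation leb := (lebesgue_tuple R n).
Implicit Types (f g : V -> C) (x l v : V).

Definition imag (t : R) : C := (0 +i* t)%C.

Lemma imagM (t : R) : imag t = imag 1 * t%:C%C.
Proof. by apply: complexP; rewrite ?cReM ?cImM /=; ring. Qed.

Lemma imagN (t : R) : imag (- t) = - imag t.
Proof. by apply: complexP; rewrite /= ?oppr0. Qed.

Lemma normc_imag (t : R) : normc (imag t) = `|t|.
Proof. by rewrite /= expr0n /= add0r sqrtr_sqr. Qed.

Definition wave l x : C := expi (- dotp l x).

Lemma dotpC l x : dotp l x = dotp x l.
Proof. by apply: eq_bigr => j _; rewrite mulrC. Qed.

Lemma dotpDl l l' x : dotp (l + l') x = dotp l x + dotp l' x.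
Proof. by rewrite /dotp -big_split; apply: eq_bigr => j _; rewrite mxE mulrDl. Qed.

Lemma dotpZl a l x : dotp (a *: l) x = a * dotp l x.
Proof. by rewrite /dotp mulr_sumr; apply: eq_bigr => j _; rewrite mxE mulrA. Qed.

Lemma dotp_dir j x : dotp (dir j) x = x 0 j.
Proof.
rewrite /dotp (bigD1 j)//= big1 ?addr0; first by rewrite /dir mxE !eqxx mul1r.
by move=> i /negbTE ij; rewrite /dir mxE ij andbF mul0r.
Qed.

Lemma dotp_le l x : `|dotp l x| <= n%:R * `|l| * `|x|.
Proof.
rewrite /dotp; apply: le_trans (ler_norm_sum _ _ _) _.
apply: (@le_trans _ _ (\sum_(j < n) (`|l| * `|x|))).
  by apply: ler_sum => j _; rewrite normrM ler_pM// coord_le_norm.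
by rewrite sumr_const card_ord -[leLHS]mulr_natl mulrA.
Qed.

Lemma Cn_dotp m l : Cn dir m (fun x => - dotp l x).
Proof.
apply: CnN; apply: Cn_sum => j; apply: CnM; first exact: Cn_cst.
exact: Cn_coord.
Qed.

Lemma is_derive_dotp l j x : is_derive x (dir j) (fun y => - dotp l y) (- l 0 j).
Proof.
apply: (@is_derive_quadratic _ _ _ _ _ _ 0) => h.
rewrite dotpC dotpDl dotpZl dotp_dir [dotp l x]dotpC mul0r.
by rewrite (_ : _ - _ = 0) ?normr0//; ring.
Qed.

Lemma smooth_wave l : csmooth (wave l).
Proof.
apply/csmoothE => m; have [Cc Cs] := Cn_expi (Cn_dotp m l).
by split; [exact: Cc|exact: Cs].
Qed.

Lemma cpd_wave l j : cpd j (wave l) = fun x => - imag (l 0 j) * wave l x.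
Proof.
apply/funext => x; rewrite cpd.unlock.
have H (h : R -> R) dh : is_derive (- dotp l x) (1 : R) h dh ->
    pd dir j (fun y => h (- dotp l y)) x = dh * - l 0 j.
  by move=> D; apply: is_derive_pdE;
    exact: (@is_derive_comp1 _ _ h (fun y => - dotp l y) x (dir j) _ _ D (is_derive_dotp l j x)).
rewrite (H _ _ (is_derive_cos (- dotp l x))) (H _ _ (is_derive_sin (- dotp l x))).
by apply: complexP; rewrite ?cReM ?cImM /=; ring.
Qed.

Lemma normc_wave l x : normc (wave l x) = 1. Proof. exact: normc_expi. Qed.

Definition cfourier : R := (2 * pi) `^ (- (n%:R / 2)).

Lemma cfourier_gt0 : 0 < cfourier.
Proof. by apply: powR_gt0; rewrite mulr_gt0 ?pi_gt0. Qed.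

Lemma fourierE f l : fourier f l = cfourier%:C%C * cintegral (fun x => f x * wave l x).
Proof. by []. Qed.

Lemma cdom_wave f l : cdom f -> cdom (fun x => f x * wave l x).
Proof.
move=> [cf [K fK]]; split; first exact: ccontinuousM cf (smooth_cont (smooth_wave l)).
by exists K => x; rewrite normcM normc_wave mulr1.
Qed.

Lemma fourierD f g l : cdom f -> cdom g ->
  fourier (fun x => f x + g x) l = fourier f l + fourier g l.
Proof.
move=> df dg; rewrite !fourierE -mulrDr; congr (_ * _).
rewrite -cintegralD; try exact: cdom_wave.
by congr (cintegral _); apply/funext => x; rewrite mulrDl.
Qed.

Lemma fourierZ (c : C) f l : cdom f ->
  fourier (fun x => c * f x) l = c * fourier f l.
Proof.
move=> df; rewrite !fourierE mulrCA; congr (_ * _).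
rewrite -cintegralZ; last exact: cdom_wave.
by congr (cintegral _); apply/funext => x; rewrite mulrA.
Qed.

Definition fourier_cst : R := cfourier * 2 * \int[leb]_t weight t.

Lemma fourier_cst_ge0 : 0 <= fourier_cst.
Proof.
rewrite !mulr_ge0// ?(ltW cfourier_gt0)//; apply: Rintegral_ge0 => t _.
exact: weight_ge0.
Qed.

Lemma integral_wave_le f l K : ccontinuous f -> (forall x, normc (f x) <= K * rweight x) ->
  normc (cfourier%:C%C * cintegral (fun x => f x * wave l x)) <= fourier_cst * K.
Proof.
move=> cf fK; rewrite normcM normc_real ger0_norm ?(ltW cfourier_gt0)//.
rewrite /fourier_cst -!mulrA ler_wpM2l ?(ltW cfourier_gt0)// [_ * K]mulrC mulrA.
apply: cintegral_le_weight; first exact: ccontinuousM cf (smooth_cont (smooth_wave l)).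
by move=> x; rewrite normcM normc_wave mulr1.
Qed.

Lemma fourier_le f l K : csmooth f -> sbound n.*2 f K ->
  normc (fourier f l) <= fourier_cst * K.
Proof.
move=> sf fK; rewrite fourierE; apply: integral_wave_le; first exact: smooth_cont.
exact: sbound_rweight.
Qed.

(** The factor -i is chosen so that a derivative of [fourier f] is the transform of [xmul j f], and
    a coordinate times [fourier f] is the transform of [dmul j f], with no further constants. *)
Definition xmul j f : V -> C := fun x => - imag 1 * ((x 0 j)%:C%C * f x).

Definition dmul j f : V -> C := fun x => - imag 1 * cpd j f x.

Lemma cschwartz_xmul j f : cschwartz f -> cschwartz (xmul j f).
Proof. by move=> sf; exact/cschwartzZ/cschwartz_coord. Qed.

Lemma cschwartz_dmul j f : cschwartz f -> cschwartz (dmul j f).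
Proof. by move=> sf; exact/cschwartzZ/cschwartz_cpd. Qed.

Lemma normc_Nimag1 : normc (- imag 1) = 1.
Proof. by rewrite normcN normc_imag normr1. Qed.

(** Integration by parts: the integral of the derivative of [f] times the wave vanishes. The
    constant K (1 + |l|) dominates both this product and its derivative. *)
Lemma fourier_coord j f l : cschwartz f ->
  (l 0 j)%:C%C * fourier f l = fourier (dmul j f) l.
Proof.
move=> Sf; have [sf bf] := Sf; have [K fK] := bf n.*2.+1.
have df := cschwartz_cdom Sf; have dpf := cschwartz_cdom (cschwartz_cpd j Sf).
have sw := smooth_wave l.
have E : cpd j (fun x => f x * wave l x) =
    fun x => cpd j f x * wave l x + - imag (l 0 j) * (f x * wave l x).
  rewrite cpdM// cpd_wave; apply/funext => x; ring.
have fK1 x : normc (f x) <= K * rweight x.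
  by apply: sbound_rweight; exact: sboundW fK.
have fK2 x : normc (cpd j f x) <= K * rweight x.
  by apply: sbound_rweight; exact: sbound_cpd.
have K0 := sbound_ge0 fK.
have := @cintegral_cpd _ _ (fun x => f x * wave l x) j (K * (1 + `|l|)) (smoothM sf sw).
rewrite E cintegralD; [|exact: cdom_wave|exact/cdomZ/cdom_wave].
rewrite cintegralZ; last exact: cdom_wave.
move=> H; have {}H := H _ _.
rewrite /dmul fourierZ// !fourierE.
have -> : cintegral (fun x => cpd j f x * wave l x) =
    imag (l 0 j) * cintegral (fun x => f x * wave l x).
  apply/eqP; rewrite -subr_eq0 -mulNr; apply/eqP; apply: H => x.
    rewrite normcM normc_wave mulr1; apply: le_trans (fK1 x) _.
    by rewrite ler_wpM2r ?(ltW (rweight_gt0 x))// ler_peMr// norm1_ge1.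
  apply: le_trans (normcD _ _) _; rewrite !normcM !normcN normc_imag normc_wave !mulr1.
  rewrite mulrDr mulr1 mulrDl lerD// mulrAC mulrC.
  by apply: ler_pM; rewrite ?normc_ge0// coord_le_norm.
rewrite (imagM (l 0 j)); set I := cintegral _; set cc := (cfourier%:C)%C.
have i2 : imag 1 * imag 1 = -1 :> C.
  by apply: complexP; rewrite ?cReM ?cImM /=; ring.
rewrite [RHS](_ : _ = - (imag 1 * imag 1) * ((l 0 j)%:C%C * (cc * I))); last by ring.
by rewrite i2 opprK mul1r.
Qed.

Lemma wave_shift l v x : wave (l + v) x = wave l x * expi (- dotp v x).
Proof. by rewrite /wave dotpDl opprD expiD. Qed.

Lemma fourier_diff f l v : cdom f ->
  fourier f (l + v) - fourier f l =
  cfourier%:C%C * cintegral (fun x => (f x * (expi (- dotp v x) - 1)) * wave l x).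
Proof.
move=> df; rewrite !fourierE -mulrBr; congr (_ * _).
have dN : cdom (fun x => -1 * (f x * wave l x)) by exact/cdomZ/cdom_wave.
rewrite -mulN1r -cintegralZ; last exact: cdom_wave.
rewrite -cintegralD; [|exact: cdom_wave|exact: dN].
by congr (cintegral _); apply/funext => x; rewrite wave_shift; ring.
Qed.

Lemma norm1_coord x : `|x| <= 1 + `|x|. Proof. by rewrite lerDr. Qed.

(** The bound |exp(it) - 1| <= 2 |t| with t linear in x costs one factor |x|, which explains the
    index [n.*2.+1]. *)
Lemma fourier_lipschitz f : cschwartz f -> exists K, forall l l',
  normc (fourier f l - fourier f l') <= K * `|l - l'|.
Proof.
move=> Sf; have [sf bf] := Sf; have [K fK] := bf n.*2.+1.
have df := cschwartz_cdom Sf.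
exists (fourier_cst * (2 * n%:R * K)) => l l'.
have -> : fourier f l - fourier f l' = fourier f (l' + (l - l')) - fourier f l'.
  by rewrite [l' + _]addrC subrK.
rewrite fourier_diff//.
rewrite -[leRHS]mulrA; apply: integral_wave_le.
  apply: ccontinuousM; first exact: smooth_cont.
  apply: ccontinuousD; last exact: ccontinuous_cst.
  exact: smooth_cont (smooth_wave (l - l')).
move=> x; rewrite normcM.
apply: (@le_trans _ _ (normc (f x) * (2 * (n%:R * `|l - l'| * `|x|)))).
  apply: ler_wpM2l; first exact: normc_ge0.
  apply: le_trans (expi_remainder1 _) _; rewrite normrN ler_wpM2l//; exact: dotp_le.
rewrite [leLHS](_ : _ = (2 * n%:R * `|l - l'|) * (`|x| * normc (f x))); last by ring.
rewrite [leRHS](_ : _ = (2 * n%:R * `|l - l'|) * (K * rweight x)); last by ring.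
apply: ler_wpM2l; first by rewrite !mulr_ge0.
rewrite -[`|x|]ger0_norm// -normc_real -normcM.
apply: (@norm1_le_rweight _ _ (fun x => (`|x|)%:C%C * f x)) => y.
rewrite normcM normc_real ger0_norm// mulrA.
apply: le_trans (fK [::] isT y); apply: ler_wpM2r; first exact: normc_ge0.
by rewrite exprSr ler_wpM2l ?norm1X_ge0// norm1_coord.
Qed.

(** The second-order remainder of exp(it) costs a factor x_j^2, whence the index [n.*2.+2]. *)
Lemma fourier_remainder f j : cschwartz f -> exists K, forall l (h : R),
  normc (fourier f (h *: dir j + l) - fourier f l - h%:C%C * fourier (xmul j f) l)
  <= K * h ^+ 2.
Proof.
move=> Sf; have [sf bf] := Sf; have [K fK] := bf n.*2.+2.
have df := cschwartz_cdom Sf; have Sx := cschwartz_xmul j Sf.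
exists (fourier_cst * (2 * K)) => l h.
rewrite addrC [_ + l]addrC fourier_diff// addrC -mulNr -fourierZ; last exact: cschwartz_cdom.
rewrite fourierE -mulrDr -cintegralD; last 2 first.
- move: (fourier_diff l (h *: dir j) df) => _.
  have -> : (fun x => f x * (expi (- dotp (h *: dir j) x) - 1) * wave l x) =
     (fun x => f x * wave (l + h *: dir j) x + -1 * (f x * wave l x)).
    by apply/funext => x; rewrite wave_shift; ring.
  by apply: cdomD; [exact: cdom_wave|apply: cdomZ; exact: cdom_wave].
- by apply: cdom_wave; apply: cdomZ; exact: cschwartz_cdom.
pose r x := expi (- dotp (h *: dir j) x) - 1 - imag (- (h * x 0 j)).
rewrite (_ : (fun x => _) = (fun x => f x * r x * wave l x)); last first.
  apply/funext => x; rewrite /r /xmul imagN (imagM (h * x 0 j)) rmorphM /=; ring.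
rewrite -mulrA.
apply: integral_wave_le.
  apply: ccontinuousM; first exact: smooth_cont.
  apply: (@ccontinuousD _ _ (fun x => expi (- dotp (h *: dir j) x) - 1)).
    apply: ccontinuousD; last exact: ccontinuous_cst.
    exact: smooth_cont (smooth_wave (h *: dir j)).
  apply: smooth_cont; apply: smoothN; under eq_fun do rewrite imagM.
  apply: smoothZ; apply: smooth_real => m; apply: CnN; apply: CnM; first exact: Cn_cst.
  exact: Cn_coord.
move=> x; rewrite normcM /r dotpZl dotp_dir.
apply: (@le_trans _ _ (normc (f x) * (2 * (h * x 0 j) ^+ 2))).
  apply: ler_wpM2l; first exact: normc_ge0.
  by have := expi_remainder2 (- (h * x 0 j)); rewrite sqrrN.
rewrite [leLHS](_ : _ = (2 * h ^+ 2) * ((x 0 j) ^+ 2 * normc (f x))); last by ring.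
rewrite [leRHS](_ : _ = (2 * h ^+ 2) * (K * rweight x)); last by ring.
apply: ler_wpM2l; first by rewrite mulr_ge0// sqr_ge0.
rewrite -[(x 0 j) ^+ 2]ger0_norm ?sqr_ge0// -normc_real -normcM.
apply: (@norm1_le_rweight _ _ (fun x => ((x 0 j) ^+ 2)%:C%C * f x)) => y.
rewrite normcM normc_real mulrA.
apply: le_trans (fK [::] isT y); apply: ler_wpM2r; first exact: normc_ge0.
rewrite -[n.*2.+2]addn2 exprD ler_wpM2l ?norm1X_ge0// normrX lerXn2r ?nnegrE//.
by apply: le_trans (norm1_coord y); exact: coord_le_norm.
Qed.


Lemma cReB (x y : C) : Re (x - y) = Re x - Re y.
Proof. by case: x y => [a b] [c d]. Qed.
Lemma cImB (x y : C) : Im (x - y) = Im x - Im y.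
Proof. by case: x y => [a b] [c d]. Qed.
Lemma cReZ (h : R) (y : C) : Re (h%:C%C * y) = h * Re y.
Proof. by rewrite cReM /= mul0r subr0. Qed.
Lemma cImZ (h : R) (y : C) : Im (h%:C%C * y) = h * Im y.
Proof. by rewrite cImM /= mul0r addr0. Qed.

Lemma is_derive_fourier f j l : cschwartz f ->
  is_derive l (dir j) (fun y => Re (fourier f y)) (Re (fourier (xmul j f) l)) /\
  is_derive l (dir j) (fun y => Im (fourier f y)) (Im (fourier (xmul j f) l)).
Proof.
move=> /(fourier_remainder j)[K HK].
split; apply: (@is_derive_quadratic _ _ _ _ _ _ K) => h; apply: le_trans (HK l h).
  by rewrite -cReZ -!cReB; exact: normc_Re.
by rewrite -cImZ -!cImB; exact: normc_Im.
Qed.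

Lemma fourier_cont f : cschwartz f -> ccontinuous (fourier f).
Proof.
move=> /fourier_lipschitz[K HK]; split.
  apply: (@lipschitz_cont _ _ (fun y => Re (fourier f y)) K) => x y.
  by apply: le_trans (HK x y); apply: le_trans (normc_Re _); rewrite cReB.
apply: (@lipschitz_cont _ _ (fun y => Im (fourier f y)) K) => x y.
by apply: le_trans (HK x y); apply: le_trans (normc_Im _); rewrite cImB.
Qed.

Lemma cpd_fourier f j : cschwartz f -> cpd j (fourier f) = fourier (xmul j f).
Proof.
move=> Sf; apply/funext => l; have [dr di] := is_derive_fourier j l Sf.
rewrite cpd.unlock (is_derive_pdE dr) (is_derive_pdE di).
exact: complexP.
Qed.

Lemma smooth_fourier f : cschwartz f -> csmooth (fourier f).
Proof.
move=> Sf; apply/csmoothE => m; elim: m f Sf => [|m IH] f Sf.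
  exact: fourier_cont.
have [cr ci] := fourier_cont Sf.
split; split.
- exact: cr.
- by move=> j x; have [[]] := is_derive_fourier j x Sf.
- move=> j; rewrite (_ : pd _ _ _ = fun y => Re (fourier (xmul j f) y)).
    by have [] := IH _ (cschwartz_xmul j Sf).
  by apply/funext => y; have [dr _] := is_derive_fourier j y Sf; exact: is_derive_pdE dr.
- exact: ci.
- by move=> j x; have [_ []] := is_derive_fourier j x Sf.
- move=> j; rewrite (_ : pd _ _ _ = fun y => Im (fourier (xmul j f) y)).
    by have [] := IH _ (cschwartz_xmul j Sf).
  by apply/funext => y; have [_ di] := is_derive_fourier j y Sf; exact: is_derive_pdE di.
Qed.

Lemma foldr_fourier f s : cschwartz f ->
  foldr cpd (fourier f) s = fourier (foldr xmul f s) /\ cschwartz (foldr xmul f s).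
Proof.
move=> Sf; elim: s => [|j s [IH1 IH2]] //=.
by rewrite IH1 cpd_fourier//; split => //; exact: cschwartz_xmul.
Qed.

Lemma fourier_coordX f j k l : cschwartz f ->
  ((l 0 j)%:C%C) ^+ k * fourier f l = fourier (iter k (dmul j) f) l /\
  cschwartz (iter k (dmul j) f).
Proof.
move=> Sf; elim: k => [|k [IH1 IH2]]; first by rewrite expr0 mul1r.
by rewrite exprS -mulrA IH1 fourier_coord//; split => //; exact: cschwartz_dmul.
Qed.

Lemma sbound_dmul m j f K : csmooth f -> sbound m.+1 f K -> sbound m (dmul j f) K.
Proof.
move=> sf fK; rewrite -[K]mul1r -normc_Nimag1.
by apply: sboundZ; [exact: smooth_cpd|exact: sbound_cpd].
Qed.

Lemma sbound_iter_dmul m k j f K : csmooth f -> sbound (m + k) f K ->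
  sbound m (iter k (dmul j) f) K /\ csmooth (iter k (dmul j) f).
Proof.
elim: k m => [|k IH] m sf fK; first by rewrite addn0 in fK.
have [H1 H2] := IH m.+1 sf (eq_rect _ (fun i => sbound i f K) fK _ (addnS m k)).
by split; [exact: sbound_dmul|exact/smoothZ/smooth_cpd].
Qed.

Lemma sbound_xmul m j f K : csmooth f -> sbound m.+1 f K ->
  sbound m (xmul j f) (2 ^+ m * K).
Proof.
move=> sf fK; rewrite -[2 ^+ m * K]mul1r -[X in X * (_ * _)]normc_Nimag1.
by apply: sboundZ; [exact/smoothM/sf/smooth_coord|exact: sbound_coord].
Qed.

Lemma sbound_foldr_xmul p m s f K : csmooth f -> (p + size s <= m)%N -> sbound m f K ->
  sbound p (foldr xmul f s) ((2 ^+ m) ^+ size s * K) /\ csmooth (foldr xmul f s).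
Proof.
elim: s p => [|j s IH] p sf /= pm fK.
  by rewrite expr0 mul1r; split => //; apply: sboundW fK; rewrite addn0 in pm.
have [|H1 H2] := IH p.+1 sf _ fK; first by rewrite addSnnS.
split; last by apply/smoothZ/smoothM => //; exact: smooth_coord.
apply: sbound_le (sbound_xmul j H2 H1).
rewrite exprS -!mulrA ler_wpM2r//.
  by rewrite mulr_ge0 ?exprn_ge0//; exact: sbound_ge0 fK.
by apply: ler_weXn2l; rewrite ?ler1n//; apply: leq_trans pm; exact: leq_addr.
Qed.

(* On [|l| > 1] the weight is comparable to a power of the largest coordinate. *)
Lemma norm1X_le (l : V) m : (1 + `|l|) ^+ m <= 2 ^+ m * (1 + \sum_(j < n) `|l 0 j| ^+ m).
Proof.
have S0 : 0 <= \sum_(j < n) `|l 0 j| ^+ m by apply: sumr_ge0 => j _; exact: exprn_ge0.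
have [l1|l1] := leP `|l| 1.
  apply: (@le_trans _ _ (2 ^+ m)).
    by rewrite lerXn2r ?nnegrE ?addr_ge0//; lra.
  by rewrite ler_peMr ?exprn_ge0// lerDl.
apply: (@le_trans _ _ ((2 * `|l|) ^+ m)).
  by rewrite lerXn2r ?nnegrE ?addr_ge0 ?mulr_ge0//; lra.
rewrite exprMn ler_wpM2l ?exprn_ge0//.
have [l0|[j ->]] := norm_attained l; first by move: l1; rewrite l0 ltr10.
rewrite (bigD1 j)//= addrCA lerDl addr_ge0//.
by apply: sumr_ge0 => i _; exact: exprn_ge0.
Qed.

(** Derivatives of the transform become monomials on [f], weights become derivatives of [f]. In [M]
    the summand [n.*2] pays for integrability, one [m] for the monomials and the other [m] for the
    derivatives. Only pure powers of single coordinates are needed as weights, by [norm1X_le]. *)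
Lemma fourier_sbound m : exists M, exists2 c : R, 0 <= c &
  forall f K, cschwartz f -> sbound M f K -> sbound m (fourier f) (c * K).
Proof.
pose M := (n.*2 + m + m)%N.
pose c1 : R := (2 ^+ M) ^+ m.
have c10 : 0 <= c1 by rewrite !exprn_ge0.
exists M; exists (2 ^+ m * (1 + n%:R) * fourier_cst * c1).
  by rewrite mulr_ge0// mulr_ge0 ?fourier_cst_ge0// mulr_ge0 ?exprn_ge0 ?addr_ge0.
move=> f K Sf fK s sm l; have K0 := sbound_ge0 fK.
have [-> Sv] := foldr_fourier s Sf; set v := foldr xmul f s in Sv *.
have [|vK sv] := @sbound_foldr_xmul (n.*2 + m) M s f K (let: conj a _ := Sf in a) _ fK.
  by rewrite leq_add2l.
have {}vK : sbound (n.*2 + m) v (c1 * K).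
  apply: sbound_le vK; rewrite ler_wpM2r//.
  by apply: ler_weXn2l => //; rewrite exprn_ege1// ler1n.
have B0 : normc (fourier v l) <= fourier_cst * (c1 * K).
  by apply: fourier_le sv _; apply: sboundW vK; exact: leq_addr.
have Bj j : `|l 0 j| ^+ m * normc (fourier v l) <= fourier_cst * (c1 * K).
  have [E Sm] := fourier_coordX j m l Sv.
  rewrite -normc_real -normcX -normcM E.
  by have [H1 H2] := sbound_iter_dmul j sv vK; apply: fourier_le.
apply: le_trans (ler_wpM2r (normc_ge0 _) (norm1X_le l m)) _.
rewrite [leRHS](_ : _ = 2 ^+ m * ((1 + n%:R) * (fourier_cst * (c1 * K)))); last by ring.
rewrite -[leLHS]mulrA ler_wpM2l ?exprn_ge0// mulrDl mulrDl mul1r mul1r.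
apply: lerD => //.
rewrite mulr_suml; apply: le_trans (ler_sum _ (fun j _ => Bj j)) _.
by rewrite sumr_const card_ord -[leLHS]mulr_natl.
Qed.

Lemma cschwartz_fourier f : cschwartz f -> cschwartz (fourier f).
Proof.
move=> Sf; split; first exact: smooth_fourier.
move=> m; have [M [c c0 H]] := fourier_sbound m; have [K fK] := Sf.2 M.
by exists (c * K); exact: H.
Qed.

End Fourier.

(** * Fourier inversion for bump functions *)

Section PoissonInversion.
Context {R : realType}.
Local Notation mu := (@lebesgue_measure R).
Implicit Types (f g h : R -> R) (x y t l e : R).

Lemma Rintegral_dominated_cvg (f_ : nat -> R -> R) f (W : R -> R) :
  (forall k, continuous (f_ k)) -> (forall y, f_ k y @[k --> \oo] --> f y) ->
  mu.-integrable setT (EFin \o W) -> (forall k y, `|f_ k y| <= W y) ->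
  \int[mu]_y f_ k y @[k --> \oo] --> \int[mu]_y f y.
Proof.
move=> cf ff iW fW.
have mf k : measurable_fun setT (f_ k) by exact: continuous_measurable_fun.
have mfl : measurable_fun setT f.
  by apply: (measurable_fun_cvg mf) => y _; exact: ff.
have ffE y : (EFin \o f_ k) y @[k --> \oo] --> (EFin \o f) y.
  by apply/fine_cvgP; split; [exact: nearW|exact: ff].
have ae1 : {ae mu, forall y, [set: R] y -> (EFin \o f_ k) y @[k --> \oo] --> (EFin \o f) y}.
  by apply: aeW => y _; exact: ffE.
have ae2 : {ae mu, forall y k, [set: R] y -> (`|(EFin \o f_ k) y| <= (EFin \o W) y)%E}.
  by apply: aeW => y k _; rewrite /= lee_fin.
have [iF _ H] := @dominated_convergence _ _ R mu setT measurableT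
  (fun k => EFin \o f_ k) (EFin \o f) (EFin \o W)
  (fun k => (measurable_EFinP _ _).2 (mf k)) ((measurable_EFinP _ _).2 mfl)
  ae1 iW ae2.
rewrite /Rintegral; apply: fine_cvg.
rewrite fineK; first exact: H.
exact: (integrable_fin_num measurableT iF).
Qed.

Lemma integrable_cauchyw2 : (mu \x mu)%E.-integrable setT
  (fun p : R * R => (cauchyw p.1 * cauchyw p.2)%:E).
Proof.
have mw : measurable_fun setT (fun p : R * R => cauchyw p.1 * cauchyw p.2).
  apply: measurable_funM; apply: (@measurableT_comp _ _ _ _ _ _ cauchyw) => //;
  by apply: continuous_measurable_fun; exact: continuous_cauchyw.
apply/integrable12ltyP; first exact/measurable_EFinP.
have fin : (\int[mu]_x (cauchyw x)%:E)%E \is a fin_num.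
  exact: (integrable_fin_num measurableT integrable_cauchyw).
under eq_integral => x _.
  under eq_integral => y _.
    rewrite /= ger0_norm ?mulr_ge0 ?cauchyw_ge0// EFinM.
    over.
  rewrite integralZl//; last exact: integrable_cauchyw.
  rewrite -[X in (_ * X)%E](fineK fin).
  over.
rewrite integralZr//; last exact: integrable_cauchyw.
by rewrite -[X in (X * _)%E](fineK fin) -EFinM ltry.
Qed.

Lemma Rintegral_Fubini (F : R * R -> R) K : measurable_fun setT F ->
  (forall x y, `|F (x, y)| <= K * (cauchyw x * cauchyw y)) ->
  \int[mu]_x \int[mu]_y F (x, y) = \int[mu]_y \int[mu]_x F (x, y).
Proof.
move=> mF FK.
have iF : (mu \x mu)%E.-integrable setT (EFin \o F).
  apply: (@dominated_integrable _ _ R (mu \x mu)%E setT F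
    (fun p => cauchyw p.1 * cauchyw p.2) K) => //; first exact: integrable_cauchyw2.
  by move=> [x y] _; exact: FK.
have := @Fubini _ _ _ _ R mu mu (EFin \o F) iF; rewrite /Rintegral => E.
have in1 x : mu.-integrable setT (EFin \o (fun y => F (x, y))).
  apply: (@dominated_integrable _ _ R mu setT _ cauchyw (K * cauchyw x)) => //.
  - exact: integrable_cauchyw.
  - by apply: measurableT_comp => //; exact: pair1_measurable.
  - by move=> y _; rewrite -mulrA.
have in2 y : mu.-integrable setT (EFin \o (fun x => F (x, y))).
  apply: (@dominated_integrable _ _ R mu setT _ cauchyw (K * cauchyw y)) => //.
  - exact: integrable_cauchyw.
  - by apply: measurableT_comp => //; exact: pair2_measurable.
  - by move=> x _; rewrite -mulrA [cauchyw y * _]mulrC.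
congr fine.
transitivity (\int[mu]_x \int[mu]_y (EFin \o F) (x, y))%E.
  apply: eq_integral => x _; rewrite fineK//.
  exact: (integrable_fin_num measurableT (in1 x)).
rewrite E; apply: eq_integral => y _; rewrite fineK//.
exact: (integrable_fin_num measurableT (in2 y)).
Qed.

(** Abel's summation factor: it makes the double integral of the inversion formula absolutely
    convergent, and its cosine transform is the Poisson kernel. *)
Definition decay e l : R := expR (- (e * `|l|)).

Lemma continuous_decay e : continuous (decay e).
Proof.
move=> l; apply: (@continuous_comp _ _ _ (fun l => - (e * `|l|)) expR).
  apply: cvgN; apply: cvgM; [exact: cvg_cst|exact: norm_continuous].
exact: continuous_expR.
Qed.

Lemma decay_ge0 e l : 0 <= decay e l. Proof. exact: expR_ge0. Qed.

Lemma decay_le1 e l : 0 <= e -> decay e l <= 1.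
Proof. by move=> e0; rewrite expR_le1 oppr_le0 mulr_ge0. Qed.

(** From 1 + y^2 / 2 <= exp(y) at y = e l, where [e <= 1] absorbs the constant term. *)
Lemma expRN_cauchyw e l : 0 < e <= 1 -> 0 <= l -> expR (- (e * l)) <= 2 / e ^+ 2 * cauchyw l.
Proof.
move=> /andP[e0 e1] l0; have el0 : 0 <= e * l by rewrite mulr_ge0// ltW.
rewrite expRN /cauchyw -[leLHS]mul1r ler_pdivrMr ?expR_gt0//.
have H := expR_ge1Dxn 1 el0.
have E : (1 + l ^+ 2) * e ^+ 2 <= 2 * expR (e * l).
  apply: le_trans (_ : 2 * (1 + (e * l) ^+ 2 / 2) <= _); last by rewrite ler_wpM2l.
  have e2 : e ^+ 2 <= 1 by rewrite expr_le1// ltW.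
  by rewrite exprMn; lra.
have l1 : 0 < 1 + l ^+ 2 by rewrite ltr_pwDl// sqr_ge0.
rewrite [leRHS](_ : _ = 2 * expR (e * l) / ((1 + l ^+ 2) * e ^+ 2)).
  by rewrite ler_pdivlMr ?mul1r// mulr_gt0// exprn_gt0.
by field; rewrite !lt0r_neq0// exprn_gt0.
Qed.

Lemma decay_cauchyw e l : 0 < e <= 1 -> decay e l <= 2 / e ^+ 2 * cauchyw l.
Proof.
move=> e01; have := expRN_cauchyw e01 (normr_ge0 l).
by rewrite /cauchyw real_normK ?num_real.
Qed.

Lemma is_derive_expRM (a l : R) : is_derive l (1 : R) (fun l => expR (a * l)) (a * expR (a * l)).
Proof.
have D : is_derive l (1 : R) (fun l => a * l) a.
  by have := is_deriveZ a (is_derive_id l (1 : R)); rewrite /GRing.scale/= mulr1.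
by have := is_derive1_comp (is_derive_expR (a * l)) D; rewrite mulrC.
Qed.

Lemma is_derive_linear (a l : R) : is_derive l (1 : R) (fun l => a * l) a.
Proof. by have := is_deriveZ a (is_derive_id l (1 : R)); rewrite /GRing.scale/= mulr1. Qed.

Lemma continuous_mulr (a : R) : continuous (fun l => a * l).
Proof. by move=> l; apply: cvgM; [exact: cvg_cst|exact: cvg_id]. Qed.

Lemma continuous_mull (a : R) : continuous (fun l => l * a).
Proof. by move=> l; apply: cvgM; [exact: cvg_id|exact: cvg_cst]. Qed.

Lemma continuous_cosM (a : R) : continuous (fun l => cos (l * a)).
Proof.
move=> l; apply: (@continuous_comp _ _ _ (fun l => l * a) cos); last exact: continuous_cos.
exact: continuous_mull.
Qed.

Lemma continuous_sinM (a : R) : continuous (fun l => sin (l * a)).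
Proof.
move=> l; apply: (@continuous_comp _ _ _ (fun l => l * a) sin); last exact: continuous_sin.
exact: continuous_mull.
Qed.

Lemma poisson_cos e t : 0 < e <= 1 ->
  \int[mu]_l (decay e l * cos (l * t)) = 2 * e / (e ^+ 2 + t ^+ 2).
Proof.
move=> e01; have /andP[e0 e1] := e01.
have den : 0 < e ^+ 2 + t ^+ 2 by rewrite ltr_wpDr ?sqr_ge0// exprn_gt0.
have c1 : continuous (fun l => decay e l * cos (l * t)).
  by move=> l; apply: cvgM; [exact: continuous_decay|exact: continuous_cosM].
rewrite (Rintegral_fold c1 (K := 2 / e ^+ 2)); last first.
  move=> l; rewrite normrM ger0_norm ?decay_ge0//.
  apply: le_trans (decay_cauchyw l e01); rewrite ler_piMr ?decay_ge0//; exact: cos_max.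
(* Twice the real part of exp((-e + i t) l) / (-e + i t), an antiderivative that tends to 0 at
   infinity. *)
pose H l : R := 2 * (expR (- e * l) * (t * sin (t * l) - e * cos (t * l)) / (e ^+ 2 + t ^+ 2)).
pose h l : R := 2 * (expR (- e * l) * cos (t * l)).
rewrite (@eq_Rintegral _ _ _ mu _ h); last first.
  move=> l; rewrite inE /= in_itv /= andbT => l0.
  rewrite /h /decay normrN ger0_norm// !mulNr cosN [t * l]mulrC.
  by move: (expR _) (cos _) => E c; ring.
have ch : continuous h.
  move=> l; apply: cvgM; first exact: cvg_cst.
  apply: cvgM.
    apply: (@continuous_comp _ _ _ (fun l => - e * l) expR); last exact: continuous_expR.
    exact: continuous_mulr.
  apply: (@continuous_comp _ _ _ (fun l => t * l) cos); last exact: continuous_cos.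
  exact: continuous_mulr.
have dH l : is_derive l (1 : R) H (h l).
  have dE := is_derive_expRM (- e) l.
  have dS : is_derive l (1 : R) (fun l => sin (t * l)) (t * cos (t * l)).
    by have := is_derive1_comp (is_derive_sin (t * l)) (is_derive_linear t l); rewrite mulrC.
  have dC : is_derive l (1 : R) (fun l => cos (t * l)) (- (t * sin (t * l))).
    have := is_derive1_comp (is_derive_cos (t * l)) (is_derive_linear t l).
    by rewrite mulNr mulrC.
  have dT := is_deriveB (is_deriveZ t dS) (is_deriveZ e dC).
  have := is_deriveZ (2 / (e ^+ 2 + t ^+ 2)) (is_deriveM dE dT).
  rewrite (_ : _ \*: _ = H); last first.
    apply/funext => u.
    change (2 / (e ^+ 2 + t ^+ 2) *
      (expR (- e * u) * (t * sin (t * u) - e * cos (t * u))) = H u).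
    by rewrite /H; ring.
  move=> /is_derive_eq; apply; rewrite /h.
  change (2 / (e ^+ 2 + t ^+ 2) *
    (expR (- e * l) * (t * (t * cos (t * l)) - e * - (t * sin (t * l))) +
     (t * sin (t * l) - e * cos (t * l)) * (- e * expR (- e * l))) =
    2 * (expR (- e * l) * cos (t * l))).
  field.
  exact: lt0r_neq0.
have hK l : 0 <= l -> `|h l| <= 4 / e ^+ 2 * cauchyw l.
  move=> l0; rewrite /h normrM ger0_norm// normrM ger0_norm ?expR_ge0//.
  apply: (@le_trans _ _ (2 * expR (- e * l))).
    by rewrite ler_wpM2l// ler_piMr ?expR_ge0//; exact: cos_max.
  rewrite (_ : 4 = 2 * 2 :> R); last by rewrite -natrM.
  by rewrite -!mulrA ler_wpM2l// mulrA mulNr; exact: expRN_cauchyw.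
have Hl : H l @[l --> +oo] --> (0 : R).
  apply/cvgr0Pnorm_le => d d0.
  pose M : R := 2 * (`|t| + e) / (e ^+ 2 + t ^+ 2).
  have M0 : 0 <= M by rewrite divr_ge0 ?(ltW den)// mulr_ge0// addr_ge0// ltW.
  have HM l : 0 <= l -> `|H l| <= M * (2 / e ^+ 2) * cauchyw l.
    move=> l0; rewrite /H normrM (ger0_norm (ler0n _ 2)) normrM normrM.
    rewrite (ger0_norm (expR_ge0 _)) [`|_^-1|]ger0_norm ?invr_ge0 ?(ltW den)//.
    have E1 : expR (- e * l) <= 2 / e ^+ 2 * cauchyw l by rewrite mulNr; exact: expRN_cauchyw.
    have E2 : `|t * sin (t * l) - e * cos (t * l)| <= `|t| + e.
      apply: le_trans (ler_normB _ _) _; rewrite !normrM (ger0_norm (ltW e0)).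
      by rewrite lerD// ler_piMr// ?(ltW e0)//; [exact: sin_max|exact: cos_max].
    rewrite /M [leRHS](_ : _ = 2 * ((2 / e ^+ 2 * cauchyw l) * (`|t| + e) /
      (e ^+ 2 + t ^+ 2))); last first.
      by field; rewrite !lt0r_neq0// exprn_gt0.
    rewrite ler_wpM2l// ler_wpM2r ?invr_ge0 ?(ltW den)//.
    by rewrite ler_pM ?expR_ge0.
  have bM l : `|M * (2 / e ^+ 2) * cauchyw l| <= M * (2 / e ^+ 2) * cauchyw l.
    rewrite normrM (ger0_norm (cauchyw_ge0 l)) ger0_norm//.
    by rewrite mulr_ge0// divr_ge0// exprn_ge0// ltW.
  have /cvgr0Pnorm_le/(_ d d0) Hc := cauchyw_cvg0 bM.
  near=> l; have l0 : 0 <= l by near: l; exact: nbhs_pinfty_ge.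
  apply: le_trans (HM l l0) _; apply: le_trans (ler_norm _) _.
  by near: l; exact: Hc.
rewrite (halfline_FTC ch dH hK Hl).
rewrite /H !mulr0 expR0 sin0 cos0 mulr0 sub0r mul1r; field.
exact: lt0r_neq0.
Unshelve. all: by end_near. Qed.

Lemma poisson_sin e t : 0 < e <= 1 -> \int[mu]_l (decay e l * sin (l * t)) = 0.
Proof.
move=> e01; have /andP[e0 e1] := e01.
have c1 : continuous (fun l => decay e l * sin (l * t)).
  by move=> l; apply: cvgM; [exact: continuous_decay|exact: continuous_sinM].
rewrite (Rintegral_fold c1 (K := 2 / e ^+ 2)); last first.
  move=> l; rewrite normrM ger0_norm ?decay_ge0//.
  apply: le_trans (decay_cauchyw l e01); rewrite ler_piMr ?decay_ge0//; exact: sin_max.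
rewrite (@eq_Rintegral _ _ _ mu _ (fun=> 0)); first by rewrite Rintegral_cst// mul0r.
by move=> l _; rewrite /decay normrN mulNr sinN mulrN subrr.
Qed.

(** Peetre's inequality: 1 + y^2 <= 2 (1 + x^2) (1 + (y - x)^2). *)
Lemma cauchyw_shift x y : cauchyw (y - x) <= 2 * (1 + x ^+ 2) * cauchyw y.
Proof.
rewrite /cauchyw -[leLHS]mul1r ler_pdivrMr ?ltr_pwDl ?sqr_ge0//.
rewrite [leRHS](_ : _ = 2 * (1 + x ^+ 2) * (1 + (y - x) ^+ 2) / (1 + y ^+ 2)); last by ring.
rewrite ler_pdivlMr ?ltr_pwDl ?sqr_ge0// mul1r.
(* The right side minus the left side equals 1 + (y - 2x)^2 + 2 (x (y - x))^2. *)
have h0 : 0 <= (y - 2 * x) ^+ 2 by exact: sqr_ge0.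
have h1 : 0 <= (x * (y - x)) ^+ 2 by exact: sqr_ge0.
nra.
Qed.

Definition poisson e t : R := 2 * e / (e ^+ 2 + t ^+ 2).

Lemma poisson_den_gt0 e t : 0 < e -> 0 < e ^+ 2 + t ^+ 2.
Proof. by move=> e0; rewrite ltr_wpDr ?sqr_ge0// exprn_gt0. Qed.

Lemma poisson_ge0 e t : 0 < e -> 0 <= poisson e t.
Proof.
by move=> e0; rewrite divr_ge0 ?(ltW (poisson_den_gt0 _ e0))// mulr_ge0// ltW.
Qed.

Lemma poisson_cauchyw e t : 0 < e <= 1 -> poisson e t <= 2 / e * cauchyw t.
Proof.
move=> /andP[e0 e1]; rewrite /poisson /cauchyw ler_pdivrMr ?poisson_den_gt0//.
rewrite [leRHS](_ : _ = (2 / e * (e ^+ 2 + t ^+ 2)) / (1 + t ^+ 2)); last by ring.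
rewrite ler_pdivlMr ?ltr_pwDl ?sqr_ge0//.
rewrite [leRHS](_ : _ = 2 * e + 2 / e * t ^+ 2); last by field; exact: lt0r_neq0.
rewrite mulrDr mulr1 lerD2l ler_wpM2r ?sqr_ge0// ler_wpM2l//.
by rewrite (le_trans e1)// invf_ge1.
Qed.

Lemma continuous_poisson x e : 0 < e -> continuous (fun y => poisson e (y - x)).
Proof.
move=> e0 y; apply: cvgM; first exact: cvg_cst.
apply: cvgV; first exact/lt0r_neq0/poisson_den_gt0.
apply: cvgD; first exact: cvg_cst.
apply: (@continuous_comp _ _ _ (fun y => y - x) (fun t => t ^+ 2)); last exact: exprn_continuous.
by apply: cvgB; [exact: cvg_id|exact: cvg_cst].
Qed.

Lemma poisson_dom e x y : 0 < e <= 1 ->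
  `|poisson e (y - x)| <= 2 / e * (2 * (1 + x ^+ 2)) * cauchyw y.
Proof.
move=> e01; have /andP[e0 _] := e01.
rewrite ger0_norm ?poisson_ge0//; apply: le_trans (poisson_cauchyw _ e01) _.
by rewrite -[leRHS]mulrA ler_wpM2l ?divr_ge0 ?(ltW e0)//; exact: cauchyw_shift.
Qed.

Lemma Rintegral_poisson e x : 0 < e <= 1 -> \int[mu]_y poisson e (y - x) = 2 * pi.
Proof.
move=> e01; have /andP[e0 e1] := e01.
have dL y : is_derive y (1 : R) (fun y => e^-1 * (y - x)) e^-1.
  have := is_deriveZ e^-1 (is_deriveB (is_derive_id y (1 : R)) (is_derive_cst x y (1 : R))).
  by rewrite subr0 /GRing.scale/= mulr1.
pose H y := 2 * atan (e^-1 * (y - x)).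
have dH y : is_derive y (1 : R) H (poisson e (y - x)).
  have := is_deriveZ 2 (@is_derive1_comp _ atan (fun y => e^-1 * (y - x)) y _ _
    (is_derive1_atan (e^-1 * (y - x))) (dL y)).
  move=> /is_derive_eq; apply; rewrite /poisson /GRing.scale/=; field.
  by rewrite !lt0r_neq0// ?poisson_den_gt0.
have H1 : H y @[y --> +oo] --> (pi : R).
  rewrite (_ : pi = 2 * (pi / 2)); last by field.
  apply: cvgM; first exact: cvg_cst.
  apply: (cvg_comp _ _ _ (@cvgy_atan R)).
  apply/cvgryPge => A; near=> y.
  rewrite ler_pdivlMl// lerBrDr; near: y.
  by apply: nbhs_pinfty_ge; exact: num_real.
have H2 : H y @[y --> -oo] --> (- pi : R).
  rewrite (_ : - pi = 2 * (- (pi / 2))); last by field.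
  apply: cvgM; first exact: cvg_cst.
  apply: (cvg_comp _ _ _ (_ : (@atan R) z @[z --> -oo] --> - (pi / 2))).
    apply/cvgrNyPle => A; near=> y.
    rewrite ler_pdivrMl// lerBlDr; near: y.
    by apply: nbhs_ninfty_le; exact: num_real.
  apply/cvgNy_compNP; rewrite (_ : _ \o _ = fun z => - atan z).
    by apply: cvgN; exact: cvgy_atan.
  by apply/funext => z /=; rewrite atanN.
rewrite (line_FTC (continuous_poisson e0) dH (fun y => poisson_dom x y e01) H1 H2).
by ring.
Unshelve. all: by end_near. Qed.

(* The kernel concentrates at [x], so only the Lipschitz bound near [x] and the
   sup bound elsewhere matter. *)
Lemma poisson_approx g x (M L : R) : continuous g -> (forall y, `|g y| <= M) ->
  (forall y, `|g y - g x| <= L * `|y - x|) ->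
  \int[mu]_y (g y * poisson (k.+1%:R^-1) (y - x)) @[k --> \oo] --> 2 * pi * g x.
Proof.
move=> cg gM gL.
have ek (k : nat) : 0 < (k.+1%:R^-1 : R) <= 1.
  by apply/andP; split; [rewrite invr_gt0 ltr0n|rewrite invf_le1 ?ltr0n ?ler1n].
have M0 : 0 <= M by apply: le_trans (gM 0).
have L0 : 0 <= L.
  by have := le_trans (normr_ge0 _) (gL (x + 1)); rewrite addrC addKr normr1 mulr1.
pose f_ k y := (g y - g x) * poisson (k.+1%:R^-1) (y - x).
have cf k : continuous (f_ k).
  move=> y; apply: cvgM; last by apply: continuous_poisson; case/andP: (ek k).
  by apply: cvgB; [exact: cg|exact: cvg_cst].
(* A majorant independent of [k]. For |t| <= 1 the Lipschitz bound combines with 2 e |t| <= e^2 +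
   t^2. For |t| > 1 the difference of values is at most 2 M, and e <= 1 with 1 + t^2 <= 2 t^2 gives
   the 8. *)
have fW k y : `|f_ k y| <= (2 * L + 8 * M) * cauchyw (y - x).
  have /andP[e0 e1] := ek k; set e := k.+1%:R^-1 in e0 e1 *.
  rewrite normrM (ger0_norm (poisson_ge0 _ e0)); set t := y - x.
  have den := poisson_den_gt0 t e0.
  rewrite /cauchyw ler_pdivlMr ?ltr_pwDl ?sqr_ge0//.
  have gy : `|g y - g x| <= 2 * M.
    by apply: le_trans (ler_normB _ _) _; rewrite mulr_natl mulr2n lerD.
  rewrite /poisson mulrA -[leLHS]mulrA [_^-1 * _]mulrC mulrA ler_pdivrMr//.
  have t2 : t ^+ 2 = `|t| ^+ 2 by rewrite real_normK ?num_real.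
  have gyt := gL y; rewrite -/t in gyt.
  rewrite t2; move: (normr_ge0 t) (normr_ge0 (g y - g x)) gyt gy.
  move: `|t| `|g y - g x| => a b a0 b0 ba bM.
  have [a1|a1] := leP a 1.
    have H1 : b * (2 * e) <= L * (e ^+ 2 + a ^+ 2).
      apply: (@le_trans _ _ (L * a * (2 * e))); first by rewrite ler_wpM2r// mulr_ge0// ltW.
      rewrite -mulrA ler_wpM2l// -subr_ge0.
      rewrite (_ : _ - _ = (e - a) ^+ 2) ?sqr_ge0//; ring.
    apply: (@le_trans _ _ (L * (e ^+ 2 + a ^+ 2) * 2)).
      apply: ler_pM => //; first by rewrite mulr_ge0// mulr_ge0// ltW.
        by rewrite addr_ge0 ?exprn_ge0.
      have : a ^+ 2 <= 1 by rewrite expr_le1.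
      lra.
    rewrite mulrAC [L * 2]mulrC ler_wpM2r ?addr_ge0 ?exprn_ge0 ?(ltW e0)//.
    by rewrite lerDl mulr_ge0.
  apply: (@le_trans _ _ (8 * M * a ^+ 2)); last first.
    apply: ler_pM; rewrite ?mulr_ge0 ?exprn_ge0//.
      by rewrite lerDr mulr_ge0.
    by rewrite lerDr exprn_ge0// ltW.
  apply: (@le_trans _ _ (2 * M * (2 * 1) * (2 * a ^+ 2))).
    apply: ler_pM; rewrite ?addr_ge0 ?mulr_ge0 ?exprn_ge0 ?(ltW e0)//.
      by apply: ler_pM; rewrite ?mulr_ge0 ?(ltW e0)// ler_wpM2l.
    have : 1 <= a ^+ 2 by rewrite exprn_ege1// ltW.
    lra.
  rewrite le_eqVlt; apply/orP; left; apply/eqP; ring.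
have iW : mu.-integrable setT (EFin \o (fun y => (2 * L + 8 * M) * cauchyw (y - x))).
  apply: (integrable_cauchyw_dom (K := (2 * L + 8 * M) * (2 * (1 + x ^+ 2)))) => //.
    move=> y; apply: cvgM; first exact: cvg_cst.
    apply: (@continuous_comp _ _ _ (fun y => y - x) cauchyw); last exact: continuous_cauchyw.
    by apply: cvgB; [exact: cvg_id|exact: cvg_cst].
  move=> y _; rewrite ger0_norm ?mulr_ge0 ?addr_ge0 ?mulr_ge0 ?cauchyw_ge0//.
  by rewrite -[leRHS]mulrA ler_wpM2l ?addr_ge0 ?mulr_ge0//; exact: cauchyw_shift.
have ff y : f_ k y @[k --> \oo] --> (0 : R).
  rewrite /f_; have [->|yx] := eqVneq y x.
    by under eq_fun do rewrite subrr mul0r; exact: cvg_cst.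
  have t0 : 0 < (y - x) ^+ 2 by rewrite exprn_even_gt0//= subr_eq0.
  rewrite -[X in _ --> X](mulr0 (g y - g x)); apply: cvgM; first exact: cvg_cst.
  apply: (@squeeze_cvgr _ _ _ _ (fun=> 0) (fun k => 2 / (y - x) ^+ 2 * (k.+1%:R^-1))).
  - apply: nearW => k; have /andP[e0 _] := ek k; rewrite poisson_ge0//=.
    rewrite /poisson mulrAC ler_wpM2r ?(ltW e0)// ler_wpM2l// lef_pV2 ?posrE ?poisson_den_gt0//.
    by rewrite lerDr exprn_ge0// ltW.
  - exact: cvg_cst.
  - rewrite -[X in _ --> X](mulr0 (2 / (y - x) ^+ 2)); apply: cvgM; first exact: cvg_cst.
    exact: cvg_harmonic.
have := Rintegral_dominated_cvg cf ff iW fW.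
rewrite Rintegral_cst// mul0r => H.
rewrite (_ : (fun k => _) = fun k => \int[mu]_y f_ k y + 2 * pi * g x).
  rewrite -[X in _ --> X]add0r; apply: cvgD; [exact: H|exact: cvg_cst].
apply/funext => k; have /andP[e0 e1] := ek k.
rewrite -(Rintegral_poisson x (ek k)) [_ * g x]mulrC.
have ip : mu.-integrable setT (EFin \o (fun y => poisson (k.+1%:R^-1) (y - x))).
  apply: (integrable_cauchyw_dom (K := 2 / (k.+1%:R^-1) * (2 * (1 + x ^+ 2)))) => //.
    exact: continuous_poisson.
  by move=> y _; exact: poisson_dom.
rewrite -RintegralZl// -RintegralD//.
- by apply: eq_Rintegral => y _; rewrite /f_; ring.
- by apply: (@dominated_integrable _ _ R mu setT (f_ k)
      (fun y => (2 * L + 8 * M) * cauchyw (y - x)) 1) => //;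
    [exact: continuous_measurable_fun|move=> y _; rewrite mul1r].
- exact: (integrableZl measurableT (g x) ip).
Qed.

End PoissonInversion.

(** * Inversion of the cosine and sine transforms in one variable *)

Section TrigonometricInversion.
Context {R : realType}.
Local Notation mu := (@lebesgue_measure R).
Implicit Types (f g h : R -> R) (x y t l e : R) (b : bool).

(** Differentiation exchanges cosine and sine up to a sign, so a boolean index lets each argument be
    made once for both. *)
Definition trig b : R -> R := if b then cos else sin.

Lemma trig_le1 b t : `|trig b t| <= 1.
Proof. by case: b; [exact: cos_max|exact: sin_max]. Qed.

Lemma continuous_trig b : continuous (trig b).
Proof. by case: b; [exact: continuous_cos|exact: continuous_sin]. Qed.

Lemma is_derive_trig b t :
  is_derive t (1 : R) (trig b) ((if b then -1 else 1) * trig (~~ b) t).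
Proof.
by case: b; rewrite ?mulN1r ?mul1r; [exact: is_derive_cos|exact: is_derive_sin].
Qed.

Lemma trig_lip b t u : `|trig b t - trig b u| <= `|t - u|.
Proof.
have D s : is_derive s (1 : R) (fun s => trig b (s + u)) ((if b then -1 else 1) * trig (~~ b) (s + u)).
  have D1 : is_derive s (1 : R) (fun s => s + u) 1.
    by have := is_deriveD (is_derive_id s (1 : R)) (is_derive_cst u s (1 : R)); rewrite addr0.
  have := @is_derive1_comp _ (trig b) (fun s => s + u) s _ _ (is_derive_trig b (s + u)) D1.
  by rewrite mulr1.
have := @mean_value_le _ _ _ 1 (t - u) D; rewrite subrK add0r mul1r; apply => s _.
by rewrite normrM; case: (b); rewrite ?normrN normr1 mul1r trig_le1.
Qed.

(** The phase [l * (y - x)] already contains the point of evaluation, so that inversion at [x]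
    amounts to integrating over [l]: the cosine part yields the value of [g] and the sine part
    yields 0. *)
Definition trans b g x l : R := \int[mu]_y (g y * trig b (l * (y - x))).

Lemma continuous_shiftM x l : continuous (fun y => l * (y - x)).
Proof.
move=> y; apply: cvgM; first exact: cvg_cst.
by apply: cvgB; [exact: cvg_id|exact: cvg_cst].
Qed.

Lemma continuous_trigM b x l : continuous (fun y => trig b (l * (y - x))).
Proof.
move=> y; apply: (@continuous_comp _ _ _ (fun y => l * (y - x)) (trig b)).
  exact: continuous_shiftM.
exact: continuous_trig.
Qed.

Lemma continuous_mul (u v : R -> R) : continuous u -> continuous v ->
  continuous (fun y => u y * v y).
Proof. by move=> cu cv y; apply: cvgM; [exact: cu|exact: cv]. Qed.

Definition cdom1 g K := continuous g /\ forall y, `|g y| <= K * cauchyw y.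

Lemma cdom1M g K v : cdom1 g K -> continuous v -> (forall y, `|v y| <= 1) ->
  cdom1 (fun y => g y * v y) K.
Proof.
move=> [cg gK] cv v1; split; first exact: continuous_mul.
by move=> y; apply: le_trans (gK y); rewrite normrM ler_piMr.
Qed.

Lemma cdom1_integrable g K : cdom1 g K -> mu.-integrable setT (EFin \o g).
Proof. by move=> [cg gK]; apply: (integrable_cauchyw_dom (K := K)) => // y _. Qed.

Definition cauchy_mass : R := \int[mu]_y cauchyw y.

Lemma cdom1_le g K : cdom1 g K -> `|\int[mu]_y g y| <= K * cauchy_mass.
Proof.
move=> dg; have ig := cdom1_integrable dg; have [cg gK] := dg.
apply: le_trans (le_normr_Rintegral measurableT ig) _.
rewrite /cauchy_mass -(RintegralZl K measurableT integrable_cauchyw).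
apply: (le_Rintegral measurableT) => //; first exact: integrable_norm.
exact: (integrableZl measurableT K integrable_cauchyw).
Qed.

Lemma cdom1_trig b g x l K : cdom1 g K -> cdom1 (fun y => g y * trig b (l * (y - x))) K.
Proof. by move=> dg; apply: cdom1M => //; [exact: continuous_trigM|move=> y; exact: trig_le1]. Qed.

Lemma trans_le b g x l K : cdom1 g K -> `|trans b g x l| <= K * cauchy_mass.
Proof. by move=> dg; apply: cdom1_le; exact: cdom1_trig. Qed.

(** Integration by parts: the derivative of [g] times the other trigonometric function has integral
    0, and the chain rule produces the factor [l]. *)
Lemma trans_derive b g g1 x l K : (forall y, is_derive y (1 : R) g (g1 y)) ->
  cdom1 g K -> cdom1 g1 K ->
  l * trans b g x l = (if b then -1 else 1) * trans (~~ b) g1 x l.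
Proof.
move=> dg Dg Dg1.
have dgt y : is_derive y (1 : R) (fun y => g y * trig (~~ b) (l * (y - x)))
    (g1 y * trig (~~ b) (l * (y - x)) +
     (if b then 1 else -1) * (l * (g y * trig b (l * (y - x))))).
  have D1 : is_derive y (1 : R) (fun y => l * (y - x)) l.
    have := is_deriveZ l (is_deriveB (is_derive_id y (1 : R)) (is_derive_cst x y (1 : R))).
    by rewrite subr0 /GRing.scale/= mulr1.
  have D2 := @is_derive1_comp _ (trig (~~ b)) (fun y => l * (y - x)) y _ _
    (is_derive_trig (~~ b) (l * (y - x))) D1.
  have D3 := is_deriveM (dg y) D2.
  apply: is_derive_eq D3 _; rewrite negbK.
  change (g y * ((if ~~ b then -1 else 1) * trig b (l * (y - x)) * l) +
    trig (~~ b) (l * (y - x)) * g1 y = g1 y * trig (~~ b) (l * (y - x)) +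
    (if b then 1 else -1) * (l * (g y * trig b (l * (y - x))))).
  by case: (b) => /=; ring.
have i1 := cdom1_integrable (cdom1_trig (~~ b) x l Dg1).
have i2 := cdom1_integrable (cdom1_trig b x l Dg).
have i3 : mu.-integrable setT (EFin \o (fun y => l * (g y * trig b (l * (y - x))))).
  exact: (integrableZl measurableT l i2).
have i4 : mu.-integrable setT
    (EFin \o (fun y => (if b then 1 else -1) * (l * (g y * trig b (l * (y - x)))))).
  exact: (integrableZl measurableT _ i3).
have K0 : 0 <= K.
  by have := le_trans (normr_ge0 _) (Dg.2 0); rewrite pmulr_lge0// cauchyw_gt0.
have [c1 _] := cdom1_trig (~~ b) x l Dg1; have [c2 _] := cdom1_trig b x l Dg.
have /(_ (K * (1 + `|l|))) := @Rintegral_derive1D _ _ _ _ _ dgt.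
rewrite (RintegralD measurableT i1 i4) (RintegralZl _ measurableT i3).
rewrite (RintegralZl _ measurableT i2) -!/(trans _ _ _ _) => H.
have {}H := H _ _ _.
have : trans (~~ b) g1 x l + (if b then 1 else -1) * (l * trans b g x l) = 0.
  apply: H.
  - move=> y; apply: cvgD; first exact: c1.
    apply: cvgM; first exact: cvg_cst.
    by apply: cvgM; [exact: cvg_cst|exact: c2].
  - move=> y; apply: le_trans (ler_normD _ _) _.
    rewrite [leRHS](_ : _ = K * cauchyw y + `|l| * (K * cauchyw y)); last by ring.
    apply: lerD.
      exact: (cdom1_trig (~~ b) x l Dg1).2.
    rewrite normrM [X in X * _](_ : _ = 1); last by case: (b); rewrite ?normrN normr1.
    rewrite mul1r normrM ler_wpM2l//.
    exact: (cdom1_trig b x l Dg).2.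
  - move=> y; apply: le_trans ((cdom1_trig (~~ b) x l Dg).2 y) _.
    by rewrite ler_wpM2r ?cauchyw_ge0// ler_peMr// lerDl.
case: (b) => /=; rewrite ?mulN1r ?mul1r.
  by rewrite addrC => /eqP; rewrite addr_eq0 => /eqP.
by move=> /eqP; rewrite subr_eq0 => /eqP.
Qed.

(** Two integrations by parts bound l^2 times the transform by the same constant as the transform
    itself; adding the two bounds gives the factor 2. *)
Lemma trans_decay b g g1 g2 x K : (forall y, is_derive y (1 : R) g (g1 y)) ->
  (forall y, is_derive y (1 : R) g1 (g2 y)) ->
  cdom1 g K -> cdom1 g1 K -> cdom1 g2 K ->
  forall l, `|trans b g x l| <= 2 * K * cauchy_mass * cauchyw l.
Proof.
move=> dg dg1 Dg Dg1 Dg2 l; rewrite /cauchyw ler_pdivlMr ?ltr_pwDl ?sqr_ge0//.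
rewrite mulrDr mulr1 -mulrA mulr_natl mulr2n lerD ?trans_le//.
rewrite -[l ^+ 2]ger0_norm ?sqr_ge0// -normrM mulrC expr2 -mulrA.
rewrite (trans_derive b x l dg Dg Dg1) mulrCA (trans_derive (~~ b) x l dg1 Dg1 Dg2).
rewrite negbK -[leRHS]/(K * cauchy_mass).
by case: (b) => /=; rewrite ?mulN1r ?mul1r ?mulN1r ?normrN trans_le.
Qed.

(** Lipschitz in [l]: the phase changes by (l - l') (y - x), and the factor |y| is paid for by the
    bound on [y * g y]. *)
Lemma continuous_trans b g x K : cdom1 g K -> (forall y, `|y * g y| <= K * cauchyw y) ->
  continuous (trans b g x).
Proof.
move=> dg ygK.
have K0 : 0 <= K.
  by have := le_trans (normr_ge0 _) (dg.2 0); rewrite pmulr_lge0// cauchyw_gt0.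
apply: (@lipschitz_cont R R (trans b g x) (K * (1 + `|x|) * cauchy_mass)) => l l'.
have i1 := cdom1_integrable (cdom1_trig b x l dg).
have i2 := cdom1_integrable (cdom1_trig b x l' dg).
rewrite /trans -(RintegralB measurableT i1 i2).
rewrite mulrC mulrA; apply: cdom1_le; split.
  move=> y; apply: cvgB; first exact: (cdom1_trig b x l dg).1.
  exact: (cdom1_trig b x l' dg).1.
move=> y; rewrite -mulrBr normrM.
apply: (@le_trans _ _ (`|g y| * (`|l - l'| * `|y - x|))).
  rewrite ler_wpM2l//; apply: le_trans (trig_lip _ _ _) _.
  by rewrite -mulrBl normrM.
rewrite mulrCA -mulrA ler_wpM2l//.
apply: (@le_trans _ _ (`|g y| * (`|y| + `|x|))); first by rewrite ler_wpM2l// ler_normB.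
rewrite mulrDr mulrDr mulr1 mulrDl lerD//; first by rewrite -normrM mulrC.
rewrite mulrAC ler_wpM2r//; exact: dg.2.
Qed.

(** Abel summation. With the factor [decay (e k)] inserted, Fubini turns the inner integral over [l]
    into the Poisson kernel, or into 0 for the sine. As [k] grows, one side converges by dominated
    convergence and the other by [poisson_approx]; the two limits agree. *)
Lemma trans_inversion b g g1 g2 x K L :
  (forall y, is_derive y (1 : R) g (g1 y)) -> (forall y, is_derive y (1 : R) g1 (g2 y)) ->
  cdom1 g K -> cdom1 g1 K -> cdom1 g2 K -> (forall y, `|y * g y| <= K * cauchyw y) ->
  (forall y, `|g y - g x| <= L * `|y - x|) ->
  \int[mu]_l trans b g x l = if b then 2 * pi * g x else 0.
Proof.
move=> dg dg1 Dg Dg1 Dg2 ygK gL.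
have [cg gK] := Dg.
have K0 : 0 <= K.
  by have := le_trans (normr_ge0 _) (Dg.2 0); rewrite pmulr_lge0// cauchyw_gt0.
have ct := @continuous_trans b g x K Dg ygK.
have tw := trans_decay b x dg dg1 Dg Dg1 Dg2.
pose e (k : nat) : R := k.+1%:R^-1.
have ek k : 0 < e k <= 1.
  by apply/andP; split; [rewrite invr_gt0 ltr0n|rewrite invf_le1 ?ltr0n ?ler1n].
have lim1 : \int[mu]_l (decay (e k) l * trans b g x l) @[k --> \oo] --> \int[mu]_l trans b g x l.
  apply: (@Rintegral_dominated_cvg _ _ _ (fun l => 2 * K * cauchy_mass * cauchyw l)).
  - by move=> k; apply: continuous_mul => //; exact: continuous_decay.
  - move=> l; rewrite -[X in _ --> X]mul1r; apply: cvgM; last exact: cvg_cst.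
    rewrite -[X in _ --> X](expR0 R) -(oppr0 R).
    apply: (@cvg_comp _ _ _ (fun k => - (e k * `|l|)) expR _ (nbhs (- 0 : R)));
      last exact: continuous_expR.
    apply: cvgN; rewrite -[X in _ --> X](mul0r `|l|); apply: cvgM; last exact: cvg_cst.
    exact: cvg_harmonic.
  - exact: (integrableZl measurableT _ integrable_cauchyw).
  - move=> k l; have /andP[e0 e1] := ek k.
    rewrite normrM (ger0_norm (decay_ge0 _ _)); apply: le_trans (tw l).
    by rewrite ler_piMl// decay_le1// ltW.
have E k : \int[mu]_l (decay (e k) l * trans b g x l) =
    \int[mu]_y (g y * (if b then poisson (e k) (y - x) else 0)).
  have /andP[e0 e1] := ek k.
  pose F (p : R * R) := decay (e k) p.1 * (g p.2 * trig b (p.1 * (p.2 - x))).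
  have mF : measurable_fun setT F.
    apply: measurable_funM.
      apply: (@measurableT_comp _ _ _ _ _ _ (decay (e k))) => //.
      by apply: continuous_measurable_fun; exact: continuous_decay.
    apply: measurable_funM.
      by apply: (@measurableT_comp _ _ _ _ _ _ g) => //; exact: continuous_measurable_fun.
    apply: (@measurableT_comp _ _ _ _ _ _ (trig b)) => //.
      by apply: continuous_measurable_fun; exact: continuous_trig.
    by apply: measurable_funM => //; apply: measurable_funB.
  have FK l y : `|F (l, y)| <= 2 / (e k) ^+ 2 * K * (cauchyw l * cauchyw y).
    rewrite /F /= normrM (ger0_norm (decay_ge0 _ _)).
    rewrite [leRHS](_ : _ = (2 / (e k) ^+ 2 * cauchyw l) * (K * cauchyw y)); last by ring.
    apply: ler_pM; rewrite ?decay_ge0//; first exact: decay_cauchyw.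
    exact: (cdom1_trig b x l Dg).2.
  transitivity (\int[mu]_l \int[mu]_y F (l, y)).
    apply: eq_Rintegral => l _; rewrite /trans -RintegralZl//.
    exact: cdom1_integrable (cdom1_trig b x l Dg).
  rewrite (Rintegral_Fubini mF FK); apply: eq_Rintegral => y _; rewrite /F /=.
  have P : \int[mu]_l (decay (e k) l * trig b (l * (y - x))) =
      if b then poisson (e k) (y - x) else 0.
    by case: (b); [exact: poisson_cos|exact: poisson_sin].
  rewrite -P -RintegralZl//; first by apply: eq_Rintegral => l _; ring.
  apply: (integrable_cauchyw_dom (K := 2 / (e k) ^+ 2)) => //.
    apply: continuous_mul; first exact: continuous_decay.
    move=> l; apply: (@continuous_comp _ _ _ (fun l => l * (y - x)) (trig b)).
      exact: continuous_mull.
    exact: continuous_trig.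
  move=> l _; rewrite normrM (ger0_norm (decay_ge0 _ _)).
  apply: le_trans (decay_cauchyw l (ek k)).
  by rewrite ler_piMr ?decay_ge0// trig_le1.
have lim2 : \int[mu]_l (decay (e k) l * trans b g x l) @[k --> \oo] -->
    (if b then 2 * pi * g x else 0).
  under eq_fun do rewrite E.
  case: (b).
    apply: (@poisson_approx _ g x K L) => // y; apply: le_trans (gK y) _.
    by rewrite ler_piMr// cauchyw_le1.
  rewrite (_ : (fun k => _) = fun=> 0); first exact: cvg_cst.
  by apply/funext => k; under eq_Rintegral do rewrite mulr0; rewrite Rintegral_cst// mul0r.
exact: (cvg_unique (@Rhausdorff R) lim1 lim2).
Qed.

End TrigonometricInversion.

(** * Integrals of products of one-variable functions *)

Section TensorIntegral.
Context {R : realType}.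
Local Notation C := R[i].
Local Notation mu := (@lebesgue_measure R).
Local Notation Re := complex.Re.
Local Notation Im := complex.Im.

Definition cintegral1 (u : R -> C) : C := (\int[mu]_y Re (u y) +i* \int[mu]_y Im (u y))%C.

Definition cdomc (u : R -> C) := [/\ continuous (fun y => Re (u y)),
  continuous (fun y => Im (u y)) & exists K, forall y, normc (u y) <= K * cauchyw y].

Lemma continuous_coord_comp n (j : 'I_n) (h : R -> R) : continuous h ->
  continuous (fun x : 'rV[R]_n => h (x 0 j)).
Proof.
move=> ch x; apply: (@continuous_comp _ _ _ (fun x : 'rV[R]_n => x 0 j) h); last exact: ch.
exact: coord_continuous.
Qed.

Lemma ccontinuous_prod n (I : Type) (r : seq I) (f : I -> 'rV[R]_n -> C) :
  (forall i, ccontinuous (f i)) -> ccontinuous (fun x => \prod_(i <- r) f i x).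
Proof.
move=> cf; elim: r => [|i r IH].
  rewrite (_ : (fun x => _) = fun=> 1); first exact: ccontinuous_cst.
  by apply/funext => x; rewrite big_nil.
rewrite (_ : (fun x => _) = fun x => f i x * \prod_(i <- r) f i x).
  exact: ccontinuousM.
by apply/funext => x; rewrite big_cons.
Qed.

Lemma cdom_tensor n (u : 'I_n -> R -> C) : (forall j, cdomc (u j)) ->
  cdom (fun x : 'rV[R]_n => \prod_j u j (x 0 j)).
Proof.
move=> cu; split.
  apply: ccontinuous_prod => j; have [cr ci _] := cu j.
  by split; [exact: (continuous_coord_comp (h := fun y => Re (u j y)))|
             exact: (continuous_coord_comp (h := fun y => Im (u j y)))].
have /choice[K HK] : forall j, exists K, forall y, normc (u j y) <= K * cauchyw y.
  by move=> j; case: (cu j).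
exists (\prod_j K j) => x; rewrite /rweight -big_split /=.
elim/big_ind2: _ => [|a b a' b' h1 h2|j _]; last exact: HK.
  by rewrite ComplexField.Normc.normc1.
by rewrite normcM ler_pM ?normc_ge0.
Qed.

Lemma cintegral_tensor n (u : 'I_n -> R -> C) : (forall j, cdomc (u j)) ->
  cintegral (fun x : 'rV[R]_n => \prod_j u j (x 0 j)) = \prod_j cintegral1 (u j).
Proof.
elim: n u => [|n IH] u cu.
  have I (c : R) : \int[lebesgue_tuple R 0]_t c = c.
    rewrite /Rintegral integral_cst// [X in (_ * X)%E](_ : _ = 1%E) ?mule1//=.
    by rewrite /dirac indicE in_setT.
  rewrite big_ord0 cintegralE; apply: complexP => /=.
    by under eq_Rintegral do rewrite big_ord0 /=; exact: I.
  by under eq_Rintegral do rewrite big_ord0 /=; exact: I.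
rewrite big_ord_recl -(IH _ (fun j => cu (lift ord0 j))).
set Q := (fun x : 'rV[R]_n => \prod_j u (lift ord0 j) (x 0 j)).
have dQ : cdom Q := cdom_tensor (fun j => cu (lift ord0 j)).
have [iQr iQi] := cdom_integrable dQ.
have [car cai [K0 aK]] := cu ord0.
have dF := cdom_tensor cu; have [[cFr cFi] [K FK]] := dF.
pose P (x : 'rV[R]_n.+1) : C := \prod_j u (lift ord0 j) (x 0 (lift ord0 j)).
have cP : ccontinuous P.
  apply: ccontinuous_prod => j; have [cr ci _] := cu (lift ord0 j).
  by split; [exact: (continuous_coord_comp (h := fun y => Re (u (lift ord0 j) y)))|
             exact: (continuous_coord_comp (h := fun y => Im (u (lift ord0 j) y)))].
have E x t : P (trow (tuple_cons (x, t))) = Q (trow t).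
  by apply: eq_bigr => j _; rewrite !trowE tnth_cons_lift.
have E0 x t : (trow (@tuple_cons R n (x, t))) 0 ord0 = x by rewrite trowE.
have FE (x : 'rV[R]_n.+1) : \prod_j u j (x 0 j) = u ord0 (x 0 ord0) * P x.
  by rewrite big_ord_recl.
have [_ [KQ QK]] := dQ.
pose A (al be : C -> R) (x : 'rV[R]_n.+1) := al (u ord0 (x 0 ord0)) * be (P x).
(* [al] and [be] stand for the real or the imaginary part: a product of two complex factors expands
   into four real products, each of which factors by Fubini. *)
have T (al be : C -> R) : (forall z, `|al z| <= normc z) -> (forall z, `|be z| <= normc z) ->
    continuous (fun y => al (u ord0 y)) -> continuous (fun x => be (P x)) ->
    continuous (fun x => be (Q x)) ->
    (lebesgue_tuple R n.+1).-integrable setT (EFin \o (fun t => A al be (trow t))) /\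
    \int[lebesgue_tuple R n.+1]_t A al be (trow t) =
    \int[mu]_y al (u ord0 y) * \int[lebesgue_tuple R n]_t be (Q (trow t)).
  move=> alz bez cal cbe cbeQ.
  have cA : continuous (A al be).
    by apply: continuousRM => //; exact: (continuous_coord_comp (h := fun y => al (u ord0 y))).
  have mA := measurable_trow cA.
  have AK t : `|A al be (trow t)| <= K * weight t.
    rewrite -rweight_trow; apply: le_trans (FK (trow t)).
    by rewrite FE normcM /A normrM ler_pM.
  split; first exact: integrable_dom mA AK.
  apply: (Rintegral_tensor mA AK (measurable_trow cbeQ) _ cal).
  - by exists KQ => t; rewrite -rweight_trow; exact: le_trans (bez _) (QK _).
  - by exists K0 => y; exact: le_trans (alz _) (aK y).
  - by move=> x t; rewrite /A E E0.
have [cPr cPi] := cP; have [[cQr cQi] _] := dQ.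
have [i1 T1] := T _ _ (@normc_Re R) (@normc_Re R) car cPr cQr.
have [i2 T2] := T _ _ (@normc_Im R) (@normc_Im R) cai cPi cQi.
have [i3 T3] := T _ _ (@normc_Re R) (@normc_Im R) car cPi cQi.
have [i4 T4] := T _ _ (@normc_Im R) (@normc_Re R) cai cPr cQr.
apply: complexP; rewrite ?cReM ?cImM !cintegralE /=.
  rewrite -T1 -T2 -(RintegralB measurableT i1 i2).
  by apply: eq_Rintegral => t _; rewrite FE cReM.
rewrite -T3 -T4 -(RintegralD measurableT i3 i4).
by apply: eq_Rintegral => t _; rewrite FE cImM.
Qed.

End TensorIntegral.

(** * Compactly supported functions and inversion for product bumps *)

Section BumpInversion.
Context {R : realType}.
Local Notation C := R[i].
Local Notation mu := (@lebesgue_measure R).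

Lemma compact_support_cdom1 (f : R -> R) (A : R) : continuous f ->
  (forall y, A < `|y| -> f y = 0) -> exists K, cdom1 f K.
Proof.
move=> cf f0; pose B := `|A| + 1; have B0 : 0 < B by rewrite ltr_pwDr.
pose h y := `|f y| * (1 + y ^+ 2).
have ch : continuous h.
  apply: continuous_mul; first by move=> y; apply: (cvg_norm (cf y)).
  by move=> y; apply: cvgD; [exact: cvg_cst|exact: exprn_continuous].
have [|c _ hc] := @EVT_max R h (- B) B _ (@continuous_withinE _ _ _ ch).
  by rewrite -subr_ge0 opprK addr_ge0// ltW.
exists (h c); split => // y; rewrite /cauchyw ler_pdivlMr ?ltr_pwDl ?sqr_ge0//.
have [yB|yB] := leP `|y| B; first by apply: hc; rewrite in_itv/= -ler_norml.
rewrite f0 ?normr0 ?mul0r//; last first.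
  by apply: le_lt_trans yB; rewrite (le_trans (ler_norm A))// lerDl.
by rewrite mulr_ge0// addr_ge0// sqr_ge0.
Qed.

Lemma cdom1_le_cst (f : R -> R) K K' : K <= K' -> cdom1 f K -> cdom1 f K'.
Proof.
move=> KK' [cf fK]; split => // y; apply: le_trans (fK y) _.
by rewrite ler_wpM2r ?cauchyw_ge0.
Qed.

Definition unitdir (_ : unit) : R := 1.

Lemma Cn_id m : Cn unitdir m (fun y : R => y).
Proof.
case: m => [|m]; first by move=> y; exact: cvg_id.
split; first by move=> y; exact: cvg_id.
  by move=> j x; exact: derivable_id.
move=> j; rewrite (_ : pd _ _ _ = fun=> 1); first exact: Cn_cst.
by apply/funext => x; rewrite pdE; exact: derive_id.
Qed.

Definition bumpat (a p : R) (y : R) : R := bump1 (a * (y - p)).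

Lemma Cn_bumpat a p m : Cn unitdir m (bumpat a p).
Proof.
apply: Cn_bump1; apply: CnM; first exact: Cn_cst.
by apply: CnB; [exact: Cn_id|exact: Cn_cst].
Qed.

Lemma bumpat_eq0 a p y : 0 < a -> 2 / a <= `|y - p| -> bumpat a p y = 0.
Proof.
move=> a0 H; apply: bump1_eq0; rewrite normrM (gtr0_norm a0).
by rewrite -ler_pdivrMl// mulrC.
Qed.

Lemma pd_eq0_open {V : normedModType R} {J : Type} (e : J -> V) j (O : set V) (f : V -> R) :
  open O -> (forall x, O x -> f x = 0) -> forall x, O x -> pd e j f x = 0.
Proof.
move=> oO f0 x Ox; rewrite pdE (near_eq_derive (g := fun=> 0)); first exact: derive_cst.
by near=> z; apply: f0; near: z; exact: open_nbhs_nbhs.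
Unshelve. all: by end_near. Qed.

Lemma open_far {V : normedModType R} (p : V) (r : R) : open [set y : V | r < `|y - p|].
Proof.
apply: (@open_comp _ _ (fun y : V => `|y - p|) [set t | r < t]); last exact: open_gt.
by move=> x _; exact: dist_continuous.
Qed.

Lemma pd_eq0 (f : R -> R) p r : (forall y, r < `|y - p| -> f y = 0) ->
  forall y, r < `|y - p| -> pd unitdir tt f y = 0.
Proof.
move=> f0 y ry; exact: (pd_eq0_open unitdir tt (@open_far R^o p r) f0).
Qed.

(** Collects what [trans_inversion] asks of a bump. One constant serves for four bounds, as the sum
    of four maxima; the Lipschitz constant is a bound for the derivative. *)
Lemma bumpat_data a p x : 0 < a -> exists g1 g2 K L,
  [/\ forall y, is_derive y (1 : R) (bumpat a p) (g1 y),
      forall y, is_derive y (1 : R) g1 (g2 y),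
      [/\ cdom1 (bumpat a p) K, cdom1 g1 K & cdom1 g2 K],
      forall y, `|y * bumpat a p y| <= K * cauchyw y &
      forall y, `|bumpat a p y - bumpat a p x| <= L * `|y - x|].
Proof.
move=> a0; set g := bumpat a p.
have [cg dg Cg] := Cn_bumpat a p 3; have [cg1 dg1 Cg1] := Cg tt.
have [cg2 dg2 _] := Cg1 tt.
pose g1 := pd unitdir tt g; pose g2 := pd unitdir tt g1.
pose r := 2 / a.
have z0 (y : R) : r < `|y - p| -> g y = 0 by move=> ry; apply: bumpat_eq0 => //; exact: ltW.
have z1 := pd_eq0 z0; have z2 := pd_eq0 z1.
have far (y : R) : r + `|p| < `|y| -> r < `|y - p|.
  by move=> ry; apply: lt_le_trans (lerB_dist y p); rewrite ltrBrDr.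
have [K0 D0] := compact_support_cdom1 cg (fun y h => z0 y (far y h)).
have [K1 D1] := compact_support_cdom1 cg1 (fun y h => z1 y (far y h)).
have [K2 D2] := compact_support_cdom1 cg2 (fun y h => z2 y (far y h)).
have cyg : continuous (fun y : R => y * g y).
  by apply: continuous_mul => // y; exact: cvg_id.
have yz (y : R) : r + `|p| < `|y| -> y * g y = 0 by move=> h; rewrite z0 ?mulr0//; exact: far.
have [K3 D3] := compact_support_cdom1 cyg yz.
have pos (f : R -> R) (K : R) : cdom1 f K -> 0 <= K.
  by move=> [_ /(_ 0) h]; have := le_trans (normr_ge0 _) h; rewrite pmulr_lge0// cauchyw_gt0.
have h0 := pos _ _ D0; have h1 := pos _ _ D1; have h2 := pos _ _ D2; have h3 := pos _ _ D3.
have dgy (y : R) : is_derive y (1 : R) g (g1 y) by exact: is_derive_pd (dg tt y).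
exists g1, g2, (K0 + K1 + K2 + K3), K1; split.
- exact: dgy.
- by move=> y; exact: is_derive_pd (dg1 tt y).
- by split; [apply: cdom1_le_cst D0|apply: cdom1_le_cst D1|apply: cdom1_le_cst D2]; lra.
- move=> y; apply: le_trans (D3.2 y) _; rewrite ler_wpM2r ?cauchyw_ge0//; lra.
- move=> y.
  have D s : is_derive s (1 : R) (fun s => g (s + x)) (g1 (s + x)).
    have E : is_derive s (1 : R) (fun s => s + x) 1.
      by have := is_deriveD (is_derive_id s (1 : R)) (is_derive_cst x s (1 : R)); rewrite addr0.
    by have := @is_derive1_comp _ g (fun s => s + x) s _ _ (dgy (s + x)) E; rewrite mulr1.
  have := @mean_value_le _ _ _ K1 (y - x) D; rewrite subrK add0r; apply => s _.
  by apply: le_trans (D1.2 _) _; rewrite ler_piMr// cauchyw_le1.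
Qed.

Lemma expi_sum (I : Type) (r : seq I) (F : I -> R) :
  expi (\sum_(i <- r) F i) = \prod_(i <- r) expi (F i).
Proof.
elim: r => [|i r IH]; last by rewrite !big_cons expiD IH.
by rewrite !big_nil; apply: complexP; rewrite /= ?cos0 ?sin0.
Qed.

Context {n : nat}.
Local Notation V := 'rV[R]_n.

Lemma cpd_eq0_open (O : set V) (f : V -> C) j : open O -> (forall x, O x -> f x = 0) ->
  forall x, O x -> cpd j f x = 0.
Proof.
move=> oO f0 x Ox; rewrite cpd.unlock.
by rewrite !(pd_eq0_open dir j oO)// => y Oy; rewrite f0.
Qed.

Lemma foldr_eq0_open (O : set V) (f : V -> C) s : open O -> (forall x, O x -> f x = 0) ->
  forall x, O x -> foldr cpd f s x = 0.
Proof. by move=> oO f0; elim: s => [|j s IH] //=; exact: cpd_eq0_open. Qed.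

(** Induction on the length absorbs the innermost letter into the function, which is why the class
    [D] has to be stable under derivatives. The sum over the letters stands in for a maximum. *)
Lemma words_bound (D : (V -> C) -> Prop) (w : V -> R) :
  (forall f, D f -> exists K, forall x, w x * normc (f x) <= K) ->
  (forall f j, D f -> D (cpd j f)) -> forall m f, D f ->
  exists K, forall s, (size s <= m)%N -> forall x,
    w x * normc (foldr cpd f s x) <= K.
Proof.
move=> Db Dd; elim=> [|m IH] f Df.
  by have [K fK] := Db f Df; exists K => s; rewrite leqn0 => /nilP ->.
have [K0 fK0] := Db f Df.
have /choice[K fK] := fun j => IH _ (Dd f j Df).
exists (`|K0| + \sum_j `|K j|) => s.
case/lastP: s => [_ x|s j].
  by apply: le_trans (fK0 x) _; rewrite (le_trans (ler_norm _))// lerDl sumr_ge0.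
rewrite size_rcons ltnS => sm x; rewrite foldr_rcons.
apply: le_trans (fK j s sm x) _; rewrite (le_trans (ler_norm _))//.
by rewrite (bigD1 j)//= addrCA lerDl addr_ge0// sumr_ge0.
Qed.

Lemma continuous_bounded_box (f : V -> R) A : continuous f ->
  exists K, forall x, `|x| <= A -> `|f x| <= K.
Proof.
move=> cf; have [A0|A0] := ltP A 0.
  by exists 0 => x xA; have := le_lt_trans (le_trans (normr_ge0 x) xA) A0; rewrite ltxx.
have cnf : continuous (fun x => `|f x|) by move=> x; exact: (cvg_norm (cf x)).
have [||c _ fc] := @EVT_max_rV R n (fun x => `|f x|) [set x : V | `|x - 0| <= A] _
  (@compact_box R n 0 A) _.
- by exists 0; rewrite /= subr0 normr0.
- exact: continuous_subspaceT.
by exists `|f c| => x xA; apply: fc; rewrite inE /= subr0.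
Qed.

Lemma ccontinuous_bounded_box (f : V -> C) A : ccontinuous f ->
  exists K, forall x, `|x| <= A -> normc (f x) <= K.
Proof.
move=> [cr ci]; have [K1 H1] := continuous_bounded_box A cr.
have [K2 H2] := continuous_bounded_box A ci.
exists (K1 + K2) => x xA; apply: le_trans (normc_le _) _.
by rewrite lerD ?H1 ?H2.
Qed.

Lemma compact_support_cschwartz (f : V -> C) A : csmooth f ->
  (forall x, A < `|x| -> f x = 0) -> cschwartz f.
Proof.
move=> sf f0; split => // m.
pose D (g : V -> C) := csmooth g /\ forall x, A < `|x| -> g x = 0.
apply: (@words_bound D (fun x => (1 + `|x|) ^+ m)) => //.
  move=> g [sg g0]; have [K gK] := ccontinuous_bounded_box A (smooth_cont sg).
  exists ((1 + `|A|) ^+ m * `|K|) => x.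
  have [xA|xA] := leP `|x| A; last first.
    by rewrite g0// normc0 mulr0 mulr_ge0// exprn_ge0// addr_ge0.
  apply: ler_pM; rewrite ?norm1X_ge0 ?normc_ge0//; last exact: le_trans (gK x xA) (ler_norm _).
  rewrite lerXn2r ?nnegrE ?addr_ge0// lerD2l; exact: le_trans xA (ler_norm _).
move=> g j [sg g0]; split; first exact: smooth_cpd.
move=> x xA; apply: (@cpd_eq0_open [set x : V | A < `|x - 0|]) => //=.
- exact: open_far.
- by move=> y; rewrite subr0; exact: g0.
- by rewrite subr0.
Qed.

Section Product.
Variables (a : R) (p : V).
Hypothesis a0 : 0 < a.

Definition bumpprod (y : V) : R := \prod_j bumpat a (p 0 j) (y 0 j).

Lemma bumpprodE y : bumpprod y = boxbump (a *: y + - (a *: p)).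
Proof. by apply: eq_bigr => j _; rewrite /bumpat !mxE mulrBr. Qed.

Lemma smooth_bumpprod : csmooth (fun y => (bumpprod y)%:C%C).
Proof.
apply: (eq_smooth _ (smooth_affine a (- (a *: p)) (smooth_boxbump (n := n)))) => y.
by rewrite bumpprodE.
Qed.

Lemma bumpprod_eq0 y : 2 / a <= `|y - p| -> bumpprod y = 0.
Proof.
move=> H; rewrite bumpprodE boxbump_eq0// -scalerBr normrZ gtr0_norm//.
by rewrite -ler_pdivrMl// mulrC.
Qed.

Lemma bumpprod_ge0 y : 0 <= bumpprod y.
Proof. by apply: prodr_ge0 => j _; exact: bump1_ge0. Qed.

Lemma cschwartz_bumpprod : cschwartz (fun y => (bumpprod y)%:C%C).
Proof.
apply: (compact_support_cschwartz (A := 2 / a + `|p|)) smooth_bumpprod _ => y H.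
rewrite bumpprod_eq0//; apply: le_trans (lerB_dist y p).
by rewrite lerBrDr ltW.
Qed.

(** Moving the outer wave under the integral turns the phase into the sum of the l_j (y_j - x_j),
    which is the phase of [trans], and everything splits over the coordinates. *)
Lemma fourier_bumpprod (l x : V) :
  fourier (fun y => (bumpprod y)%:C%C) (- l) * wave x l =
  (@cfourier R n)%:C%C * \prod_j
    (trans true (bumpat a (p 0 j)) (x 0 j) (l 0 j) +i*
     trans false (bumpat a (p 0 j)) (x 0 j) (l 0 j))%C.
Proof.
pose u j (y : R) : C := (bumpat a (p 0 j) y)%:C%C * expi (l 0 j * (y - x 0 j)).
have cu j : cdomc (u j).
  have [g1 [g2 [K [L [_ _ [D _ _] _ _]]]]] := bumpat_data (p 0 j) 0 a0.
  have Er y : complex.Re (u j y) = bumpat a (p 0 j) y * trig true (l 0 j * (y - x 0 j)).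
    by rewrite cReZ.
  have Ei y : complex.Im (u j y) = bumpat a (p 0 j) y * trig false (l 0 j * (y - x 0 j)).
    by rewrite cImZ.
  split; last first.
  - by exists K => y; rewrite normcM normc_expi mulr1 normc_real; exact: D.2.
  - under eq_fun do rewrite Ei; exact: (cdom1_trig false (x 0 j) (l 0 j) D).1.
  - under eq_fun do rewrite Er; exact: (cdom1_trig true (x 0 j) (l 0 j) D).1.
have -> : \prod_j (trans true (bumpat a (p 0 j)) (x 0 j) (l 0 j) +i*
     trans false (bumpat a (p 0 j)) (x 0 j) (l 0 j))%C = \prod_j cintegral1 (u j).
  apply: eq_bigr => j _; rewrite /cintegral1 /trans.
  by congr (_ +i* _)%C; apply: eq_Rintegral => y _; rewrite ?cReZ ?cImZ.
rewrite -cintegral_tensor// fourierE -mulrA; congr (_ * _).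
rewrite mulrC -cintegralZ; last exact/cdom_wave/cschwartz_cdom/cschwartz_bumpprod.
congr (cintegral _); apply/funext => y.
rewrite /u big_split /= -expi_sum /bumpprod rmorph_prod mulrCA; congr (_ * _).
rewrite /wave -expiD; congr expi; rewrite /dotp -!sumrN -big_split /=.
by apply: eq_bigr => j _; rewrite mxE; ring.
Qed.

(** Each coordinate contributes one application of [trans_inversion]: the cosine part gives [2 * pi]
    times the bump, the sine part disappears. *)
Lemma fourier_inversion_bumpprod (x : V) :
  fourier (fun l => fourier (fun y => (bumpprod y)%:C%C) (- l)) x =
  (((@cfourier R n) ^+ 2 * (2 * pi) ^+ n)%:C%C * (bumpprod x)%:C%C).
Proof.
pose h j (l : R) : C := (trans true (bumpat a (p 0 j)) (x 0 j) l +i*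
     trans false (bumpat a (p 0 j)) (x 0 j) l)%C.
have H j : cdomc (h j) /\ cintegral1 (h j) = (2 * pi * bumpat a (p 0 j) (x 0 j))%:C%C.
  have [g1 [g2 [K [L [dg dg1 [D D1 D2] yg gL]]]]] := bumpat_data (p 0 j) (x 0 j) a0.
  split; last first.
    rewrite /cintegral1 /h /= (trans_inversion true dg dg1 D D1 D2 yg gL).
    by rewrite (trans_inversion false dg dg1 D D1 D2 yg gL).
  split.
  - exact: (continuous_trans (b := true) D yg).
  - exact: (continuous_trans (b := false) D yg).
  - exists (2 * K * cauchy_mass + 2 * K * cauchy_mass) => l.
    apply: le_trans (normc_le _) _; rewrite mulrDl /=.
    by apply: lerD; exact: (trans_decay _ _ dg dg1 D D1 D2).
rewrite fourierE.
have -> : (fun l => fourier (fun y => (bumpprod y)%:C%C) (- l) * wave x l) =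
    (fun l : V => (@cfourier R n)%:C%C * \prod_j h j (l 0 j)).
  by apply/funext => l; rewrite fourier_bumpprod.
rewrite cintegralZ; last by apply: cdom_tensor => j; case: (H j).
rewrite cintegral_tensor; last by move=> j; case: (H j).
rewrite (eq_bigr (fun j => (2 * pi * bumpat a (p 0 j) (x 0 j))%:C%C)); last first.
  by move=> j _; case: (H j).
rewrite -rmorph_prod big_split /= prodr_const card_ord -/(bumpprod x).
by rewrite mulrA -!rmorphM /= -expr2 !mulrA.
Qed.

End Product.
End BumpInversion.

(** * Tempered functionals *)

Section Tempered.
Context {R : realType} {n : nat}.
Local Notation C := R[i].
Local Notation V := 'rV[R]_n.

(** Spelling a multi-index as a word connects [mpartial] and the Schwartz seminorms with the
    estimates, which are all over words. *)
Definition mword (a : mpoly.multinom n) : seq 'I_n :=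
  flatten [seq nseq (mpoly.fun_of_multinom a j) j | j <- enum 'I_n].

Lemma mpartialE a (f : V -> C) : mpartial a f = foldr cpd f (mword a).
Proof.
rewrite /mpartial partialE /mword; elim: (enum 'I_n) => [//|j s IH] /=.
rewrite IH foldr_cat; move: (foldr cpd f _) => g.
by elim: (mpoly.fun_of_multinom a j) => [//|k IHk] /=; rewrite IHk.
Qed.

Lemma size_mword a : size (mword a) = mpoly.mdeg a.
Proof.
rewrite mpoly.mdegE /mword size_flatten /shape -map_comp sumnE big_map big_enum /=.
by apply: eq_bigr => j _; rewrite size_nseq.
Qed.

Lemma prod_mword (a : mpoly.multinom n) (A : comPzRingType) (h : 'I_n -> A) :
  \prod_(j <- mword a) h j = \prod_j h j ^+ mpoly.fun_of_multinom a j.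
Proof.
rewrite /mword big_flatten /= big_map big_enum /=; apply: eq_bigr => j _.
by rewrite big_nseq -Monoid.iteropE.
Qed.

Lemma monomial_le a (x : V) : `|monomial a x| <= (1 + `|x|) ^+ mpoly.mdeg a.
Proof.
rewrite /monomial normr_prod mpoly.mdegE -prodrXr; apply: ler_prod => j _.
rewrite normr_ge0 normrX lerXn2r ?nnegrE ?norm1X_ge0 ?addr_ge0//.
by apply: le_trans (coord_le_norm x j) _; rewrite lerDr.
Qed.

Lemma seminorm_le (a b : mpoly.multinom n) (f : V -> C) m K :
  (mpoly.mdeg a <= m)%N -> (mpoly.mdeg b <= m)%N -> sbound m f K ->
  (schwartz_seminorm a b f <= K%:E)%E.
Proof.
move=> am bm fK; apply: ge_ereal_sup => _ [x _ <-]; rewrite lee_fin.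
have bs : (size (mword b) <= m)%N by rewrite size_mword.
apply: le_trans (fK _ bs x); rewrite mpartialE normcM normc_real ler_wpM2r ?normc_ge0//.
apply: le_trans (monomial_le a x) _.
by rewrite ler_weXn2l ?lerDl.
Qed.

Lemma cschwartz_schwartz (f : V -> C) : cschwartz f -> schwartz f.
Proof.
move=> [sf fb]; split; first exact/csmoothP.
move=> a b; have [K fK] := fb (mpoly.mdeg a + mpoly.mdeg b)%N.
by apply: le_lt_trans (seminorm_le (leq_addr _ _) (leq_addl _ _) fK) _; exact: ltry.
Qed.

(** Temperedness in terms of [sbound]: a single order [m], and stability under the Fourier transform
    and under [adjop] becomes a mere change of order. *)
Definition ctempered (S : (V -> C) -> C) :=
  (forall (c : C) f g, cschwartz f -> cschwartz g ->
     S (fun x => c * f x + g x) = c * S f + S g) /\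
  exists (m : nat) (c : R), 0 <= c /\
    forall f K, cschwartz f -> sbound m f K -> normc (S f) <= c * K.

Lemma tempered_ctempered (T : (V -> C) -> C) : tempered_distribution T -> ctempered T.
Proof.
move=> [Tl [k [c Tb]]]; split.
  by move=> e f g sf sg; apply: Tl; exact: cschwartz_schwartz.
(* The cardinality squared counts the pairs of multi-indices in the double sum. The absolute value
   is taken because [c] may be negative. *)
exists k, (`|c| * (#|{: mpoly.bmultinom n k}| ^ 2)%:R); split; first by rewrite mulr_ge0.
move=> f K sf fK; rewrite -lee_fin.
have K0 := sbound_ge0 fK.
have S0 (a b : mpoly.multinom n) : (0 <= schwartz_seminorm a b f)%E.
  apply: le_trans (ereal_sup_ubound _); last by exists 0.
  by rewrite lee_fin normc_ge0.
apply: le_trans (Tb f (cschwartz_schwartz sf)) _.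
apply: (@le_trans _ _ (`|c|%:E * \sum_(a : mpoly.bmultinom n k)
    \sum_(b : mpoly.bmultinom n k) schwartz_seminorm (mpoly.bmnm a) (mpoly.bmnm b) f)%E).
  apply: lee_wpmul2r; last by rewrite lee_fin ler_norm.
  by apply: sume_ge0 => a _; apply: sume_ge0 => b _.
rewrite -mulrA EFinM; apply: lee_wpmul2l; first by rewrite lee_fin.
apply: (@le_trans _ _ (\sum_(a : mpoly.bmultinom n k) \sum_(b : mpoly.bmultinom n k) K%:E)%E).
  apply: lee_sum => a _; apply: lee_sum => b _.
  by apply: seminorm_le fK; rewrite ltnW// mpoly.bmdeg.
under eq_bigr do rewrite sumEFin sumr_const.
rewrite sumEFin sumr_const -mulrnA lee_fin mulr_natl -mulnn.
by rewrite (@eq_card _ xpredT {: mpoly.bmultinom n k}).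
Qed.

Lemma ctempered_fourier S : ctempered S -> ctempered (fun f => S (fourier f)).
Proof.
move=> [Sl [m [c [c0 Sb]]]]; split.
  move=> e f g sf sg; rewrite -Sl; [|exact: cschwartz_fourier..].
  congr S; apply/funext => l; rewrite fourierD ?fourierZ//; first exact: cschwartz_cdom.
    by apply: cdomZ; exact: cschwartz_cdom.
  exact: cschwartz_cdom.
have [M [c' c'0 H]] := @fourier_sbound R n m.
exists M, (c * c'); split; first by rewrite mulr_ge0.
move=> f K sf fK; rewrite -mulrA; apply: Sb; first exact: cschwartz_fourier.
exact: H.
Qed.

Lemma ctemperedD S f g : ctempered S -> cschwartz f -> cschwartz g ->
  S (fun x => f x + g x) = S f + S g.
Proof.
move=> [Sl _] sf sg; rewrite -[in RHS](mul1r (S f)) -Sl//; congr S.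
by apply/funext => x; rewrite mul1r.
Qed.

Lemma cschwartz0 : @cschwartz R n (fun=> 0).
Proof.
split; first exact: smooth_cst.
by move=> m; exists 0 => s _ x; rewrite foldr_cst; case: s => [|? ?]; rewrite normc0 mulr0.
Qed.

Lemma ctempered0 S : ctempered S -> S (fun=> 0) = 0.
Proof.
move=> tS; have /eqP := ctemperedD tS cschwartz0 cschwartz0.
rewrite (_ : (fun x : V => 0 + 0) = fun=> 0); last by apply/funext => x; rewrite addr0.
by rewrite -subr_eq0 opprD addNKr oppr_eq0 => /eqP.
Qed.

End Tempered.

(** * Cutoffs and quantitative density of compactly supported functions *)

Section Cutoff.
Context {R : realType} {n : nat}.
Local Notation C := R[i].
Local Notation V := 'rV[R]_n.

Definition cutoff (a : R) (p : V) (y : V) : C := (bumpprod a p y)%:C%C.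

Lemma cutoffE a p : cutoff a p = fun y => (boxbump (a *: y + - (a *: p)))%:C%C.
Proof. by apply/funext => y; rewrite /cutoff bumpprodE. Qed.

Lemma smooth_cutoff a p : csmooth (cutoff a p).
Proof. exact: smooth_bumpprod. Qed.

Lemma cutoff_eq1 a p y : 0 < a -> a * `|y - p| <= 1 -> cutoff a p y = 1.
Proof.
move=> a0 H; rewrite cutoffE boxbump_eq1// -scalerBr normrZ gtr0_norm//.
Qed.

Lemma cutoff_eq0 a p y : 0 < a -> 2 / a <= `|y - p| -> cutoff a p y = 0.
Proof. by move=> a0 H; rewrite /cutoff bumpprod_eq0. Qed.

(** Every derivative of the rescaled bump brings a factor [a <= 1], so the bound for the unit bump
    serves for all scales. *)
Lemma cutoff_deriv_bound m : exists2 A : R, 0 <= A &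
  forall a (s : seq 'I_n) x, 0 < a -> a <= 1 ->
  (size s <= m)%N -> normc (foldr cpd (fun y => 1 - cutoff a 0 y) s x) <= A.
Proof.
have [_ /(_ m)[K bK]] := @cschwartz_bumpprod R n 1 0 ltr01.
have K0 := sbound_ge0 bK.
exists (1 + K); first by rewrite addr_ge0.
move=> a s x a0 a1 sm.
have -> : (fun y => 1 - cutoff a 0 y) = fun y => 1 + -1 * (cutoff a 0 y).
  by apply/funext => y; rewrite mulN1r.
rewrite foldrD; [|exact: smooth_cst|exact: smoothZ (smooth_cutoff _ _)].
rewrite foldrZ; last exact: smooth_cutoff.
apply: le_trans (normcD _ _) _; apply: lerD.
  rewrite foldr_cst; case: s {sm} => [|? ?]; last by rewrite normc0.
  by rewrite ComplexField.Normc.normc1.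
rewrite mulN1r normcN cutoffE (@foldr_affine _ _ (fun y => (boxbump y)%:C%C)); last first.
  exact: smooth_boxbump.
rewrite normcM normcX normc_real gtr0_norm//.
rewrite -[leRHS]mul1r; apply: ler_pM; rewrite ?normc_ge0 ?exprn_ge0 ?(ltW a0)//.
  by rewrite exprn_ile1 ?(ltW a0).
set z := a *: x + _.
have := bK s sm z; rewrite (_ : (fun y => _) = fun y => (boxbump y)%:C%C); last first.
  by apply/funext => y; rewrite bumpprodE scale1r scaler0 subr0.
by apply: le_trans; rewrite ler_peMl ?normc_ge0 ?norm1X_ge1.
Qed.

(** The factor 1 - cutoff vanishes where a |x| < 1. Elsewhere the additional weight 1 + |x| granted
    by the index [m.+1] is at least 1/a, and this is the origin of the rate [a]. *)
Lemma cutoff_sbound m : exists2 A : R, 0 <= A & forall h K a, csmooth h -> 0 < a -> a <= 1 ->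
  sbound m.+1 h K -> sbound m (fun x => (1 - cutoff a 0 x) * h x) (A * K * a).
Proof.
have [A A0 HA] := cutoff_deriv_bound m.
exists (2 ^+ m * A); first by rewrite mulr_ge0 ?exprn_ge0.
move=> h K a sh a0 a1 hK s sm x; have K0 := sbound_ge0 hK.
have s1 : csmooth (fun x => 1 - cutoff a 0 x).
  by apply: smoothB; [exact: smooth_cst|exact: smooth_cutoff].
have [xa|xa] := ltP (a * `|x|) 1.
  rewrite (@foldr_eq0_open _ _ [set y : V | a * `|y| < 1]) ?normc0 ?mulr0//.
  - by rewrite !mulr_ge0// ?exprn_ge0// ltW.
  - apply: (@open_comp _ _ (fun y : V => a * `|y|) [set t | t < 1]); last exact: open_lt.
    move=> y _; apply: (@cvgM _ _ (nbhs y) _ (fun=> a) (fun y : V => `|y|)).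
      exact: cvg_cst.
    exact: (cvg_norm (@cvg_id _ (nbhs y))).
  - by move=> y /= /ltW ya; rewrite cutoff_eq1 ?subr0// subrr mul0r.
have N0 : 0 < 1 + `|x| by rewrite ltr_pwDl.
pose Nm := (1 + `|x|) ^+ m.+1; have Nm0 : 0 < Nm by rewrite exprn_gt0.
have L := @leibniz_bound _ _ m _ h x A (K / Nm) s1 sh (fun s' H => HA a s' x a0 a1 H).
have {}L : normc (foldr cpd (fun x => (1 - cutoff a 0 x) * h x) s x) <= 2 ^+ m * A * (K / Nm).
  apply: L => // s' sm'; rewrite ler_pdivlMr// mulrC.
  by apply: (hK s' (leqW sm') x).
apply: le_trans (ler_wpM2l (norm1X_ge0 x m) L) _.
rewrite /Nm exprS invfM (mulrC _ (2 ^+ m * A * _)) -!mulrA.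
rewrite mulVf ?mulr1 ?expf_neq0 ?lt0r_neq0//.
rewrite 3?ler_wpM2l ?exprn_ge0// -div1r ler_pdivrMr//.
by apply: le_trans xa _; rewrite ler_pM2l// lerDr.
Qed.

Lemma cschwartzMbump h a p : 0 < a -> csmooth h -> cschwartz (fun x => cutoff a p x * h x).
Proof.
move=> a0 sh; apply: (@compact_support_cschwartz _ _ _ (2 / a + `|p|)).
  exact: smoothM (smooth_cutoff _ _) sh.
move=> x xa; rewrite cutoff_eq0 ?mul0r//; apply: le_trans (lerB_dist x p).
by rewrite lerBrDr ltW.
Qed.

Lemma ctempered_cutoff S h : ctempered S -> cschwartz h ->
  exists2 A : R, 0 <= A & forall a, 0 < a -> a <= 1 ->
    normc (S h - S (fun x => cutoff a 0 x * h x)) <= A * a.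
Proof.
move=> tS sh; have [Sl [m [c [c0 Sb]]]] := tS.
have [A A0 HA] := cutoff_sbound m; have [sm /(_ m.+1)[K hK]] := sh.
exists (c * (A * K)); first by rewrite !mulr_ge0// (sbound_ge0 hK).
move=> a a0 a1.
pose u x := cutoff a 0 x * h x; pose v x := (1 - cutoff a 0 x) * h x.
have su : cschwartz u := cschwartzMbump 0 a0 sm.
have sv : cschwartz v.
  rewrite (_ : v = fun x => h x + -1 * u x).
    by apply: cschwartzD => //; exact: cschwartzZ.
  by apply/funext => x; rewrite /v /u mulrBl mul1r mulN1r.
have -> : S h = S v + S u.
  rewrite -ctemperedD//; congr S; apply/funext => x.
  by rewrite /v /u -mulrDl subrK mul1r.
rewrite addrK -mulrA; apply: Sb => //; exact: HA.
Qed.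

Lemma cvg0_le (x A : R) : 0 <= A -> (forall a, 0 < a -> a <= 1 -> x <= A * a) -> x <= 0.
Proof.
move=> A0 H; apply/ler_addgt0Pr => e e0; rewrite add0r.
pose a := Num.min 1 (e / (A + 1)).
have A1 : 0 < A + 1 by rewrite ltr_wpDl.
have a0 : 0 < a by rewrite lt_min ltr01 divr_gt0.
have a1 : a <= 1 by rewrite ge_min lexx.
apply: le_trans (H a a0 a1) _.
have ae : a <= e / (A + 1) by rewrite ge_min lexx orbT.
apply: le_trans (ler_wpM2l A0 ae) _.
rewrite mulrCA ler_piMr ?(ltW e0)// ler_pdivrMr// mul1r lerDl ler01//.
Qed.

Lemma ctempered_density S (h : V -> C) : ctempered S -> cschwartz h ->
  (forall a, 0 < a -> a <= 1 -> S (fun x => cutoff a 0 x * h x) = 0) -> S h = 0.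
Proof.
move=> tS sh S0; have [A A0 H] := ctempered_cutoff tS sh.
apply/eqP; rewrite -normc_eq0 eq_le normc_ge0 andbT.
apply: (cvg0_le A0) => a a0 a1; have := H a a0 a1.
by rewrite S0// subr0.
Qed.

End Cutoff.

(** * Adjoint of a constant-coefficient operator *)

Section Adjoint.
Context {R : realType} {n : nat}.
Local Notation C := R[i].
Local Notation V := 'rV[R]_n.
Variable P : mpoly.mpoly n C.

(* Partial derivatives along a word are never permuted, so the transpose takes
   them along the reversed word. *)
Definition adjop (g : V -> C) : V -> C := fun x =>
  \sum_(a <- mpoly.msupp P) mpoly.mcoeff a P * (-1) ^+ mpoly.mdeg a *
    foldr cpd g (rev (mword a)) x.

Lemma diffopE (f : V -> C) : diffop P f =
  fun x => \sum_(a <- mpoly.msupp P) mpoly.mcoeff a P * foldr cpd f (mword a) x.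
Proof. by apply/funext => x; apply: eq_bigr => a _; rewrite mpartialE. Qed.

Lemma smooth_diffop f : csmooth f -> csmooth (diffop P f).
Proof.
move=> sf; rewrite diffopE; apply: smooth_sum => a.
by apply: smoothZ; exact: smooth_foldr.
Qed.

Lemma smooth_adjop g : csmooth g -> csmooth (adjop g).
Proof.
move=> sg; apply: smooth_sum => a.
by apply: smoothZ; exact: smooth_foldr.
Qed.

Lemma smooth_iter_diffop k f : csmooth f -> csmooth (iter k (diffop P) f).
Proof. by move=> sf; elim: k => [//|k IH]; exact: smooth_diffop. Qed.

Lemma smooth_iter_adjop k f : csmooth f -> csmooth (iter k adjop f).
Proof. by move=> sf; elim: k => [//|k IH]; exact: smooth_adjop. Qed.

Lemma adjop_eq0_open (O : set V) g : open O -> (forall x, O x -> g x = 0) ->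
  forall x, O x -> adjop g x = 0.
Proof.
move=> oO g0 x Ox; rewrite /adjop big1// => a _.
by rewrite (@foldr_eq0_open _ _ O)// mulr0.
Qed.

Lemma iter_adjop_eq0_open (O : set V) g k : open O -> (forall x, O x -> g x = 0) ->
  forall x, O x -> iter k adjop g x = 0.
Proof. by move=> oO g0; elim: k => [//|k IH]; exact: adjop_eq0_open. Qed.

Lemma foldr_lin (c : C) (f g : V -> C) s : csmooth f -> csmooth g ->
  foldr cpd (fun x => c * f x + g x) s = fun x => c * foldr cpd f s x + foldr cpd g s x.
Proof.
move=> sf sg; rewrite (foldrD s (smoothZ c sf) sg) (foldrZ c s sf) //.
Qed.

Lemma adjop_lin (c : C) (f g : V -> C) : csmooth f -> csmooth g ->
  adjop (fun x => c * f x + g x) = fun x => c * adjop f x + adjop g x.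
Proof.
move=> sf sg; apply/funext => x; rewrite /adjop mulr_sumr -big_split /=.
by apply: eq_bigr => a _; rewrite (foldr_lin c _ sf sg) mulrDr mulrCA.
Qed.

Lemma cschwartz_foldr f s : cschwartz f -> cschwartz (foldr cpd f s : V -> C).
Proof. by move=> sf; elim: s => [//|j s IH]; exact: cschwartz_cpd. Qed.

Lemma cschwartz_sum (I : Type) (r : seq I) (F : I -> V -> C) :
  (forall i, cschwartz (F i)) -> cschwartz (fun x => \sum_(i <- r) F i x).
Proof.
move=> sF; elim: r => [|i r IH].
  rewrite (_ : (fun x => _) = fun=> 0); first exact: cschwartz0.
  by apply/funext => x; rewrite big_nil.
rewrite (_ : (fun x => _) = fun x => F i x + \sum_(i <- r) F i x).
  exact: cschwartzD.
by apply/funext => x; rewrite big_cons.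
Qed.

Lemma cschwartz_adjop f : cschwartz f -> cschwartz (adjop f).
Proof.
move=> sf; apply: cschwartz_sum => a; apply: cschwartzZ.
exact: cschwartz_foldr.
Qed.

Lemma sbound_foldr m s (f : V -> C) K : sbound (size s + m) f K -> sbound m (foldr cpd f s) K.
Proof.
elim: s m => [//|j s IH] m fK; apply: sbound_cpd.
by apply: IH; rewrite addnS -addSn.
Qed.

Lemma sbound_sum (I : Type) (r : seq I) (F : I -> V -> C) (K : I -> R) m :
  (forall i, csmooth (F i)) -> (forall i, sbound m (F i) (K i)) ->
  sbound m (fun x => \sum_(i <- r) F i x) (\sum_(i <- r) K i).
Proof.
move=> sF FK; elim: r => [|i r IH].
  rewrite (_ : (fun x => _) = fun=> 0); last by apply/funext => x; rewrite big_nil.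
  rewrite big_nil => s _ x; rewrite foldr_cst.
  by case: s => [|? ?]; rewrite normc0 mulr0.
rewrite (_ : (fun x => _) = fun x => F i x + \sum_(i <- r) F i x).
  by rewrite big_cons; apply: sboundD => //; exact: smooth_sum.
by apply/funext => x; rewrite big_cons.
Qed.

Lemma sbound_adjop m : exists M : nat, exists2 A : R, 0 <= A &
  forall f K, csmooth f -> sbound M f K -> sbound m (adjop f) (A * K).
Proof.
pose q := (\max_(a <- mpoly.msupp P) mpoly.mdeg a)%N.
pose b (a : mpoly.multinom n) : C := mpoly.mcoeff a P * (-1) ^+ mpoly.mdeg a.
pose r := mpoly.msupp P.
exists (q + m)%N, (\sum_(a <- r) normc (b a)).
  by apply: sumr_ge0 => a _; exact: normc_ge0.
move=> f K sf fK; rewrite mulr_suml.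
pose F a (x : V) := b a * foldr cpd f (rev (mword a)) x.
have H : forall a, a \in r -> sbound m (F a) (normc (b a) * K).
  move=> a ar; apply: sboundZ; first exact: smooth_foldr.
  apply: sbound_foldr; apply: sboundW fK.
  rewrite leq_add2r size_rev size_mword.
  exact: (leq_bigmax_seq (F := fun a => mpoly.mdeg a)).
(* [sbound_sum] asks for a bound at every index, while the degree is controlled on the support of
   [P] only; the test for membership replaces the other terms by 0. *)
have E : adjop f = fun x => \sum_(a <- r) (if a \in r then F a x else 0).
  by apply/funext => x; apply: eq_big_seq => a ->.
rewrite E (eq_big_seq (fun a => if a \in r then normc (b a) * K else 0)); last by move=> a ->.
apply: sbound_sum => a; have [ar|ar] := boolP (a \in r).
- by apply: smoothZ; exact: smooth_foldr.
- exact: smooth_cst.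
- exact: H.
- by move=> s _ x; rewrite foldr_cst; case: s => [|? ?]; rewrite normc0 mulr0.
Qed.

Lemma ctempered_adjop S : ctempered S -> ctempered (fun f => S (adjop f)).
Proof.
move=> [Sl [m [c [c0 Sb]]]]; split.
  move=> e f g sf sg; rewrite (adjop_lin e sf.1 sg.1).
  by apply: Sl; exact: cschwartz_adjop.
have [M [A A0 H]] := sbound_adjop m.
exists M, (c * A); split; first by rewrite mulr_ge0.
move=> f K sf fK; rewrite -mulrA; apply: Sb; first exact: cschwartz_adjop.
exact: H sf.1 fK.
Qed.

Lemma ctempered_iter_adjop k S : ctempered S -> ctempered (fun f => S (iter k adjop f)).
Proof.
move=> tS; elim: k => [//|k IH].
rewrite (_ : (fun f => _) = fun f => S (iter k adjop (adjop f))).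
  exact: ctempered_adjop IH.
by apply/funext => f; rewrite -iterSr.
Qed.

Lemma foldr_far (g : V -> C) A s : (forall x, A < `|x| -> g x = 0) ->
  forall x, A < `|x| -> foldr cpd g s x = 0.
Proof.
move=> g0 x xA; apply: (@foldr_eq0_open _ _ [set x : V | A < `|x - 0|]) => //=.
- exact: open_far.
- by move=> y; rewrite subr0; exact: g0.
- by rewrite subr0.
Qed.

Lemma cschwartzM_far (h1 h2 : V -> C) A : csmooth h1 -> csmooth h2 ->
  (forall x, A < `|x| -> h2 x = 0) -> cschwartz (fun x => h1 x * h2 x).
Proof.
move=> s1 s2 z2; apply: (@compact_support_cschwartz _ _ _ A); first exact: smoothM.
by move=> x /z2 ->; rewrite mulr0.
Qed.

Lemma integral_by_parts (f g : V -> C) A j : csmooth f -> csmooth g ->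
  (forall x, A < `|x| -> g x = 0) ->
  cintegral (fun x => cpd j f x * g x) = - cintegral (fun x => f x * cpd j g x).
Proof.
move=> sf sg g0.
have g0' := foldr_far [:: j] g0.
have d1 := cschwartz_cdom (cschwartzM_far (smooth_cpd j sf) sg g0).
have d2 := cschwartz_cdom (cschwartzM_far sf (smooth_cpd j sg) g0').
have d3 := cschwartzM_far sf sg g0.
apply/eqP; rewrite -subr_eq0 opprK -cintegralD//.
have [_ [K fK]] := cschwartz_cdom d3; have [_ [K' fK']] := cschwartz_cdom (cschwartz_cpd j d3).
have W0 x : 0 <= rweight x :> R.
  exact: ltW (rweight_gt0 x).
have := @cintegral_cpd R n _ j (`|K| + `|K'|) d3.1.
rewrite (cpdM j sf sg) => ->//.
- move=> x; apply: le_trans (fK x) _; rewrite ler_wpM2r//.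
  by apply: le_trans (ler_norm K) _; rewrite lerDl.
- move=> x; move: (fK' x); rewrite (cpdM j sf sg) => H; apply: le_trans H _.
  rewrite ler_wpM2r//; apply: le_trans (ler_norm K') _; by rewrite lerDr.
Qed.

(** The outermost letter is moved first and so becomes the innermost one on [g]; this is what
    reverses the word. *)
Lemma integral_word (f g : V -> C) A s : csmooth f -> csmooth g ->
  (forall x, A < `|x| -> g x = 0) ->
  cintegral (fun x => foldr cpd f s x * g x) =
  (-1) ^+ size s * cintegral (fun x => f x * foldr cpd g (rev s) x).
Proof.
move=> sf; elim: s g => [|j s IH] g sg g0; first by rewrite mul1r.
rewrite /= (integral_by_parts j (smooth_foldr s sf) sg g0) IH.
- by rewrite rev_cons foldr_rcons exprS mulN1r mulNr.
- exact: smooth_cpd.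
- exact: (foldr_far [:: j] g0).
Qed.

Lemma cintegral_sum (I : Type) (r : seq I) (F : I -> V -> C) :
  (forall i, cschwartz (F i)) ->
  cintegral (fun x => \sum_(i <- r) F i x) = \sum_(i <- r) cintegral (F i).
Proof.
move=> sF; elim: r => [|i r IH].
  rewrite big_nil (_ : (fun x => _) = fun x => 0 * (fun=> 0) x).
    by rewrite cintegralZ ?mul0r//; apply: cschwartz_cdom; exact: cschwartz0.
  by apply/funext => x; rewrite big_nil mul0r.
rewrite big_cons -IH -cintegralD.
- by congr cintegral; apply/funext => x; rewrite big_cons.
- exact: cschwartz_cdom.
- by apply: cschwartz_cdom; exact: cschwartz_sum.
Qed.

Lemma iter_adjop_far (g : V -> C) A k : (forall x, A < `|x| -> g x = 0) ->
  forall x, A < `|x| -> iter k adjop g x = 0.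
Proof.
move=> g0 x xA; apply: (@iter_adjop_eq0_open [set x : V | A < `|x - 0|]) => //=.
- exact: open_far.
- by move=> y; rewrite subr0; exact: g0.
- by rewrite subr0.
Qed.

Lemma integral_diffop (f g : V -> C) A : csmooth f -> csmooth g ->
  (forall x, A < `|x| -> g x = 0) ->
  cintegral (fun x => diffop P f x * g x) = cintegral (fun x => f x * adjop g x).
Proof.
move=> sf sg g0.
rewrite (_ : (fun x => _) = fun x => \sum_(a <- mpoly.msupp P)
    mpoly.mcoeff a P * (foldr cpd f (mword a) x * g x)); last first.
  by apply/funext => x; rewrite diffopE mulr_suml; apply: eq_bigr => a _; rewrite mulrA.
rewrite [X in _ = cintegral X](_ : _ = fun x => \sum_(a <- mpoly.msupp P)
   mpoly.mcoeff a P * (-1) ^+ mpoly.mdeg a * (f x * foldr cpd g (rev (mword a)) x)); last first.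
  by apply/funext => x; rewrite mulr_sumr; apply: eq_bigr => a _; rewrite mulrCA.
have D1 a := cschwartzM_far (smooth_foldr (mword a) sf) sg g0.
have D2 a := cschwartzM_far sf (smooth_foldr (rev (mword a)) sg) (foldr_far (rev (mword a)) g0).
rewrite !cintegral_sum.
- apply: eq_bigr => a _; rewrite !cintegralZ; [|exact: cschwartz_cdom..].
  by rewrite (integral_word _ sf sg g0) size_mword mulrA.
- by move=> a; apply: cschwartzZ; exact: D2.
- by move=> a; apply: cschwartzZ; exact: D1.
Qed.

Lemma integral_iter_diffop (f g : V -> C) A k : csmooth f -> csmooth g ->
  (forall x, A < `|x| -> g x = 0) ->
  cintegral (fun x => iter k (diffop P) f x * g x) =
  cintegral (fun x => f x * iter k adjop g x).
Proof.
move=> sf; elim: k g => [//|k IH] g sg g0.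
rewrite iterS (integral_diffop (smooth_iter_diffop k sf) sg g0) IH -?iterSr//.
  exact: smooth_adjop.
exact: (@iter_adjop_far g A 1 g0).
Qed.

Lemma symbolE (l : V) : symbol P l =
  \sum_(a <- mpoly.msupp P) mpoly.mcoeff a P * \prod_(j <- mword a) imag (l 0 j).
Proof. by rewrite /symbol mpoly.mevalE; apply: eq_bigr => a _; rewrite prod_mword. Qed.

Lemma smooth_imag_coord j : csmooth (fun l : V => imag (l 0 j) : C).
Proof.
apply: (eq_smooth _ (smoothZ (imag 1) (smooth_coord j))) => x.
by apply: complexP; rewrite ?cReM ?cImM /=; ring.
Qed.

Lemma smooth_symbol : csmooth (symbol P).
Proof.
have : csmooth (fun l : V => \sum_(a <- mpoly.msupp P)
    mpoly.mcoeff a P * \prod_(j <- mword a) imag (l 0 j) : C).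
  apply: smooth_sum => a; apply: smoothZ; apply: smooth_prod => j.
  exact: smooth_imag_coord.
by apply: eq_smooth => l; exact: symbolE.
Qed.

Lemma foldr_xmulE (u : V -> C) s x :
  foldr xmul u s x = (-1) ^+ size s * (\prod_(j <- s) imag (x 0 j) * u x).
Proof.
elim: s => [|j s IH] /=; first by rewrite big_nil !mul1r.
rewrite /xmul IH big_cons exprS.
have -> : imag (x 0 j) = imag 1 * (x 0 j)%:C%C :> C.
  by apply: complexP; rewrite ?cReM ?cImM /=; ring.
ring.
Qed.

Lemma fourier_sum (I : Type) (r : seq I) (F : I -> V -> C) l :
  (forall i, cschwartz (F i)) ->
  fourier (fun x => \sum_(i <- r) F i x) l = \sum_(i <- r) fourier (F i) l.
Proof.
move=> sF; elim: r => [|i r IH].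
  rewrite big_nil (_ : (fun x => _) = fun x => 0 * (fun=> 0) x).
    by rewrite (fourierZ 0 l (cschwartz_cdom cschwartz0)) mul0r.
  by apply/funext => x; rewrite big_nil mul0r.
have d1 := cschwartz_cdom (sF i); have d2 := cschwartz_cdom (cschwartz_sum r sF).
rewrite big_cons -IH -(fourierD l d1 d2).
rewrite (_ : (fun x => _) = fun x => F i x + \sum_(i <- r) F i x)//.
by apply/funext => x; rewrite big_cons.
Qed.

(** Under the transform each letter becomes multiplication by -i l_j. The resulting sign cancels the
    sign of the transpose, which leaves the symbol at +i l. *)
Lemma adjop_fourier (u : V -> C) : cschwartz u ->
  adjop (fourier u) = fourier (fun l => symbol P l * u l) /\
  cschwartz (fun l => symbol P l * u l).
Proof.
move=> su.
have E : (fun l => symbol P l * u l) = fun l => \sum_(a <- mpoly.msupp P)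
    (mpoly.mcoeff a P * (-1) ^+ mpoly.mdeg a) * foldr xmul u (rev (mword a)) l.
  apply/funext => l; rewrite symbolE mulr_suml; apply: eq_bigr => a _.
  rewrite foldr_xmulE size_rev size_mword -!mulrA (mulrA ((-1) ^+ _)) -exprMn.
  rewrite mulrNN mulr1 expr1n mul1r.
  by rewrite (perm_big _ (permEl (perm_rev _))).
have S a : cschwartz (fun l =>
    (mpoly.mcoeff a P * (-1) ^+ mpoly.mdeg a) * foldr xmul u (rev (mword a)) l).
  by apply: cschwartzZ; exact: (foldr_fourier (rev (mword a)) su).2.
rewrite E; split; last exact: cschwartz_sum.
apply/funext => x; rewrite fourier_sum//; apply: eq_bigr => a _.
have [F1 F2] := foldr_fourier (rev (mword a)) su.
by rewrite fourierZ ?F1//; exact: cschwartz_cdom.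
Qed.

Lemma iter_adjop_fourier (u : V -> C) k : cschwartz u ->
  iter k adjop (fourier u) = fourier (fun l => symbol P l ^+ k * u l) /\
  cschwartz (fun l => symbol P l ^+ k * u l).
Proof.
move=> su; elim: k => [|k [IH1 IH2]].
  rewrite (_ : (fun l => _) = u)//; by apply/funext => l; rewrite mul1r.
rewrite iterS IH1; have [E1 E2] := adjop_fourier IH2; rewrite E1.
have E : (fun l => symbol P l * (symbol P l ^+ k * u l)) = fun l => symbol P l ^+ k.+1 * u l.
  by apply/funext => l; rewrite exprS mulrA.
by rewrite E in E2 *.
Qed.

End Adjoint.

(** * Support and localization *)

Section Support.
Context {R : realType} {n : nat}.
Local Notation C := R[i].
Local Notation V := 'rV[R]_n.

Lemma fsupp_eq0 (f : V -> C) x : ~ fsupp f x -> f x = 0.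
Proof.
move=> nx; apply/eqP/negPn/negP => fx; apply: nx; exact: subset_closure.
Qed.

Lemma fsupp_nbhs0 (f : V -> C) (O : set V) x : open O -> O x -> (forall y, O y -> f y = 0) ->
  ~ fsupp f x.
Proof.
move=> oO Ox f0 /(_ O (open_nbhs_nbhs (conj oO Ox)))[y [/= fy Oy]].
by move: fy; rewrite f0// eqxx.
Qed.

Lemma fsupp_closed (f : V -> C) (D : set V) : closed D -> (forall x, ~ D x -> f x = 0) ->
  fsupp f `<=` D.
Proof.
move=> cD f0; rewrite /fsupp closureE => x; apply; split=> // y /= fy.
by apply: contrapT => nDy; move: fy; rewrite f0// eqxx.
Qed.

Lemma closed_box (p : V) (r : R) : closed [set x : V | `|x - p| <= r].
Proof.
apply: (@preimage_closed _ _ (fun y : V => `|y - p|) [set t | t <= r]); last exact: closed_le.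
by move=> x _; exact: dist_continuous.
Qed.

Lemma far_test_function (f : V -> C) A : csmooth f -> (forall x, A < `|x| -> f x = 0) ->
  test_function f.
Proof.
move=> sf f0; split; first exact/csmoothP.
apply: (@subclosed_compact _ _ [set x : V | `|x - 0| <= A]).
- exact: closed_closure.
- exact: compact_box.
- apply: fsupp_closed; first exact: closed_box.
  by move=> x /= /negP; rewrite subr0 -ltNge => /f0.
Qed.

Lemma compact_far (K : set V) : compact K -> exists A : R, forall x, K x -> `|x| <= A.
Proof.
move=> /compact_bounded [M [_ HM]]; exists (M + 1) => x Kx.
by apply: HM; rewrite ?ltrDl.
Qed.

Lemma test_function_far (f : V -> C) : test_function f ->
  csmooth f /\ exists A : R, forall x, A < `|x| -> f x = 0.
Proof.
move=> [sf cf]; split; first exact/csmoothP.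
have [A HA] := compact_far cf; exists A => x Ax; apply: fsupp_eq0 => /HA.
by rewrite leNgt Ax.
Qed.

(** A bump of parameter [c.1] centred at [c.2] is 1 within distance 1 / [c.1] and vanishes beyond 2
    / [c.1]. Compactness selects finitely many whose plateaus cover [K] while their supports stay in
    the prescribed neighbourhoods. *)
Lemma finite_cutoffs (K : set V) (W : V -> set V) : compact K ->
  (forall p, K p -> nbhs p (W p)) ->
  exists l : seq (R * V),
    (forall c, c \in l -> [/\ 0 < c.1, K c.2 & forall y, `|y - c.2| <= 2 / c.1 -> W c.2 y]) /\
    (forall y, K y -> exists2 c, c \in l & c.1 * `|y - c.2| < 1).
Proof.
move=> cK KW.
have /choice[a Ha] : forall p, exists a : R, 0 < a /\
    (K p -> forall y, `|y - p| <= 2 / a -> W p y).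
  move=> p; have [Kp|nKp] := pselect (K p); last by exists 1.
  have /nbhs_ballP[e /= e0 eW] := KW p Kp.
  (* The support then has radius 2 / a = e / 2, which leaves room inside the ball of radius e. *)
  exists (4 / e); split; first by rewrite divr_gt0.
  move=> _ y yp; apply: eW; rewrite -ball_normE /ball_ /= distrC.
  apply: le_lt_trans yp _; rewrite invf_div mulrCA gtr_pMr// ltr_pdivrMr//.
  by rewrite mul1r ltr_nat.
move: cK; rewrite compact_cover => /(_ V K (fun p => [set y | a p * `|y - p| < 1])).
case.
- move=> p _; apply: (@open_comp _ _ (fun y : V => a p * `|y - p|) [set t | t < 1]);
    last exact: open_lt.
  move=> y _; apply: (@cvgM _ _ (nbhs y) _ (fun=> a p) (fun y : V => `|y - p|)).
    exact: cvg_cst.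
  exact: dist_continuous.
- by move=> y Ky; exists y => //=; rewrite subrr normr0 mulr0.
move=> D' D'K KD'; exists [seq (a p, p) | p <- finmap.enum_fset D']; split.
  move=> c /mapP[p pD' ->] /=; have /D'K := pD'; rewrite inE => Kp.
  by have [a0 H] := Ha p; split => //; exact: H.
move=> y /KD'[p pD' yp]; exists (a p, p) => //.
by apply/mapP; exists p.
Qed.

(** Takes the place of a partition of unity: it is 0 wherever some bump of the list is 1, and 1
    wherever all of them vanish. *)
Definition cutprod (l : seq (R * V)) (y : V) : C := \prod_(c <- l) (1 - cutoff c.1 c.2 y).

Lemma smooth_cutprod l : csmooth (cutprod l).
Proof.
apply: smooth_prod => c; apply: smoothB; first exact: smooth_cst.
exact: smooth_cutoff.
Qed.

Lemma cutprod_cons c l y : cutprod (c :: l) y = (1 - cutoff c.1 c.2 y) * cutprod l y.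
Proof. by rewrite /cutprod big_cons. Qed.

Lemma cutprod_eq0 l y : (forall c, c \in l -> 0 < c.1) ->
  (exists2 c, c \in l & c.1 * `|y - c.2| < 1) -> cutprod l y = 0.
Proof.
move=> l0 [c cl yc]; rewrite /cutprod (big_rem c)//= cutoff_eq1 ?subrr ?mul0r//.
  exact: l0.
exact: ltW.
Qed.

Lemma cutprod_eq1 l y : (forall c, c \in l -> 0 < c.1 /\ 2 / c.1 <= `|y - c.2|) ->
  cutprod l y = 1.
Proof.
move=> H; rewrite /cutprod big_seq big1// => c cl.
by have [c0 yc] := H c cl; rewrite cutoff_eq0// subr0.
Qed.

(* Peeling off one factor at a time, phi = c phi + (1 - c) phi. *)
Lemma cutprod_vanish S l (phi : V -> C) A : ctempered S -> csmooth phi ->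
  (forall x, A < `|x| -> phi x = 0) ->
  (forall c, c \in l -> forall psi, csmooth psi -> (forall x, A < `|x| -> psi x = 0) ->
     S (fun y => cutoff c.1 c.2 y * psi y) = 0) ->
  S phi = S (fun y => cutprod l y * phi y).
Proof.
move=> tS sphi phi0; elim: l => [|c l IH] H.
  by congr S; apply/funext => y; rewrite /cutprod big_nil mul1r.
rewrite IH; last by move=> c' c'l; apply: H; rewrite inE c'l orbT.
pose psi y := cutprod l y * phi y.
have spsi : csmooth psi := smoothM (smooth_cutprod l) sphi.
have psi0 x : A < `|x| -> psi x = 0 by move=> /phi0; rewrite /psi => ->; rewrite mulr0.
have E : psi = fun y => cutoff c.1 c.2 y * psi y + (cutprod (c :: l) y * phi y).
  by apply/funext => y; rewrite cutprod_cons /psi; ring.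
rewrite -/psi [in LHS]E ctemperedD//.
- by rewrite H ?add0r// inE eqxx.
- exact: cschwartzM_far (smooth_cutoff _ _) spsi psi0.
- exact: cschwartzM_far (smooth_cutprod _) sphi phi0.
Qed.

(** The support of [phi] is covered by finitely many bumps, each inside an open set on which S
    vanishes. Removing these bumps does not change the value of S, and what remains of [phi] is
    0. *)
Lemma dist_supp_vanish S (phi : V -> C) : ctempered S -> test_function phi ->
  (forall y, fsupp phi y -> ~ dist_supp S y) -> S phi = 0.
Proof.
move=> tS tphi H; have [sphi [A phi0]] := test_function_far tphi.
have /choice[U HU] : forall p, exists U : set V, fsupp phi p ->
    [/\ open U, vanishes_on S U & U p].
  move=> p; have [sp|nsp] := pselect (fsupp phi p); last by exists setT.
  have /contrapT[U [oU vU] Up] := H p sp.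
  by exists U.
have [l [l1 l2]] := @finite_cutoffs (fsupp phi) U tphi.2 (fun p sp =>
  let: And3 oU _ Up := HU p sp in open_nbhs_nbhs (conj oU Up)).
rewrite (cutprod_vanish (l := l) tS sphi phi0).
  rewrite (_ : (fun y => _) = fun=> 0); first exact: ctempered0.
  apply/funext => y; have [sy|nsy] := pselect (fsupp phi y).
    by rewrite cutprod_eq0 ?mul0r//; [move=> c /l1[]|exact: l2].
  by rewrite (fsupp_eq0 nsy) mulr0.
move=> c cl psi spsi psi0; have [c0 sc cU] := l1 c cl; have [_ vU _] := HU _ sc.
apply: vU.
  apply: (@far_test_function _ A); first exact: smoothM (smooth_cutoff _ _) spsi.
  by move=> x /psi0 ->; rewrite mulr0.
apply: (@subset_trans _ [set y | `|y - c.2| <= 2 / c.1]); last by move=> y; exact: cU.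
apply: fsupp_closed; first exact: closed_box.
by move=> y /= /negP; rewrite -ltNge => /ltW yc; rewrite cutoff_eq0 ?mul0r.
Qed.

(** Here [psi] is 1 - [cutprod], equal to 1 near the support. The rest, [cutprod] times [h],
    vanishes near the support but need not be compactly supported, so it is first cut off and then
    removed by density. *)
Lemma dist_supp_localize S (O : set V) : ctempered S -> compact (dist_supp S) -> open O ->
  dist_supp S `<=` O ->
  exists psi : V -> C, [/\ csmooth psi, exists A : R, forall x, A < `|x| -> psi x = 0,
    forall x, ~ O x -> psi x = 0 &
    forall h, cschwartz h -> S h = S (fun x => psi x * h x)].
Proof.
move=> tS cK oO KO.
have [l [l1 l2]] := @finite_cutoffs (dist_supp S) (fun=> O) cK
  (fun p Kp => open_nbhs_nbhs (conj oO (KO p Kp))).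
pose psi y : C := 1 - cutprod l y.
have spsi : csmooth psi by apply: smoothB (smooth_cst _) (smooth_cutprod l).
have l0 c : c \in l -> 0 < c.1 by case/l1.
(* A sum in place of a maximum: it bounds the distance from 0 reached by each bump in the list. *)
pose A := \sum_(c <- l) (2 / c.1 + `|c.2|).
have psi0 x : A < `|x| -> psi x = 0.
  move=> Ax; rewrite /psi cutprod_eq1 ?subrr// => c cl; split; first exact: l0.
  have cA : 2 / c.1 + `|c.2| <= A.
    rewrite /A (big_rem c)//= lerDl big_seq; apply: sumr_ge0 => c' c'l.
    by rewrite addr_ge0// divr_ge0// ltW// l0// (mem_rem c'l).
  by apply: le_trans (lerB_dist x c.2); rewrite lerBrDr; exact: le_trans cA (ltW Ax).
exists psi; split => //; first by exists A.
  move=> x nOx; rewrite /psi cutprod_eq1 ?subrr// => c cl; have [c0 _ cO] := l1 c cl.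
  split => //; rewrite leNgt; apply/negP => /ltW xc; exact/nOx/cO.
move=> h sh; have sph : cschwartz (fun x => psi x * h x).
  rewrite (_ : (fun x => _) = fun x => h x * psi x); last by apply/funext => x; rewrite mulrC.
  exact: cschwartzM_far sh.1 spsi psi0.
have E : (fun x => cutprod l x * h x) = fun x => h x + -1 * (psi x * h x).
  by apply/funext => x; rewrite /psi; ring.
have sch : cschwartz (fun x => cutprod l x * h x).
  by rewrite E; apply: cschwartzD sh (cschwartzZ _ sph).
have Eh : h = fun x => cutprod l x * h x + psi x * h x.
  by apply/funext => x; rewrite /psi; ring.
rewrite [in LHS]Eh ctemperedD// (ctempered_density tS sch) ?add0r// => a a0 a1.
apply: dist_supp_vanish tS _ _.
  apply: (@far_test_function _ (2 / a)); first exact: smoothM (smooth_cutoff _ _) sch.1.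
  by move=> x /ltW xa; rewrite cutoff_eq0 ?mul0r// subr0.
move=> y; apply: contraPnot => Ky; have [c cl yc] := l2 y Ky.
apply: (@fsupp_nbhs0 _ [set y : V | c.1 * `|y - c.2| < 1]) => //.
  apply: (@open_comp _ _ (fun y : V => c.1 * `|y - c.2|) [set t | t < 1]); last exact: open_lt.
  move=> x _; apply: (@cvgM _ _ (nbhs x) _ (fun=> c.1) (fun y : V => `|y - c.2|)).
    exact: cvg_cst.
  exact: dist_continuous.
move=> x /= xc; rewrite cutprod_eq0 ?mul0r ?mulr0//.
by exists c.
Qed.

End Support.

(** * Lower bound for the growth *)

(* Bernoulli's inequality gives [t (k + 1) <= (1 + t) ^ k], and [t] is chosen so that
   [(1 + t) ^ M * q < 1]. *)
Lemma poly_geometric (R : realType) (x c q : R) (M : nat) : 0 <= c -> 0 <= q -> q < 1 ->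
  (forall k, (0 < k)%N -> x <= c * k.+1%:R ^+ M * q ^+ k) -> x <= 0.
Proof.
move=> c0 q0 q1 H.
(* This gives t M <= (1 - q) / 2, hence (1 - t)^M >= (1 + q) / 2 by Bernoulli. As (1 + t) (1 - t) <=
   1, it follows that (1 + t)^M (1 + q) / 2 <= 1, and q < (1 + q) / 2. *)
pose t := (1 - q) / (2 * M.+1%:R).
have M0 : 0 < 2 * M.+1%:R :> R by rewrite mulr_gt0.
have t0 : 0 < t by rewrite divr_gt0// subr_gt0.
have tM : t * M%:R <= (1 - q) / 2.
  rewrite /t invfM mulrA -mulrA ler_piMr// ?divr_ge0// ?subr_ge0 ?ltW//.
  by rewrite mulrC ltr_pdivrMr// mul1r ltr_nat.
have t1 : t <= 1.
  rewrite /t ler_pdivrMr// mul1r (@le_trans _ _ 1)//; first by rewrite gerBl.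
  by rewrite -natrM ler1n muln_gt0.
have B1 (j : nat) : 1 - t * j%:R <= (1 - t) ^+ j.
  elim: j => [|j IH]; first by rewrite mulr0 subr0.
  rewrite exprS; apply: le_trans (ler_wpM2l _ IH); last by rewrite subr_ge0.
  rewrite -natr1 mulrDr mulr1 mulrBl mul1r mulrBr mulr1 opprB.
  have := mulr_ge0 (ltW t0) (mulr_ge0 (ltW t0) (ler0n R j)).
  lra.
have B2 (j : nat) : 1 + t * j%:R <= (1 + t) ^+ j.
  elim: j => [|j IH]; first by rewrite mulr0 addr0.
  rewrite exprS; apply: le_trans (ler_wpM2l _ IH); last by rewrite addr_ge0// ltW.
  rewrite -natr1 mulrDr mulr1 mulrDl mul1r mulrDr mulr1.
  have := mulr_ge0 (ltW t0) (mulr_ge0 (ltW t0) (ler0n R j)).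
  lra.
have T1 : 0 < 1 + t by rewrite ltr_pwDl// ltW.
pose q' := (1 + t) ^+ M * q.
have q'0 : 0 <= q' by rewrite mulr_ge0// exprn_ge0// ltW.
have q'1 : q' < 1.
  have h : (1 + t) ^+ M * ((1 + q) / 2) <= 1.
    apply: (@le_trans _ _ ((1 + t) ^+ M * (1 - t) ^+ M)).
      rewrite ler_wpM2l ?exprn_ge0 ?(ltW T1)//; apply: le_trans (B1 M); lra.
    rewrite -exprMn; apply: exprn_ile1.
      by apply: mulr_ge0; [exact: ltW|rewrite subr_ge0].
    rewrite (_ : (1 + t) * (1 - t) = 1 - t ^+ 2); last by ring.
    by rewrite gerBl sqr_ge0.
  apply: lt_le_trans h; rewrite ltr_pM2l ?exprn_gt0//; lra.
have H' k : (0 < k)%N -> x <= c * t^-1 ^+ M * q' ^+ k.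
  move=> k0; apply: le_trans (H k k0) _.
  rewrite /q' exprMn !mulrA ler_wpM2r ?exprn_ge0// -!mulrA ler_wpM2l//.
  rewrite -exprM mulnC exprM -exprMn lerXn2r ?nnegrE ?mulr_ge0 ?invr_ge0//;
    rewrite ?exprn_ge0 ?(ltW t0) ?(ltW T1)//.
  rewrite mulrC ler_pdivlMr//; apply: le_trans (B2 k).
  by rewrite -natr1 mulrC mulrDr mulr1 addrC lerD2r.
have c't : 0 <= c * t^-1 ^+ M by rewrite mulr_ge0// exprn_ge0// invr_ge0 ltW.
have : geometric (c * t^-1 ^+ M) q' @ \oo --> (0 : R).
  by apply: cvg_geometric; rewrite ger0_norm.
move=> cv; rewrite leNgt; apply/negP => x0.
have [K _ HK] := cvgr_lt 0 cv x x0.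
have /= := HK K.+1 (leqnSn K); apply/negP; rewrite -leNgt; exact: H'.
Qed.

(** * Seminorms of powers times a localized factor *)

Section PowerBounds.
Context {R : realType} {n : nat}.
Local Notation C := R[i].
Local Notation V := 'rV[R]_n.

Lemma box_deriv_bound (p : V -> C) m A : csmooth p -> exists K : R,
  forall s, (size s <= m)%N -> forall x, `|x| <= A -> normc (foldr cpd p s x) <= K.
Proof.
move=> sp.
(* The indicator of the box serves as weight, so that bounds on the box fall under the general
   statement. *)
have [||K HK] := @words_bound R n csmooth (fun x => if `|x| <= A then 1 else 0) _ _ m p sp.
- move=> f sf; have [K fK] := ccontinuous_bounded_box A (smooth_cont sf).
  exists `|K| => x; have [xA|] := boolP (`|x| <= A); last by rewrite mul0r.
  by rewrite mul1r; apply: le_trans (fK x xA) (ler_norm _).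
- by move=> f j; exact: smooth_cpd.
by exists K => s sm x xA; have := HK s sm x; rewrite xA mul1r.
Qed.

Lemma continuous_normc (p : V -> C) : csmooth p -> continuous (fun x => normc (p x)).
Proof.
move=> /smooth_cont[cr ci] x.
pose q x := complex.Re (p x) * complex.Re (p x) + complex.Im (p x) * complex.Im (p x).
rewrite (_ : (fun x => normc (p x)) = fun x => Num.sqrt (q x)).
  apply: (@continuous_comp _ _ _ q Num.sqrt); last exact: sqrt_continuous.
  exact: (continuousRD (continuousRM cr cr) (continuousRM ci ci)).
by apply/funext => y; rewrite /q; case: (p y) => a b; rewrite /= !expr2.
Qed.

Lemma open_normc_gt (p : V -> C) (r : R) : csmooth p -> open [set x | r < normc (p x)].
Proof.
move=> sp; apply: (@open_comp _ _ (fun x => normc (p x)) [set t | r < t]); last exact: open_gt.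
by move=> x _; exact: continuous_normc.
Qed.

Lemma open_normc_lt (p : V -> C) (r : R) : csmooth p -> open [set x | normc (p x) < r].
Proof.
move=> sp; apply: (@open_comp _ _ (fun x => normc (p x)) [set t | t < r]); last exact: open_lt.
by move=> x _; exact: continuous_normc.
Qed.

(** Beyond [A], and where |p| > r, the product vanishes on an open set together with its
    derivatives. On the remaining region [power_bound] applies and the weight is at most (1 +
    |A|)^m; therefore bounds on [w] without weight are enough. *)
Lemma power_sbound (m : nat) (p : V -> C) (A r : R) : csmooth p -> 0 < r ->
  exists2 c : R, 0 <= c & forall (w : V -> C) (k : nat) (B : R),
    csmooth w -> (forall x, A < `|x| -> w x = 0) ->
    (forall x, r < normc (p x) -> w x = 0) -> 0 <= B ->
    (forall s, (size s <= m)%N -> forall x, normc (foldr cpd w s x) <= B) ->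
    sbound m (fun x => p x ^+ k * w x) (c * k.+1%:R ^+ m * r ^+ k * B).
Proof.
move=> sp r0; have [Ap HAp] := box_deriv_bound m A sp.
have [c c0 Hc] := @power_bound R n m Ap r r0.
exists ((1 + `|A|) ^+ m * c); first by rewrite mulr_ge0// exprn_ge0// addr_ge0.
move=> w k B sw wA wr B0 wB s sm x.
have N0 : 0 <= (1 + `|A|) ^+ m * c * k.+1%:R ^+ m * r ^+ k * B.
  by rewrite !mulr_ge0// ?exprn_ge0// ?addr_ge0// ltW.
have [xA|xA] := leP `|x| A; last first.
  rewrite (@foldr_far _ _ _ A)// ?normc0 ?mulr0// => y /wA ->.
  by rewrite mulr0.
have [px|px] := leP (normc (p x)) r; last first.
  rewrite (@foldr_eq0_open _ _ _ _ _ (@open_normc_gt p r sp))//.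
    by rewrite normc0 mulr0.
  by move=> y /= /wr ->; rewrite mulr0.
rewrite -!mulrA; apply: ler_pM; rewrite ?norm1X_ge0 ?normc_ge0//.
  rewrite lerXn2r ?nnegrE ?addr_ge0// lerD2l; exact: le_trans xA (ler_norm _).
rewrite !mulrA; apply: (Hc p w x B k sp sw px _ _ s sm).
  by move=> s' sm'; exact: HAp.
by move=> s' sm'; exact: wB.
Qed.

Lemma enorm_le (x : V) : enorm x <= n%:R * `|x|.
Proof.
rewrite -[leRHS]ger0_norm ?mulr_ge0// -sqrtr_sqr; apply: ler_wsqrtr.
apply: le_trans (ler_norm _) _; apply: le_trans (dotp_le x x) _.
rewrite exprMn -mulrA -expr2 ler_wpM2r ?sqr_ge0//.
by rewrite -natrX ler_nat -mulnn; case: (posnP n) => [->//|n0]; rewrite leq_pmull.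
Qed.

Lemma norm_le_enorm (x : V) : `|x| <= enorm x.
Proof.
apply: norm_le_coord; first exact: sqrtr_ge0.
move=> j; rewrite -sqrtr_sqr; apply: ler_wsqrtr; rewrite /dotp (bigD1 j)//= expr2 lerDl.
by apply: sumr_ge0 => i _; rewrite -expr2 sqr_ge0.
Qed.

End PowerBounds.

(** * Vanishing of the Fourier transform where the symbol exceeds the growth rate *)

Section LowerBound.
Context {R : realType} {n : nat}.
Local Notation C := R[i].
Local Notation V := 'rV[R]_n.
Variables (P : mpoly.mpoly n C) (f : V -> C) (T : (V -> C) -> C).
Hypotheses (sf : csmooth f) (tT : ctempered T) (eT : extends_function f T).

(** The one point of contact between [T] and [f]: the iterated transpose does not enlarge the
    support, so [T] is evaluated at a test function. *)
Lemma T_iter_adjop k g A : csmooth g -> (forall x, A < `|x| -> g x = 0) ->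
  T (iter k (adjop P) g) = cintegral (fun x => iter k (diffop P) f x * g x).
Proof.
move=> sg g0; rewrite (integral_iter_diffop P k sf sg g0); apply: eT.
by apply: (@far_test_function _ _ _ A); [exact: smooth_iter_adjop|exact: iter_adjop_far].
Qed.

(** For a Schwartz [h] the integral formula is available only after a cutoff. The resulting bound
    does not involve the scale [a], and letting [a] tend to 0 removes the error, whose constant may
    depend on [k] and [h]. *)
Lemma adjop_power_bound (r : R) (N : nat) (c : R) : 0 <= r -> 0 <= c ->
  (forall (k : nat) x, (0 < k)%N -> normc (iter k (diffop P) f x) <=
     c * k%:R ^+ N * r ^+ k * (1 + enorm x) ^+ N) ->
  exists M : nat, exists2 c' : R, 0 <= c' & forall (k : nat) h K, (0 < k)%N ->
    cschwartz h -> sbound M h K ->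
    normc (T (iter k (adjop P) h)) <= c' * k%:R ^+ N * r ^+ k * K.
Proof.
move=> r0 c0 H.
pose W : R := \int[lebesgue_tuple R n]_t weight t.
have W0 : 0 <= W.
  by apply: Rintegral_ge0 => t _; rewrite -rweight_trow ltW// rweight_gt0.
(* [N] absorbs the growth of the integrand and [n.*2] makes it integrable. The power of [n.+1] comes
   from 1 + [enorm x] <= (n + 1) (1 + |x|), and the 2 from [cintegral_le_weight]. *)
exists (N + n.*2)%N, (2 * W * (c * n.+1%:R ^+ N)); first by rewrite !mulr_ge0// exprn_ge0.
move=> k h K k0 sh hK; have K0 := sbound_ge0 hK.
have [A A0 HA] := ctempered_cutoff (ctempered_iter_adjop P k tT) sh.
set b := (X in _ <= X).
rewrite -subr_le0; apply: (cvg0_le A0) => a a0 a1.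
rewrite lerBlDl; apply: le_trans (lerD (lexx b) (HA a a0 a1)).
rewrite -lerBlDr.
set z := T (iter k _ _); set z' := T (iter k _ _).
apply: (@le_trans _ _ (normc z')).
  by rewrite lerBlDl; apply: le_trans (normcD _ _); rewrite subrK.
rewrite /z' (@T_iter_adjop k _ (2 / a)); last 2 first.
- exact: smoothM (smooth_cutoff a 0) sh.1.
- by move=> x /ltW xa; rewrite cutoff_eq0 ?mul0r// subr0.
pose B := c * k%:R ^+ N * r ^+ k * n.+1%:R ^+ N * K.
have -> : b = 2 * B * W by rewrite /b /B; ring.
apply: cintegral_le_weight.
  apply: ccontinuousM; first exact: smooth_cont (smooth_iter_diffop P k sf).
  exact: smooth_cont (smoothM (smooth_cutoff a 0) sh.1).
apply: norm1_le_rweight => x.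
have N1 : (1 + enorm x) ^+ N <= n.+1%:R ^+ N * (1 + `|x|) ^+ N.
  rewrite -exprMn lerXn2r ?nnegrE ?mulr_ge0 ?addr_ge0 ?sqrtr_ge0//.
  have := enorm_le x; have := normr_ge0 x; have : 0 <= n%:R :> R by [].
  rewrite -natr1; nra.
have C1 : normc (cutoff a 0 x) <= 1.
  rewrite /cutoff normc_real ger0_norm ?bumpprod_ge0//.
  by rewrite bumpprodE boxbump_le1.
have hx := hK [::] (leq0n _) x; rewrite /= exprD in hx.
rewrite !normcM /B.
apply: (@le_trans _ _ ((1 + `|x|) ^+ n.*2 *
    ((c * k%:R ^+ N * r ^+ k * (n.+1%:R ^+ N * (1 + `|x|) ^+ N)) * (1 * normc (h x))))).
  rewrite ler_wpM2l ?norm1X_ge0// ler_pM ?mulr_ge0 ?normc_ge0//.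
    by apply: le_trans (H k x k0) _; rewrite ler_wpM2l// !mulr_ge0// exprn_ge0.
  by rewrite ler_wpM2r ?normc_ge0.
rewrite [leLHS](_ : _ = c * k%:R ^+ N * r ^+ k * n.+1%:R ^+ N *
  ((1 + `|x|) ^+ N * (1 + `|x|) ^+ n.*2 * normc (h x))); last by ring.
by rewrite ler_wpM2l// !mulr_ge0// exprn_ge0.
Qed.

(* [flat 0] vanishes exactly on the nonpositive reals, so the denominator below is
   [|p|^2] where [|p| >= r] and never 0. *)
Lemma local_inverse (p : V -> C) (r : R) : csmooth p -> 0 < r ->
  exists2 a : V -> C, csmooth a & forall x, r <= normc (p x) -> a x * p x = 1.
Proof.
move=> sp r0; have /csmoothE Cp := sp.
pose q x := complex.Re (p x) * complex.Re (p x) + complex.Im (p x) * complex.Im (p x).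
have Cq m : Cn dir m q by have [cr ci] := Cp m; apply: CnD; exact: CnM.
have q0 x : 0 <= q x by rewrite addr_ge0// -expr2 sqr_ge0.
pose d x := q x + flat 0 (r ^+ 2 - q x).
have Cd m : Cn dir m d.
  by apply: CnD => //; apply: Cn_flat; apply: CnB => //; exact: Cn_cst.
have d0 x : d x != 0.
  apply: lt0r_neq0; have [qr|qr] := ltP (q x) (r ^+ 2).
    by rewrite ltr_wpDl// flat0_gt0// subr_gt0.
  by rewrite ltr_pwDl ?flat_ge0//; apply: lt_le_trans qr; rewrite exprn_gt0.
exists (fun x => ((d x)^-1)%:C%C * (p x)^*%C).
  apply: smoothM (smooth_conj sp); apply: smooth_real => m.
  exact: CnV.
have qE x : q x = normc (p x) ^+ 2.
  rewrite /q; case: (p x) => a b /=; rewrite sqr_sqrtr ?addr_ge0 ?sqr_ge0//.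
move=> x px; have dq : d x = q x.
  rewrite /d flat_npos ?addr0// subr_le0 qE lerXn2r ?nnegrE ?(ltW r0)//.
  exact: normc_ge0.
rewrite -mulrA (_ : _ * p x = (q x)%:C%C); last first.
  by rewrite /q; case: (p x) => a b; apply: complexP; rewrite ?cReM ?cImM /=; ring.
by rewrite -dq -rmorphM /= mulVf.
Qed.

(** Since phi = p^k (a^k phi) for every [k], the fixed number S(phi) gets a bound for each [k]. The
    polynomial factor in these bounds collects [N] from the growth of [f] and [M'] from
    differentiating a^k. *)
Lemma fourier_vanishes (r r' : R) (N : nat) (c : R) : 0 <= r -> r < r' -> 0 <= c ->
  (forall (k : nat) x, (0 < k)%N -> normc (iter k (diffop P) f x) <=
     c * k%:R ^+ N * r ^+ k * (1 + enorm x) ^+ N) ->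
  vanishes_on (dist_fourier T) [set l | r' < normc (symbol P l)].
Proof.
move=> r0 rr' c0 H phi tphi phiU; have r'0 : 0 < r' := le_lt_trans r0 rr'.
have [sphi [A phi0]] := test_function_far tphi.
have ss := @smooth_symbol _ _ P.
have [a sa aE] := local_inverse ss r'0.
have phiE l : phi l != 0 -> r' < normc (symbol P l).
  move=> nz; apply: phiU; exact: subset_closure.
have [M [c1 c10 H1]] := adjop_power_bound r0 c0 H.
have [M' [c2 c20 H2]] := @fourier_sbound R n M.
have ir0 : 0 < r'^-1 by rewrite invr_gt0.
have [c3 c30 H3] := power_sbound M' A sa ir0.
have scphi : cschwartz phi := compact_support_cschwartz sphi phi0.
have [B phiB] := scphi.2 M'; have B0 := sbound_ge0 phiB.
have su k : csmooth (fun l => a l ^+ k * phi l) := smoothM (smoothX k sa) sphi.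
have scu k : cschwartz (fun l => a l ^+ k * phi l).
  exact: cschwartzM_far (smoothX k sa) sphi phi0.
have E k : fourier phi = iter k (adjop P) (fourier (fun l => a l ^+ k * phi l)).
  have [-> _] := iter_adjop_fourier P k (scu k).
  congr fourier; apply/funext => l; have [->|nz] := eqVneq (phi l) 0; first by rewrite !mulr0.
  by rewrite mulrA -exprMn mulrC [symbol P l * a l]mulrC aE ?expr1n ?mulr1// ltW// phiE.
apply/eqP; rewrite -normc_eq0 eq_le normc_ge0 andbT.
have q0 : 0 <= r / r' by rewrite divr_ge0// ltW.
have q1 : r / r' < 1 by rewrite ltr_pdivrMr// mul1r.
apply: (@poly_geometric R _ (c1 * (c2 * (c3 * B))) (r / r') (N + M')) => //.
  by rewrite !mulr_ge0.
move=> k k0; rewrite /dist_fourier (E k).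
have F3 := H3 phi k B sphi phi0.
have {}F3 : sbound M' (fun l => a l ^+ k * phi l) (c3 * k.+1%:R ^+ M' * r'^-1 ^+ k * B).
  apply: F3 => //.
  (* Where [phi] is nonzero, |a| = 1 / |p| < 1 / r'; so |a| exceeds 1 / r' only at zeros of
     [phi]. *)
  - move=> l al; apply/eqP/negPn/negP => /phiE pl.
    have /(congr1 (fun z : C => normc z)) := aE l (ltW pl).
    rewrite normcM ComplexField.Normc.normc1 => e1.
    have pl0 : 0 < normc (symbol P l) := lt_trans r'0 pl.
    have : 1 < normc (a l) * normc (symbol P l).
      by rewrite -ltr_pdivrMr// div1r; apply: lt_trans al; rewrite ltf_pV2.
    by rewrite e1 ltxx.
  - move=> s sm x; apply: le_trans (phiB s sm x).
    by rewrite ler_peMl ?normc_ge0 ?norm1X_ge1.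
have F2 := H2 _ _ (scu k) F3.
apply: le_trans (H1 k _ _ k0 (cschwartz_fourier (scu k)) F2) _.
rewrite (_ : c1 * _ * _ * _ = (c1 * (c2 * (c3 * B))) *
  (k%:R ^+ N * k.+1%:R ^+ M' * (r ^+ k * r'^-1 ^+ k))); last by ring.
rewrite -[leRHS]mulrA; apply: ler_wpM2l; first by rewrite !mulr_ge0.
rewrite exprMn; apply: ler_wpM2r; first by rewrite mulr_ge0// exprn_ge0// ltW.
rewrite exprD ler_wpM2r ?exprn_ge0// lerXn2r ?nnegrE//.
by rewrite ler_nat.
Qed.

Lemma symbol_le_growth (r : R) (N : nat) (c : R) : 0 <= r -> 0 <= c ->
  (forall (k : nat) x, (0 < k)%N -> normc (iter k (diffop P) f x) <=
     c * k%:R ^+ N * r ^+ k * (1 + enorm x) ^+ N) ->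
  forall l, dist_supp (dist_fourier T) l -> normc (symbol P l) <= r.
Proof.
move=> r0 c0 H l Kl; rewrite leNgt; apply/negP => rl.
(* A level strictly in between: the ratio r / r' has to be less than 1, and the set above the level
   has to be a neighbourhood of [l]. *)
pose r' := (r + normc (symbol P l)) / 2.
have rr' : r < r' by rewrite /r'; lra.
have r'l : r' < normc (symbol P l) by rewrite /r'; lra.
apply: Kl; exists [set l | r' < normc (symbol P l)] => //; split.
  exact: open_normc_gt (@smooth_symbol _ _ P).
exact: fourier_vanishes r0 rr' c0 H.
Qed.

End LowerBound.

(** * Upper bound for the growth *)

Section Mollifier.
Context {R : realType} {n : nat}.
Local Notation C := R[i].
Local Notation V := 'rV[R]_n.

Definition bumpmass (a : R) (p : V) : R := \int[lebesgue_tuple R n]_t bumpprod a p (trow t).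

(** Its value is 1, since [cfourier] is (2 pi)^(-n/2). It is carried along in this form and divided
    out in [antifourier]. *)
Definition inversion_cst : C := (((@cfourier R n) ^+ 2 * (2 * pi) ^+ n)%:C)%C.

Lemma inversion_cst_neq0 : inversion_cst != 0.
Proof.
have : 0 < (@cfourier R n) ^+ 2 * (2 * pi) ^+ n.
  by rewrite mulr_gt0// exprn_gt0// ?cfourier_gt0// mulr_gt0// pi_gt0.
rewrite -normc_eq0 normc_real => h; by rewrite gtr0_norm// lt0r_neq0.
Qed.

Lemma cschwartz_cutoff a (p : V) : 0 < a -> cschwartz (cutoff a p).
Proof. by move=> a0; exact: cschwartz_bumpprod. Qed.

Lemma integrable_bumpprod a (p : V) : 0 < a ->
  (lebesgue_tuple R n).-integrable setT (EFin \o (fun t => bumpprod a p (trow t))).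
Proof. by move=> a0; exact: (cdom_integrable (cschwartz_cdom (cschwartz_cutoff p a0))).1. Qed.

Lemma integrable_cstM_bumpprod c a (p : V) : 0 < a ->
  (lebesgue_tuple R n).-integrable setT (EFin \o (fun t => c * bumpprod a p (trow t))).
Proof.
move=> a0; have d := cdomZ c%:C%C (cschwartz_cdom (cschwartz_cutoff p a0)).
have := (cdom_integrable d).1.
by under eq_fun do rewrite cReZ.
Qed.

Lemma cintegral_le_bumpprod (h : V -> C) c a (p : V) : 0 < a -> cdom h ->
  (forall x, normc (h x) <= c * bumpprod a p x) ->
  normc (cintegral h) <= 2 * c * bumpmass a p.
Proof.
move=> a0 dh hc.
apply: le_trans (cintegral_le dh hc (integrable_cstM_bumpprod c p a0)) _.
by rewrite RintegralZl ?mulrA//; exact: integrable_bumpprod.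
Qed.

Lemma cintegral_cutoff a (p : V) : 0 < a -> cintegral (cutoff a p) = (bumpmass a p)%:C%C.
Proof.
move=> a0; rewrite cintegralE; apply: complexP => //=.
by rewrite Rintegral_cst// mul0r.
Qed.

(* A bump of mass 0 would have a vanishing Fourier transform, against inversion. *)
Lemma bumpmass_gt0 a (p : V) : 0 < a -> 0 < bumpmass a p.
Proof.
move=> a0; rewrite lt0r; apply/andP; split; last first.
  by apply: Rintegral_ge0 => t _; exact: bumpprod_ge0.
apply/negP => /eqP m0.
have F0 l : fourier (cutoff a p) l = 0.
  have d := cdom_wave l (cschwartz_cdom (cschwartz_cutoff p a0)).
  have := @cintegral_le_bumpprod _ 1 a p a0 d.
  rewrite m0 mulr0 => H.
  rewrite fourierE (_ : cintegral _ = 0) ?mulr0//.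
  apply/eqP; rewrite -normc_eq0 eq_le normc_ge0 andbT; apply: H => x.
  by rewrite normcM normc_wave mulr1 mul1r /cutoff normc_real ger0_norm// bumpprod_ge0.
have := fourier_inversion_bumpprod p a0 p.
rewrite (_ : (fun l => _) = fun l : V => 0 * (fun=> 0) l); last first.
  by apply/funext => l; rewrite mul0r; exact: F0.
rewrite (fourierZ 0 p (cschwartz_cdom cschwartz0)) mul0r.
rewrite -/(cutoff a p p) cutoff_eq1// ?subrr ?normr0 ?mulr0// mulr1 => /esym/eqP.
by apply/negP; exact: inversion_cst_neq0.
Qed.

(** Averages of [h] over shrinking bumps approach the value at [x] by continuity. The oscillation is
    taken below e / 2 because [cintegral_le_bumpprod] loses a factor 2. *)
Lemma mollifier_bound (h : V -> C) x M : csmooth h ->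
  (forall a, 2 <= a -> normc (cintegral (fun y => h y * cutoff a x y)) <= M * bumpmass a x) ->
  normc (h x) <= M.
Proof.
move=> sh H; apply/ler_addgt0Pr => e e0.
have ch : continuous (fun y => normc (h y - h x)).
  by apply: continuous_normc; apply: smoothB sh (smooth_cst _).
have /nbhs_ballP[d /= d0 dh] : nbhs x [set y | normc (h y - h x) < e / 2].
  have := ch x; rewrite /continuous_at subrr normc0.
  by move=> /(_ [set t | t < e / 2]); apply; apply: lt_nbhsl; rewrite divr_gt0.
(* The 4 / d puts the support of the bump, of radius 2 / a, within distance d of [x]; the 2 makes
   the hypothesis on averages applicable. *)
pose a := Num.max 2 (4 / d).
have a2 : 2 <= a by rewrite le_max lexx.
have a0 : 0 < a by apply: lt_le_trans a2.
have ad : 2 / a < d.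
  rewrite ltr_pdivrMr//; have : 4 / d <= a by rewrite le_max lexx orbT.
  rewrite ler_pdivrMr// => h4; nra.
have I0 := bumpmass_gt0 x a0.
have scut := smooth_cutoff a x.
have far : forall y, 2 / a + `|x| < `|y| -> cutoff a x y = 0.
  move=> y ya; rewrite cutoff_eq0//; apply: le_trans (lerB_dist y x).
  by rewrite lerBrDr ltW.
have d1 := cschwartz_cdom (cschwartzM_far (smoothB sh (smooth_cst (h x))) scut far).
have d2 := cschwartz_cdom (cschwartz_cutoff x a0).
have E : cintegral (fun y => h y * cutoff a x y) =
    cintegral (fun y => (h y - h x) * cutoff a x y) + h x * (bumpmass a x)%:C%C.
  rewrite -cintegral_cutoff// -(cintegralZ _ d2) -(cintegralD d1 (cdomZ _ d2)).
  by congr cintegral; apply/funext => y; ring.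
have B : normc (cintegral (fun y => (h y - h x) * cutoff a x y)) <= 2 * (e / 2) * bumpmass a x.
  apply: cintegral_le_bumpprod => // y; rewrite normcM.
  have -> : normc (cutoff a x y) = bumpprod a x y.
    by rewrite /cutoff normc_real ger0_norm// bumpprod_ge0.
  have [yx|yx] := ltP `|y - x| d.
    rewrite ler_wpM2r ?bumpprod_ge0// ltW//; apply: (dh y).
    by rewrite -ball_normE /ball_ /= distrC.
  rewrite (@bumpprod_eq0 _ _ a x a0 y) ?mulr0//.
  exact: le_trans (ltW ad) yx.
have Ha := H a a2.
rewrite -(ler_pM2r I0) mulrDl.
have -> : normc (h x) * bumpmass a x = normc (h x * (bumpmass a x)%:C%C).
  by rewrite normcM normc_real gtr0_norm.
have -> : h x * (bumpmass a x)%:C%C = cintegral (fun y => h y * cutoff a x y)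
   - cintegral (fun y => (h y - h x) * cutoff a x y) by rewrite E addrC addKr.
apply: le_trans (normcB _ _) _; apply: lerD Ha _.
by apply: le_trans B _; rewrite mulrCA divff ?mulr1.
Qed.

Lemma cschwartz_opp (h : V -> C) : cschwartz h -> cschwartz (fun l => h (- l)).
Proof.
have E : (fun l => h (- l)) = fun l => h ((-1) *: l + 0).
  by apply/funext => l; rewrite scaleN1r addr0.
move=> [sh hb]; split; first by rewrite E; exact: smooth_affine.
move=> m; have [K hK] := hb m; exists K => s sm l.
rewrite E (@foldr_affine _ _ h)// normcM normcX normc_real normrN normr1 expr1n mul1r.
by rewrite scaleN1r addr0 -(normrN l); exact: hK.
Qed.

Lemma foldr_opp (h : V -> C) s l : csmooth h ->
  normc (foldr cpd (fun y => h (- y)) s l) = normc (foldr cpd h s (- l)).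
Proof.
move=> sh; rewrite (_ : (fun y => _) = fun l => h ((-1) *: l + 0)).
  rewrite (@foldr_affine _ _ h)// normcM normcX normc_real normrN normr1 expr1n mul1r.
  by rewrite scaleN1r addr0.
by apply/funext => y; rewrite scaleN1r addr0.
Qed.

(** The inverse Fourier transform of the bump at [x], written as a reflected Fourier transform. *)
Definition antifourier (a : R) (x : V) (l : V) : C :=
  inversion_cst^-1 * fourier (cutoff a x) (- l).

Lemma cschwartz_antifourier a x : 0 < a -> cschwartz (antifourier a x).
Proof.
move=> a0; apply: cschwartzZ; apply: (@cschwartz_opp (fourier (cutoff a x))).
exact: cschwartz_fourier (cschwartz_cutoff x a0).
Qed.

Lemma fourier_antifourier a x : 0 < a -> fourier (antifourier a x) = cutoff a x.
Proof.
move=> a0; apply/funext => y; rewrite /antifourier fourierZ; last first.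
  apply: cschwartz_cdom; apply: (@cschwartz_opp (fourier (cutoff a x))).
  exact: cschwartz_fourier (cschwartz_cutoff x a0).
by rewrite (fourier_inversion_bumpprod x a0 y) mulrA mulVf ?mul1r// inversion_cst_neq0.
Qed.

Lemma normc_prod (I : Type) (r : seq I) (F : I -> C) :
  normc (\prod_(i <- r) F i) = \prod_(i <- r) normc (F i).
Proof.
elim: r => [|i r IH]; last by rewrite !big_cons normcM IH.
by rewrite !big_nil ComplexField.Normc.normc1.
Qed.

(** A derivative is the transform of a monomial times the bump. As [2 <= a], the bump lives within
    distance 1 of [x], so the monomial is at most a power of 2 (1 + |x|) there, and the integral of
    the bump is its mass. No weight in [l] appears: it would turn into derivatives of the bump, that
    is, into powers of [a]. *)
Lemma antifourier_deriv_le m : exists2 c : R, 0 <= c & forall a (x : V) s l, 2 <= a ->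
  (size s <= m)%N ->
  normc (foldr cpd (antifourier a x) s l) <= c * (1 + `|x|) ^+ m * bumpmass a x.
Proof.
have cf0 := @cfourier_gt0 R n.
exists (normc (inversion_cst^-1) * ((@cfourier R n) * (2 * 2 ^+ m))).
  by rewrite !mulr_ge0 ?normc_ge0 ?exprn_ge0// ltW.
move=> a x s l a2 sm; have a0 : 0 < a by apply: lt_le_trans a2.
have sg := cschwartz_cutoff x a0.
have sh := cschwartz_fourier sg.
have so := cschwartz_opp sh.
rewrite /antifourier (foldrZ _ _ so.1) normcM -!mulrA; apply: ler_wpM2l; first exact: normc_ge0.
rewrite foldr_opp; last exact: sh.1.
have [-> sx] := foldr_fourier s sg.
rewrite fourierE normcM normc_real gtr0_norm//; apply: ler_wpM2l; first exact: ltW.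
rewrite !mulrA; rewrite -[2 * 2 ^+ m * _]mulrA -exprMn.
apply: cintegral_le_bumpprod => //; first exact: cdom_wave (cschwartz_cdom sx).
move=> y; rewrite normcM normc_wave mulr1 foldr_xmulE !normcM normcX normcN.
rewrite ComplexField.Normc.normc1 expr1n mul1r normc_prod.
have -> : normc (cutoff a x y) = bumpprod a x y.
  by rewrite /cutoff normc_real ger0_norm// bumpprod_ge0.
have [yx|yx] := leP (2 / a) `|y - x|.
  by rewrite (@bumpprod_eq0 _ _ a x a0 y)// !mulr0.
apply: ler_wpM2r; first exact: bumpprod_ge0.
have y1 : 1 <= 2 * (1 + `|x|) by have := normr_ge0 x; lra.
have yn : `|y| <= 2 * (1 + `|x|).
  have : 2 / a <= 1 by rewrite ler_pdivrMr// mul1r.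
  have := lerB_dist y x; have := normr_ge0 x; lra.
apply: (@le_trans _ _ ((2 * (1 + `|x|)) ^+ size s)); last by rewrite ler_weXn2l.
elim: s {sm sx} => [|j s IH]; first by rewrite big_nil.
rewrite big_cons exprS; apply: ler_pM => //; first exact: normc_ge0.
  by apply: prodr_ge0 => i _; exact: normc_ge0.
by rewrite normc_imag; apply: le_trans (coord_le_norm y j) yn.
Qed.

End Mollifier.

(** * Growth of the iterates from a bound on the symbol over the support *)

Section UpperBound.
Context {R : realType} {n : nat}.
Local Notation C := R[i].
Local Notation V := 'rV[R]_n.
Variables (P : mpoly.mpoly n C) (f : V -> C) (T : (V -> C) -> C).
Hypotheses (sf : csmooth f) (tT : ctempered T) (eT : extends_function f T).

Lemma growth_le_symbol (r : R) : 0 < r -> compact (dist_supp (dist_fourier T)) ->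
  (forall l, dist_supp (dist_fourier T) l -> normc (symbol P l) < r) ->
  exists (N : nat) (c : R), 0 <= c /\
    forall (k : nat) x, (0 < k)%N -> normc (iter k (diffop P) f x) <=
      c * k%:R ^+ N * r ^+ k * (1 + enorm x) ^+ N.
Proof.
move=> r0 cK Kr; have ss := @smooth_symbol _ _ P.
have tS : ctempered (dist_fourier T) := ctempered_fourier tT.
have [psi [spsi [A psiA] psi0 psiS]] :=
  dist_supp_localize tS cK (@open_normc_lt _ _ (symbol P) r ss) Kr.
have [_ [m [cS [cS0 HS]]]] := tS.
have [c1 c10 H1] := power_sbound m A ss r0.
have [c2 c20 H2] := @antifourier_deriv_le R n m.
have [B psiB] := (compact_support_cschwartz spsi psiA).2 m.
have B0 := sbound_ge0 psiB.
have D0 : 0 <= cS * (c1 * (2 ^+ m * B * c2)) by rewrite !mulr_ge0// exprn_ge0.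
(* The inner power of 2 comes from the Leibniz rule for [psi] times [u]; the outer one replaces k +
   1 by 2 k, which uses [0 < k]. *)
exists m, (cS * (c1 * (2 ^+ m * B * c2)) * 2 ^+ m); split.
  by rewrite mulr_ge0// exprn_ge0.
move=> k x k0; apply: mollifier_bound; first exact: smooth_iter_diffop.
move=> a a2; have a0 : 0 < a by apply: lt_le_trans a2.
have I0 := bumpmass_gt0 x a0.
have su := cschwartz_antifourier x a0; set u := antifourier a x in su.
have far : forall y, 2 / a + `|x| < `|y| -> cutoff a x y = 0.
  move=> y ya; rewrite cutoff_eq0//; apply: le_trans (lerB_dist y x).
  by rewrite lerBrDr ltW.
(* The average of the iterate over the bump is carried along the chain: [T] of the iterated
   transpose of the bump, then S(p^k u) with F u equal to the bump, then S(p^k psi u) by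
   localization. *)
rewrite -(@T_iter_adjop _ _ P f T sf eT k _ _ (smooth_cutoff a x) far).
rewrite -(fourier_antifourier x a0) -/u.
have [-> spu] := iter_adjop_fourier P k su.
rewrite -/(dist_fourier T _) psiS//.
rewrite (_ : (fun l => _) = fun l => symbol P l ^+ k * (psi l * u l)); last first.
  by apply/funext => l; rewrite mulrCA.
have spu' : csmooth (fun l => psi l * u l) := smoothM spsi su.1.
have pu0 l : A < `|l| -> psi l * u l = 0 by move=> /psiA ->; rewrite mul0r.
pose Q := 2 ^+ m * B * (c2 * (1 + `|x|) ^+ m * bumpmass a x).
have Q0 : 0 <= Q.
  by rewrite /Q !mulr_ge0 ?exprn_ge0 ?addr_ge0// ltW.
have bQ s : (size s <= m)%N -> forall l, normc (foldr cpd (fun l => psi l * u l) s l) <= Q.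
  move=> sm l; apply: (leibniz_bound spsi su.1 _ _ sm) => s' sm'; last exact: H2.
  apply: le_trans (psiB s' sm' l); by rewrite ler_peMl ?normc_ge0 ?norm1X_ge1.
have pr l : r < normc (symbol P l) -> psi l * u l = 0.
  move=> rl; rewrite psi0 ?mul0r//= => lr; move: (lt_trans lr rl); by rewrite ltxx.
have F := H1 _ k Q spu' pu0 pr Q0 bQ.
have scu : cschwartz (fun l => symbol P l ^+ k * (psi l * u l)).
  exact: cschwartzM_far (smoothX k ss) spu' pu0.
apply: le_trans (HS _ _ scu F) _.
rewrite /Q [leLHS](_ : _ = cS * (c1 * (2 ^+ m * B * c2)) * k.+1%:R ^+ m * r ^+ k *
  (1 + `|x|) ^+ m * bumpmass a x); last by ring.
rewrite ler_wpM2r ?(ltW I0)//.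
apply: ler_pM; rewrite ?mulr_ge0 ?exprn_ge0 ?addr_ge0 ?(ltW r0)//; last first.
  rewrite lerXn2r ?nnegrE ?addr_ge0 ?sqrtr_ge0// lerD2l; exact: norm_le_enorm.
rewrite ler_wpM2r ?exprn_ge0 ?(ltW r0)// -[leRHS]mulrA -exprMn ler_wpM2l//.
rewrite lerXn2r ?nnegrE ?mulr_ge0// -natr1.
have : 1 <= k%:R :> R by rewrite ler1n.
lra.
Qed.

End UpperBound.

Theorem theorem2p14 (R : realType) (d : nat) (hd : (0 < d)%N)
    (f : 'rV[R]_d -> R[i]) (T : ('rV[R]_d -> R[i]) -> R[i])
    (P : mpoly.mpoly d R[i]) :
  smooth f ->
  tempered_distribution T ->
  extends_function f T ->
  compact (dist_supp (dist_fourier T)) ->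
  Rtilde P f = Rsupp P (dist_fourier T).
Proof.
move=> /csmoothP sf /tempered_ctempered tT eT cK.
have tS : ctempered (dist_fourier T) := ctempered_fourier tT.
apply/eqP; rewrite eq_le; apply/andP; split; last first.
  apply: le_ereal_inf_tmp => _ [r [r0 [N [c [c0 H]]]] <-].
  (* In the case where [Rsupp] is 0 by convention, the inequality is just [0 <= r]. *)
  rewrite /Rsupp; case: asboolP => _; first by rewrite lee_fin.
  apply: ge_ereal_sup => _ [l Kl <-]; rewrite lee_fin.
  exact: (symbol_le_growth sf tT eT r0 c0 H).
(* The upper estimate asks for a strict bound of the symbol by a positive rate; [q + e] provides
   both, and the infimum lets [e] tend to 0. *)
have upper (q : R) : 0 <= q ->
    (forall l, dist_supp (dist_fourier T) l -> normc (symbol P l) <= q) ->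
    (Rtilde P f <= q%:E)%E.
  move=> q0 Hq; apply/lee_addgt0Pr => e e0.
  apply: ereal_inf_lbound; exists (q + e) => //; split; first by rewrite addr_ge0// ltW.
  have qe0 : 0 < q + e by rewrite ltr_wpDl.
  apply: (growth_le_symbol sf tT eT qe0 cK) => l Kl.
  by apply: le_lt_trans (Hq l Kl) _; rewrite ltrDl.
rewrite /Rsupp; case: asboolP => [vS|nvS].
  (* The whole space is an open set on which the distribution vanishes, so the support is empty and
     [q = 0] is admissible. *)
  apply: upper => // l; case; exists setT => //; split => //.
  exact: openT.
set E := (X in (_ <= ereal_sup X)%E).
(* The supremum over an empty support would be [-oo]. A distribution that does not vanish has a
   point in its support, so the supremum is nonnegative, and either a real number or [+oo]. *)
have [l0 Kl0] : dist_supp (dist_fourier T) !=set0.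
  apply/set0P/eqP => K0; apply: nvS => phi tphi _.
  by apply: (dist_supp_vanish tS tphi) => y _; rewrite K0.
have E0 : (0 <= ereal_sup E)%E.
  apply: (@le_trans _ _ (normc (symbol P l0))%:E); first by rewrite lee_fin normc_ge0.
  by apply: ereal_sup_ubound; exists l0.
case sE : (ereal_sup E) E0 => [q| |] //= q0; last by rewrite leey.
apply: upper => // l Kl; rewrite -lee_fin -sE.
by apply: ereal_sup_ubound; exists l.
Qed.
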